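(* Fix $\alpha\in(0,1]$ and $0<\beta<\alpha$. Let $\{X^{\epsilon}\}_{\epsilon>0}$ be a family of real valued $\alpha$-H\''older continuous semi-martingales on $[0,1]$ and let $\{A^{\epsilon}\}_{\epsilon>0}$ be a family of real valued adapted continuous processes on $[0,1]$ such that the It\^o integral satisfies $A^{\epsilon}\cdot X^{\epsilon}\in C^{\alpha\text{-Hld}}([0,1],\mathbb{R})$ for every $\epsilon$. Assume that $\{(A^{\epsilon},X^{\epsilon})\}_{\epsilon>0}$ satisfies the LDP on $C([0,1],\mathbb{R})\times C_0^{\alpha\text{-Hld}}([0,1],\mathbb{R})$ with speed $\epsilon^{-1}$ with good rate function $I^{\#}$. If $\{X^{\epsilon}\}_{\epsilon>0}$ is $\alpha$-Uniformly Exponentially Tight, then $\{(A^{\epsilon},X^{\epsilon},A^{\epsilon}\cdot X^{\epsilon})\}_{\epsilon>0}$ satisfies the LDP on $C([0,1],\mathbb{R})\times C_0^{\alpha\text{-Hld}}([0,1],\mathbb{R})\times C_0^{\beta\text{-Hld}}([0,1],\mathbb{R})$ with speed $\epsilon^{-1}$ with good rate function $$I(a,x,z)=\begin{cases} I^{\#}(a,x), & z=a\cdot x,\ x\in\mathbf{BV},\\ +\infty, & \text{otherwise},\end{cases}$$ where $a\cdot x=\int_0^{\cdot}a_r\,\mathrm{d}x_r$ is the Riemann--Stieltjes integral.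
   Context: A filtered probability space $(\Omega,\mathcal{F},(\mathcal{F}_t)_{t\ge0},\mathsf{P})$ satisfying the usual conditions is fixed; adaptedness and semi-martingales refer to it. The index $\epsilon$ ranges over $(0,1]$. For a semi-martingale $X$ and a suitable adapted process $U$, $(U\cdot X)_t=\int_0^tU_r\,\mathrm{d}X_r$ is the It\^o integral. $C([0,1],\mathbb{R})$ carries the uniform topology. For $\alpha\in(0,1]$, $C^{\alpha\text{-Hld}}([0,1],\mathbb{R})$ is the H\''older space with norm $\|x\|_{\alpha\text{-Hld}}=|x_0|+\sup_{0\le s<t\le1}\frac{|x_t-x_s|}{|t-s|^{\alpha}}$, and $C_0^{\alpha\text{-Hld}}([0,1],\mathbb{R})$ is the subspace of those $x$ with $\lim_{\delta\searrow0}\sup_{|t-s|\le\delta}\frac{|x_t-x_s|}{|t-s|^{\alpha}}=0$ (same norm). $\mathbf{BV}$ is the set of functions on $[0,1]$ of bounded variation. A family $\{X^{\epsilon}\}_{\epsilon>0}$ of real valued continuous semi-martingales on $[0,1]$ is $\alpha$-Uniformly Exponentially Tight if for all $M>0$ there exists $K_M>0$ such that $$\limsup_{\epsilon\searrow0}\epsilon\log\sup_{U\in\mathcal{B}([0,1],\mathbb{R})}\mathsf{P}\left[\|U\cdot X^{\epsilon}\|_{\alpha\text{-Hld}}\ge K_M\right]\le -M,$$ where $\mathcal{B}([0,1],\mathbb{R})$ is the set of all adapted, left continuous with right limits processes $U$ on $[0,1]$ with $\sup_{t\in[0,1]}|U_t|\le1$. A good rate function on a metric space $E$ is $I:E\to[0,\infty]$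 with compact level sets $\{I\le\lambda\}$, $\lambda\in[0,\infty)$. A family of $E$-valued random variables $\{\xi^\epsilon\}$ satisfies the LDP with speed $\epsilon^{-1}$ with good rate function $I$ if for all Borel $\Gamma\subset E$, $-\inf_{\Gamma^{o}}I\le\liminf_{\epsilon\searrow0}\epsilon\log\mathsf{P}[\xi^\epsilon\in\Gamma]\le\limsup_{\epsilon\searrow0}\epsilon\log\mathsf{P}[\xi^\epsilon\in\Gamma]\le-\inf_{\overline{\Gamma}}I$. *)

(* Defs.v *)
From HB Require Import structures.
From mathcomp Require Import all_boot all_order all_algebra.
From mathcomp Require Import all_classical all_reals all_analysis.
From mathcomp Require Import ring.
Set Implicit Arguments.
Unset Strict Implicit.
Unset Printing Implicit Defensive.
Import Order.TTheory GRing.Theory Num.Theory.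
Import numFieldNormedType.Exports.
Local Open Scope classical_set_scope.
Local Open Scope ring_scope.


Section norms.
Context {R : realType}.
Implicit Types (f g : R -> R) (alpha delta : R).

Definition unif_norm f : \bar R :=
  ereal_sup [set h : \bar R | exists2 t : R, 0 <= t <= 1 & h = `|f t|%:E].

Definition hld_quot alpha f (s t : R) : R := `|f t - f s| / (t - s) `^ alpha.

Definition hld_seminorm alpha f : \bar R :=
  ereal_sup [set h : \bar R | exists s t : R,
     [/\ 0 <= s, s < t, t <= 1 & h = (hld_quot alpha f s t)%:E]].

Definition hld_norm alpha f : \bar R := (`|f 0|%:E + hld_seminorm alpha f)%E.

Definition hld_modulus alpha f delta : \bar R :=
  ereal_sup [set h : \bar R | exists s t : R,
     [/\ 0 <= s, s < t, t <= 1, t - s <= delta &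
         h = (hld_quot alpha f s t)%:E]].

Arguments unif_norm f%_R.
Arguments hld_quot alpha%_R f%_R (s t)%_R.
Arguments hld_norm alpha%_R f%_R.

(* A function on [0, 1] is represented by its extension to R that is constant
   on each side of [0, 1], so that equality of representatives is equality of
   functions on [0, 1]. *)
Definition clamp01 (t : R) : R := Num.max 0 (Num.min t 1).

Lemma clamp01_itv t : 0 <= clamp01 t <= 1.
Proof.
by rewrite /clamp01 le_max lexx/= ge_max ler01 ge_min lexx orbT.
Qed.

Lemma unif_norm_ge0 f : (0 <= unif_norm f)%E.
Proof.
apply: (@le_trans _ _ (`|f 0|%:E)); first by rewrite lee_fin.
by apply: ereal_sup_ubound; exists 0; rewrite // lexx ler01.
Qed.

Lemma unif_norm_ub f t : 0 <= t <= 1 -> (`|f t|%:E <= unif_norm f)%E.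
Proof. by move=> t01; apply: ereal_sup_ubound; exists t. Qed.

Lemma unif_norm0 : unif_norm (fun=> 0) = 0%E.
Proof.
apply/eqP; rewrite eq_le unif_norm_ge0 andbT.
by apply: ge_ereal_sup => _ [t _ ->]; rewrite normr0.
Qed.

Lemma unif_norm_triangle f g h :
  (unif_norm (f \- h) <= unif_norm (f \- g) + unif_norm (g \- h))%E.
Proof.
apply: ge_ereal_sup => _ [t t01 ->].
apply: (@le_trans _ _ (`|(f \- g) t|%:E + `|(g \- h) t|%:E)%E).
  by rewrite -EFinD lee_fin ler_distD.
by apply: leeD; apply: unif_norm_ub.
Qed.

Lemma unif_norm_sym f g : unif_norm (f \- g) = unif_norm (g \- f).
Proof.
congr ereal_sup; apply/seteqP.
by split=> _ [t t01 ->]; exists t; rewrite //= distrC.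
Qed.

Let hsup_ge0 alpha f : (0 <= hld_seminorm alpha f)%E.
Proof.
apply: (@le_trans _ _ ((hld_quot alpha f 0 1)%:E)).
  by rewrite lee_fin divr_ge0// powR_ge0.
by apply: ereal_sup_ubound; exists 0, 1.
Qed.

Lemma hld_norm_ge0 alpha f : (0 <= hld_norm alpha f)%E.
Proof. by apply: adde_ge0; [rewrite lee_fin|exact: hsup_ge0]. Qed.

Lemma hld_norm_ub0 alpha f : (`|f 0|%:E <= hld_norm alpha f)%E.
Proof. by rewrite /hld_norm leeDl// hsup_ge0. Qed.

Lemma hld_norm_ub alpha f s t : 0 <= s -> s < t -> t <= 1 ->
  ((hld_quot alpha f s t)%:E <= hld_norm alpha f)%E.
Proof.
move=> s0 st t1; apply: (@le_trans _ _ (hld_seminorm alpha f)).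
  by apply: ereal_sup_ubound; exists s, t.
by rewrite /hld_norm leeDr.
Qed.

Lemma hld_norm0 alpha : hld_norm alpha (fun=> 0) = 0%E.
Proof.
rewrite /hld_norm normr0 add0e; apply/eqP; rewrite eq_le hsup_ge0 andbT.
apply: ge_ereal_sup => _ [s [t [_ _ _ ->]]].
by rewrite /hld_quot subrr normr0 mul0r.
Qed.

Lemma hld_norm_triangle alpha f g h :
  (hld_norm alpha (f \- h) <= hld_norm alpha (f \- g) + hld_norm alpha (g \- h))%E.
Proof.
rewrite /hld_norm addeACA; apply: leeD; first by rewrite -EFinD lee_fin ler_distD.
apply: ge_ereal_sup => _ [s [t [s0 st t1 ->]]].
apply: (@le_trans _ _ ((hld_quot alpha (f \- g) s t)%:E +
                       (hld_quot alpha (g \- h) s t)%:E)%E).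
  rewrite -EFinD lee_fin /hld_quot -mulrDl ler_wpM2r ?invr_ge0 ?powR_ge0//=.
  apply: le_trans (ler_normD _ _); rewrite le_eqVlt; apply/orP; left.
  by apply/eqP; congr `| _ |; rewrite opprB !opprD !opprK; ring.
by apply: leeD; apply: ereal_sup_ubound; exists s, t.
Qed.

Lemma hld_norm_sym alpha f g : hld_norm alpha (f \- g) = hld_norm alpha (g \- f).
Proof.
have E u v s t : hld_quot alpha (u \- v) s t = hld_quot alpha (v \- u) s t.
  by rewrite /hld_quot/= -normrN; congr (`| _ | / _); ring.
rewrite /hld_norm /= distrC; congr (_ + ereal_sup _)%E.
by apply/seteqP; split=> _ [s [t [? ? ? ->]]]; exists s, t; split; rewrite // E.
Qed.

Lemma hld_norm_eq0 alpha f t : hld_norm alpha f = 0%E -> 0 <= t <= 1 -> f t = 0.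
Proof.
move=> f0 /andP[t0 t1].
have f00 : f 0 = 0.
  by have := hld_norm_ub0 alpha f; rewrite f0 lee_fin normr_le0 => /eqP.
move: t0; rewrite le_eqVlt => /predU1P[<-//|t0].
have := hld_norm_ub alpha f (lexx 0) t0 t1.
rewrite f0 lee_fin /hld_quot f00 !subr0 pmulr_lle0 ?invr_gt0 ?powR_gt0//.
by rewrite normr_le0 => /eqP.
Qed.

End norms.
Arguments unif_norm {R} f%_R.
Arguments hld_quot {R} alpha%_R f%_R (s t)%_R.
Arguments hld_norm {R} alpha%_R f%_R.

Record C01 (R : realType) := MkC01 {
  C01_fun :> R -> R ;
  C01_clamp : forall t, C01_fun t = C01_fun (clamp01 t) ;
  C01_cont : {within `[0, 1], continuous C01_fun} }.

Record CHld (R : realType) (alpha : R) := MkCHld {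
  CHld_fun :> R -> R ;
  CHld_clamp : forall t, CHld_fun t = CHld_fun (clamp01 t) ;
  CHld_fin : (hld_norm alpha CHld_fun < +oo)%E }.

Record C0Hld (R : realType) (alpha : R) := MkC0Hld {
  C0Hld_fun :> R -> R ;
  C0Hld_clamp : forall t, C0Hld_fun t = C0Hld_fun (clamp01 t) ;
  C0Hld_fin : (hld_norm alpha C0Hld_fun < +oo)%E ;
  C0Hld_van : hld_modulus alpha C0Hld_fun delta @[delta --> 0^'+] --> 0%E }.

Section C01_metric.
Context {R : realType}.
Implicit Types x y z : C01 R.

Let eqC x y : (x : R -> R) = y -> x = y.
Proof.
case: x y => [f f1 f2] [g g1 g2] /= fg; subst g.
by rewrite (Prop_irrelevance f1 g1) (Prop_irrelevance f2 g2).
Qed.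

HB.instance Definition _ := gen_eqMixin (C01 R).
HB.instance Definition _ := gen_choiceMixin (C01 R).

Lemma C01_unif_fin x y : unif_norm (x \- y) \is a fin_num.
Proof.
have bnd (f : R -> R) : {within `[0, 1], continuous f} ->
    exists M, forall t : R, 0 <= t <= 1 -> `|f t| <= M.
  move=> cf.
  have [c _ fc] := EVT_max (@ler01 R) cf.
  have [e _ fe] := EVT_min (@ler01 R) cf.
  exists (`|f c| + `|f e|) => t t01.
  have := fc t; rewrite in_itv/= => /(_ t01) h1.
  have := fe t; rewrite in_itv/= => /(_ t01) h2.
  rewrite ler_norml; apply/andP; split.
    rewrite (le_trans _ h2)// lerNl (le_trans (ler_norm _))// normrN.
    by rewrite lerDr.
  by rewrite (le_trans h1)// (le_trans (ler_norm _))// lerDl.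
have [M xM] := bnd _ (@C01_cont _ x).
have [N yN] := bnd _ (@C01_cont _ y).
rewrite ge0_fin_numE ?unif_norm_ge0//.
apply: (@le_lt_trans _ _ (M + N)%:E); last exact: ltry.
apply: ge_ereal_sup => _ [t t01 ->]; rewrite lee_fin/=.
by rewrite (le_trans (ler_normB _ _))// lerD ?xM ?yN.
Qed.

Definition C01_dist x y : R := fine (unif_norm (x \- y)).

Let distxx x : C01_dist x x = 0.
Proof.
rewrite /C01_dist (_ : _ \- _ = fun=> 0) ?unif_norm0//.
by apply/funext => t /=; rewrite subrr.
Qed.

Let dist_pos x y : C01_dist x y = 0 -> x = y.
Proof.
move=> xy; apply: eqC; apply/funext => t.
rewrite (C01_clamp x) (C01_clamp y); apply/eqP; rewrite -subr_eq0 -normr_le0.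
rewrite -lee_fin -[X in (_ <= X%:E)%E]xy fineK ?C01_unif_fin//.
exact: (unif_norm_ub (x \- y) (clamp01_itv t)).
Qed.

Let dist_sym x y : C01_dist x y = C01_dist y x.
Proof. by rewrite /C01_dist unif_norm_sym. Qed.

Let dist_tri y x z : C01_dist x z <= C01_dist x y + C01_dist y z.
Proof.
rewrite /C01_dist -fineD ?C01_unif_fin// fine_le ?fin_numD ?C01_unif_fin//.
exact: unif_norm_triangle.
Qed.

HB.instance Definition _ :=
  @isMetric.Build R (C01 R) C01_dist distxx dist_pos dist_sym dist_tri.

End C01_metric.

Section C0Hld_metric.
Context {R : realType} {alpha : R}.
Implicit Types x y z : C0Hld alpha.

Let eqC x y : (x : R -> R) = y -> x = y.
Proof.
case: x y => [f f1 f2 f3] [g g1 g2 g3] /= fg; subst g.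
by rewrite (Prop_irrelevance f1 g1) (Prop_irrelevance f2 g2) (Prop_irrelevance f3 g3).
Qed.

HB.instance Definition _ := gen_eqMixin (C0Hld alpha).
HB.instance Definition _ := gen_choiceMixin (C0Hld alpha).

Lemma C0Hld_norm_fin x y : hld_norm alpha (x \- y) \is a fin_num.
Proof.
rewrite ge0_fin_numE ?hld_norm_ge0//.
apply: (le_lt_trans (hld_norm_triangle alpha x (fun=> 0) y)).
rewrite (hld_norm_sym alpha (fun=> 0) y).
have sub0 (f : R -> R) : f \- (fun=> 0) = f by apply/funext => t /=; rewrite subr0.
by rewrite !sub0 lte_add_pinfty ?C0Hld_fin.
Qed.

Definition C0Hld_dist x y : R := fine (hld_norm alpha (x \- y)).

Let distxx x : C0Hld_dist x x = 0.
Proof.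
rewrite /C0Hld_dist (_ : _ \- _ = fun=> 0) ?hld_norm0//.
by apply/funext => t /=; rewrite subrr.
Qed.

Let dist_pos x y : C0Hld_dist x y = 0 -> x = y.
Proof.
move=> xy; apply: eqC; apply/funext => t.
rewrite (C0Hld_clamp x) (C0Hld_clamp y); apply/eqP; rewrite -subr_eq0; apply/eqP.
apply: (@hld_norm_eq0 _ alpha (x \- y) _ _ (clamp01_itv t)).
by rewrite -(fineK (C0Hld_norm_fin x y)) -/(C0Hld_dist x y) xy.
Qed.

Let dist_sym x y : C0Hld_dist x y = C0Hld_dist y x.
Proof. by rewrite /C0Hld_dist hld_norm_sym. Qed.

Let dist_tri y x z : C0Hld_dist x z <= C0Hld_dist x y + C0Hld_dist y z.
Proof.
rewrite /C0Hld_dist -fineD ?C0Hld_norm_fin//; apply: fine_le.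
- exact: C0Hld_norm_fin.
- by rewrite fin_numD; apply/andP; split; exact: C0Hld_norm_fin.
- exact: hld_norm_triangle.
Qed.

HB.instance Definition _ :=
  @isMetric.Build R (C0Hld alpha) C0Hld_dist distxx dist_pos dist_sym dist_tri.

End C0Hld_metric.

Section embedding.
Context {R : realType} {alpha beta : R}.
Hypothesis beta_lt_alpha : beta < alpha.
Variable z : CHld alpha.

Let K := fine (hld_norm alpha z).

Let quot_le (s t : R) : 0 <= s -> s < t -> t <= 1 ->
  hld_quot beta z s t <= K * (t - s) `^ (alpha - beta).
Proof.
move=> s0 st t1; have ts0 : 0 < t - s by rewrite subr_gt0.
have Kfin : hld_norm alpha z \is a fin_num.
  by rewrite ge0_fin_numE ?hld_norm_ge0 ?CHld_fin.
have : hld_quot alpha z s t <= K by rewrite -lee_fin fineK// hld_norm_ub.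
rewrite /hld_quot ler_pdivrMr ?powR_gt0// => h.
rewrite ler_pdivrMr ?powR_gt0// -mulrA -powRD ?subrK//.
by apply/implyP => _; rewrite gt_eqF.
Qed.

Let K0 : 0 <= K. Proof. by rewrite fine_ge0 ?hld_norm_ge0. Qed.

Lemma CHld_fin_lt : (hld_norm beta z < +oo)%E.
Proof.
rewrite lte_add_pinfty ?ltry//.
apply: (@le_lt_trans _ _ K%:E); last exact: ltry.
apply: ge_ereal_sup => _ [s [t [s0 st t1 ->]]]; rewrite lee_fin.
apply: le_trans (quot_le s0 st t1) _; apply: ler_piMr => //.
have <- : 1 `^ (alpha - beta) = 1 :> R by rewrite powR1.
have ts1 : t - s <= 1 by rewrite lerBlDr (le_trans t1)// lerDl.
by apply: ge0_ler_powR; rewrite // ?nnegrE ?ler01// subr_ge0 ltW.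
Qed.

Lemma CHld_van_lt : hld_modulus beta z delta @[delta --> 0^'+] --> 0%E.
Proof.
have ab0 : 0 < alpha - beta by rewrite subr_gt0.
have gK : (K * delta `^ (alpha - beta))%:E @[delta --> (0:R)^'+] --> 0%E.
  apply: cvg_EFin; first by near=> d.
  rewrite -[X in _ --> X](mulr0 K).
  by apply: cvgMl_tmp; exact: powR_cvg0.
apply: (@squeeze_cvge _ _ _ _ (fun=> 0%E) _ (fun d => (K * d `^ (alpha - beta))%:E));
  [|exact: cvg_cst|exact: gK].
near=> d.
have d0 : 0 < d by near: d; exact: nbhs_right_gt.
have d1 : d <= 1 by near: d; apply: nbhs_right_le.
apply/andP; split.
  apply: (@le_trans _ _ ((hld_quot beta z 0 d)%:E)).
    by rewrite lee_fin divr_ge0// powR_ge0.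
  by apply: ereal_sup_ubound; exists 0, d; rewrite subr0 lexx.
apply: ge_ereal_sup => _ [s [t [s0 st t1 td ->]]]; rewrite lee_fin.
apply: le_trans (quot_le s0 st t1) _; apply: ler_wpM2l => //.
by apply: ge0_ler_powR; rewrite // ?nnegrE ?subr_ge0 ltW.
Unshelve. all: by end_near. Qed.

Definition CHld_C0Hld : C0Hld beta :=
  MkC0Hld (@CHld_clamp _ _ z) CHld_fin_lt CHld_van_lt.

End embedding.


Section processes.
Context {R : realType} {d : measure_display} {T : measurableType d}.
Variables (P : probability T R) (F : R -> set_system T).
Implicit Types (X Y U V M : T -> R -> R) (tau : T -> \bar R).

(* [F t] is relevant for [0 <= t] only. *)
Definition usual_filtration :=
  [/\ forall t : R, 0 <= t -> sigma_algebra setT (F t),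
      forall t : R, 0 <= t -> F t `<=` measurable,
      forall s t : R, 0 <= s -> s <= t -> F s `<=` F t,
      forall t : R, 0 <= t -> F t = \bigcap_(s in [set s | t < s]) F s &
      forall N, P.-negligible N -> F 0 N].

Definition adapted X := forall t : R, 0 <= t <= 1 ->
  forall B : set R, measurable B -> F t ((X ^~ t) @^-1` B).

Definition continuous_paths X := forall w, {within `[0, 1], continuous (X w)}.

Definition stopping_time tau :=
  (forall w, (0 <= tau w)%E) /\
  (forall t : R, 0 <= t -> F t [set w | (tau w <= t%:E)%E]).

Definition stopped X tau : T -> R -> R :=
  fun w t => X w (fine (mine t%:E (tau w))).

Definition stopped_sigma tau : set_system T := [set B | measurable B /\
  forall t : R, 0 <= t -> F t (B `&` [set w | (tau w <= t%:E)%E])].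

(* The last condition is E[M_t | F_s] = M_s. *)
Definition martingale M :=
  [/\ adapted M,
      forall t : R, 0 <= t <= 1 -> P.-integrable setT (fun w => (M w t)%:E) &
      forall s t : R, 0 <= s -> s <= t -> t <= 1 -> forall B, F s B ->
        (\int[P]_(w in B) (M w t)%:E = \int[P]_(w in B) (M w s)%:E)%E].

Definition continuous_local_martingale M :=
  [/\ adapted M, continuous_paths M &
      exists tau : nat -> T -> \bar R,
        [/\ forall n, stopping_time (tau n),
            forall n w, (tau n w <= tau n.+1 w)%E,
            {ae P, forall w, tau n w @[n --> \oo] --> +oo%E} &
            forall n, martingale (stopped M (tau n))]].

Definition continuous_semimartingale X :=
  [/\ adapted X, continuous_paths X &
      exists M V : T -> R -> R,
        [/\ continuous_local_martingale M,
            adapted V /\ continuous_paths V,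
            forall w, bounded_variation 0 1 (V w),
            forall w, M w 0 = 0 /\ V w 0 = 0 &
            forall w (t : R), 0 <= t <= 1 -> X w t = X w 0 + M w t + V w t]].

(** The Ito integral. Simple predictable processes are of the form
    H_0 1_{0} + \sum_(i < n) H_i 1_(tau_i, tau_(i+1)] with the tau_i stopping
    times and H_i measurable for F_(tau_i). The integral of a left continuous
    adapted U is the limit, uniformly on [0, 1] in probability, of the
    elementary integrals of simple predictable processes converging to U in the
    same sense; when X is a semimartingale this limit does not depend on the
    approximating sequence. It is defined only up to indistinguishability, hence
    a relation. *)
Record simple_process := MkSimple {
  sp_size : nat ;
  sp_init : T -> R ;
  sp_time : nat -> T -> \bar R ;
  sp_val : nat -> T -> R ;
  sp_initF : forall B : set R, measurable B -> F 0 (sp_init @^-1` B) ;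
  sp_time0 : forall w, sp_time 0%N w = 0%E ;
  sp_time_le : forall i w, (sp_time i w <= sp_time i.+1 w)%E ;
  sp_stop : forall i, stopping_time (sp_time i) ;
  sp_valF : forall i (B : set R), measurable B ->
    stopped_sigma (sp_time i) (sp_val i @^-1` B) }.

Definition simple_eval (H : simple_process) : T -> R -> R := fun w t =>
  sp_init H w * (t == 0)%:R + \sum_(i < sp_size H)
    sp_val H i w * ((sp_time H i w < t%:E) && (t%:E <= sp_time H i.+1 w))%E%:R.

Definition simple_integral (H : simple_process) X : T -> R -> R := fun w t =>
  \sum_(i < sp_size H) sp_val H i w *
    (stopped X (sp_time H i.+1) w t - stopped X (sp_time H i) w t).

Definition ucp (Y_ : nat -> T -> R -> R) Y := forall e : R, 0 < e ->
  P [set w | (e%:E < unif_norm (Y_ n w \- Y w))%E] @[n --> \oo] --> 0%E.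

Definition is_ito_integral U X Y :=
  [/\ adapted Y, continuous_paths Y &
      exists H : nat -> simple_process,
        ucp (fun n => simple_eval (H n)) U /\
        ucp (fun n => simple_integral (H n) X) Y].

Definition unit_integrand U :=
  [/\ adapted U,
      forall w (t : R), 0 < t <= 1 -> U w s @[s --> t^'-] --> U w t,
      forall w (t : R), 0 <= t < 1 -> cvg (U w s @[s --> t^'+]) &
      forall w (t : R), 0 <= t <= 1 -> `|U w t| <= 1].

Definition unif_exp_tight (alpha : R) (X : R -> T -> R -> R) :=
  forall M : R, 0 < M -> exists2 K : R, 0 < K &
    (limf_esup (fun e : R => e%:E * lne (ereal_sup
       [set p : \bar R | exists U Y, [/\ unit_integrand U,
          is_ito_integral U (X e) Y &
          p = P [set w | K%:E <= hld_norm alpha (Y w)]]]))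
     0^'+ <= (- M)%:E)%E.

End processes.


Section LDP.
Context {R : realType}.

Definition good_rate_function (E : pseudoMetricType R) (I : E -> \bar R) :=
  (forall x, (0 <= I x)%E) /\
  (forall lambda : R, 0 <= lambda -> compact [set x | (I x <= lambda%:E)%E]).

Definition satisfies_LDP {d : measure_display} {T : measurableType d}
    (P : probability T R) (E : pseudoMetricType R) (xi : R -> T -> E)
    (I : E -> \bar R) :=
  [/\ good_rate_function I,
      forall e : R, 0 < e <= 1 -> forall G : set E, <<s open >> G ->
        measurable (xi e @^-1` G) &
      forall G : set E, <<s open >> G ->
        let f (e : R) := (e%:E * lne (P (xi e @^-1` G)))%E in
        [/\ (- ereal_inf (I @` G^°) <= limf_einf f 0^'+)%E,
            (limf_einf f 0^'+ <= limf_esup f 0^'+)%E &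
            (limf_esup f 0^'+ <= - ereal_inf (I @` closure G))%E]].

(* \int_0^t a dx = v as a limit of tagged Riemann-Stieltjes sums. *)
Definition is_RS_integral (a x : R -> R) (t v : R) :=
  forall e : R, 0 < e -> exists2 delta : R, 0 < delta &
    forall (s : seq R) (c : nat -> R), itv_partition 0 t s ->
      let p := nth t (0 :: s) in
      (forall i, (i < size s)%N -> p i.+1 - p i < delta) ->
      (forall i, (i < size s)%N -> p i <= c i <= p i.+1) ->
      `|\sum_(i < size s) a (c i) * (x (p i.+1) - x (p i)) - v| < e.

Definition ito_rate (alpha beta : R)
    (Isharp : C01 R * C0Hld alpha -> \bar R)
    (axz : C01 R * C0Hld alpha * C0Hld beta) : \bar R :=
  let: (a, x, z) := axz in
  if `[< bounded_variation 0 1 x /\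
         forall t : R, 0 <= t <= 1 -> is_RS_integral a x t (z t) >]
  then Isharp (a, x) else +oo%E.

End LDP.

(* Main.v *)
(* The integral is approximated by A^n.X, with A^n the value of A at the last
   point of the grid k/(n+1): a continuous functional of (A, X).  Up to the
   first time A moves by more than delta within a cell, (A - A^n)/delta is a
   left continuous integrand bounded by 1, so uniform exponential tightness
   makes |A.X - A^n.X| >= delta K exponentially negligible; that A oscillates by
   more than delta within a cell becomes negligible as n grows, by compactness
   of the level sets of the rate function.  Applied to deterministic step
   integrands, tightness also shows that a path x of rate at most M satisfies
   sum |x(p_(i+1)) - x(p_i)| <= K |t - s|^alpha over partitions of [s, t].
   Hence x has bounded variation, a.x exists, and a^n.x -> a.x in alpha-Hoelder
   norm uniformly on level sets; the contraction principle extended to such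
   exponentially good approximations concludes. *)
Require Import Defs.
From HB Require Import structures.
From mathcomp Require Import all_boot all_order all_algebra.
From mathcomp Require Import all_classical all_reals all_analysis.
From mathcomp Require Import measurable_realfun ring lra.
Set Implicit Arguments.
Unset Strict Implicit.
Unset Printing Implicit Defensive.
Import Order.TTheory GRing.Theory Num.Theory.
Import numFieldNormedType.Exports.
Local Open Scope classical_set_scope.
Local Open Scope ring_scope.

(** * Exponential rates *)

Section ExponentialRates.
Context {R : realType}.
Implicit Types (p : R -> \bar R) (a b c m : R).

Lemma near0_gt0 : \forall e \near (0 : R)^'+, 0 < e.
Proof. exact: nbhs_right_gt. Qed.

Lemma near0_unit : \forall e \near (0 : R)^'+, 0 < e <= 1.
Proof.
near=> e; apply/andP; split; near: e; [exact: near0_gt0|exact: nbhs_right_le].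
Unshelve. all: by end_near. Qed.

Lemma near_expR_rate a b c : a < b ->
  \forall e \near 0^'+, c * expR (- b / e) <= expR (- a / e).
Proof.
move=> ab; have [c0|c0] := leP c 0.
  near=> e; apply: (@le_trans _ _ 0); last exact: expR_ge0.
  by rewrite mulr_le0_ge0// expR_ge0.
near=> e; have e0 : 0 < e by near: e; exact: near0_gt0.
have ec : e <= (b - a) / c by near: e; apply: nbhs_right_le; rewrite divr_gt0 ?subr_gt0.
have -> : - a / e = (b - a) / e + (- b / e) by rewrite -mulrDl; congr (_ / _); ring.
rewrite expRD ler_wpM2r ?expR_ge0//.
apply: le_trans (expR_ge1Dx _); rewrite (@le_trans _ _ ((b - a) / e))//; last by rewrite lerDr.
by rewrite ler_pdivlMr// mulrC -ler_pdivlMr.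
Unshelve. all: by end_near. Qed.

Lemma lne_lt_expR p e m : 0 < e -> (e%:E * lne (p e) < m%:E)%E ->
  (p e <= (expR (m / e))%:E)%E.
Proof.
move=> e0; case: (p e) => [r| |] /=; last by rewrite leNye.
  case: ifPn => [r0 _|]; first by rewrite lee_fin (le_trans r0)// expR_ge0.
  rewrite -ltNge => r0; rewrite -EFinM lte_fin lee_fin => h.
  by rewrite -[leLHS]lnK// ler_expR ler_pdivlMr// mulrC ltW.
by rewrite gt0_muley ?lte_fin.
Qed.

Lemma lne_le_expR p e m : 0 < e -> (p e <= (expR (m / e))%:E)%E ->
  (e%:E * lne (p e) <= m%:E)%E.
Proof.
move=> e0; case: (p e) => [r| |] //=; last first.
  by move=> _; rewrite gt0_muleNy ?lte_fin// leNye.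
rewrite lee_fin => h; case: ifPn => [r0|].
  by rewrite gt0_muleNy ?lte_fin// leNye.
rewrite -ltNge => r0; rewrite -EFinM lee_fin mulrC -ler_pdivlMr//.
by rewrite -ler_expR lnK.
Qed.

Lemma lne_gt_expR p e m : 0 < e -> (m%:E < e%:E * lne (p e))%E ->
  ((expR (m / e))%:E <= p e)%E.
Proof.
move=> e0; case: (p e) => [r| |] //=; last first.
- by rewrite gt0_muleNy ?lte_fin.
- by rewrite leey.
case: ifPn => [r0|]; first by rewrite gt0_muleNy ?lte_fin.
rewrite -ltNge => r0; rewrite -EFinM lte_fin lee_fin mulrC -ltr_pdivrMr// => h.
by rewrite -[leRHS]lnK// ler_expR ltW.
Qed.

Lemma lne_ge_expR p e m : 0 < e -> ((expR (m / e))%:E <= p e)%E ->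
  (m%:E <= e%:E * lne (p e))%E.
Proof.
move=> e0; case: (p e) => [r| |] //=; last first.
  by move=> _; rewrite gt0_muley ?lte_fin// leey.
rewrite lee_fin => h; have r0 : 0 < r by apply: lt_le_trans h; exact: expR_gt0.
rewrite [r <= 0]leNgt r0/= -EFinM lee_fin mulrC -ler_pdivrMr//.
by rewrite -ler_expR lnK.
Qed.

Lemma limf_esup_expRP p m :
  (limf_esup (fun e : R => e%:E * lne (p e)) 0^'+ <= (- m)%:E)%E <->
  forall m', m' < m -> \forall e \near 0^'+, (p e <= (expR (- m' / e))%:E)%E.
Proof.
split=> [+ m' mm'|pm].
  rewrite limf_esupE => /le_lt_trans /(_ (_ : (_ < (- m')%:E)%E)).
  rewrite lte_fin ltrN2 => /(_ mm') /ereal_inf_lt[_ [V V0 <-] supV].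
  near=> e; have e0 : 0 < e by near: e; exact: near0_gt0.
  have Ve : V e by near: e.
  apply: lne_lt_expR => //; apply: le_lt_trans supV.
  by apply: ereal_sup_ubound; exists e.
apply/lee_addgt0Pr => d d0; rewrite -EFinD limf_esupE.
have pmd : m - d < m by rewrite gtrBl.
have near_p : \forall e \near 0^'+, 0 < e /\ (p e <= (expR (- (m - d) / e))%:E)%E.
  by apply: filterS2 near0_gt0 (pm _ pmd).
apply: ge_ereal_inf; eexists; first by eexists; [exact: near_p|reflexivity].
apply: ge_ereal_sup => _ [e [e0 pe] <-].
by apply: lne_le_expR; rewrite // -[- m + d]opprK opprD opprK.
Unshelve. all: by end_near. Qed.

Lemma limf_einf_expRP p m :
  ((- m)%:E <= limf_einf (fun e : R => e%:E * lne (p e)) 0^'+)%E <->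
  forall m', m < m' -> \forall e \near 0^'+, ((expR (- m' / e))%:E <= p e)%E.
Proof.
split=> [+ m' mm'|pm].
  rewrite limf_einfE => /(lt_le_trans (_ : ((- m')%:E < _)%E)).
  rewrite lte_fin ltrN2 => /(_ mm') /ereal_sup_gt[_ [V V0 <-] supV].
  near=> e; have e0 : 0 < e by near: e; exact: near0_gt0.
  have Ve : V e by near: e.
  apply: lne_gt_expR => //; apply: (lt_le_trans supV).
  by apply: ereal_inf_lbound; exists e.
apply/lee_subgt0Pr => d d0; rewrite -EFinB limf_einfE.
have pmd : m < m + d by rewrite ltrDl.
have near_p : \forall e \near 0^'+, 0 < e /\ ((expR (- (m + d) / e))%:E <= p e)%E.
  by apply: filterS2 near0_gt0 (pm _ pmd).
apply: le_ereal_sup_tmp; eexists; first by eexists; [exact: near_p|reflexivity].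
apply: le_ereal_inf_tmp => _ [e [e0 pe] <-].
by apply: lne_ge_expR; rewrite // -opprD.
Unshelve. all: by end_near. Qed.

Lemma limf_einf_le_esup (f : R -> \bar R) :
  (limf_einf f 0^'+ <= limf_esup f 0^'+)%E.
Proof.
rewrite limf_einfE limf_esupE.
apply: ge_ereal_sup => _ [V V0 <-]; apply: le_ereal_inf_tmp => _ [W W0 <-].
have [e [Ve We]] := @filter_ex _ (0 : R)^'+ _ _ (filterI V0 W0).
apply: (@le_trans _ _ (f e)).
  by apply: ereal_inf_lbound; exists e.
by apply: ereal_sup_ubound; exists e.
Qed.

End ExponentialRates.

(** * A contraction principle for graphs *)

Lemma borel_open (E : topologicalType) (U : set E) : open U -> <<s open >> U.
Proof. exact: sub_sigma_algebra. Qed.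

Lemma borel_closed (E : topologicalType) (U : set E) : closed U -> <<s open >> U.
Proof.
move=> Ucl; rewrite -[U]setCK -setTD; apply: sigma_algebraCD.
by apply: borel_open; rewrite openC.
Qed.

Section GraphLDP.
Context {R : realType} {d : measure_display} {T : measurableType d}.
Variables (P : probability T R) (E1 E2 : pseudoMetricType R).
Variables (xi : R -> T -> E1) (zeta : R -> T -> E2).
Variables (I : E1 -> \bar R) (J : E1 * E2 -> \bar R).
Variables (Phi : nat -> E1 -> E2) (Psi : E1 -> E2).
Hypothesis I_LDP : satisfies_LDP P xi I.
Hypothesis Phi_cont : forall n, continuous (Phi n).
Hypothesis pair_meas : forall e : R, 0 < e <= 1 ->
  forall G : set (E1 * E2), <<s open >> G ->
  measurable ((fun w => (xi e w, zeta e w)) @^-1` G).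
Hypothesis exp_good : forall eta m : R, 0 < eta -> \forall n \near \oo,
  \forall e \near 0^'+, exists B : set T, [/\ measurable B,
    forall w, ~ B w -> ball (Phi n (xi e w)) eta (zeta e w) &
    (P B <= (expR (- m / e))%:E)%E].
Hypothesis Phi_Psi : forall lambda eta : R, 0 < eta -> \forall n \near \oo,
  forall x, (I x <= lambda%:E)%E -> ball (Phi n x) eta (Psi x).
Hypothesis J_graph : forall x, (I x < +oo)%E -> J (x, Psi x) = I x.
Hypothesis J_fin : forall x z, (J (x, z) < +oo)%E -> (I x < +oo)%E /\ z = Psi x.
Hypothesis J_ge0 : forall xz, (0 <= J xz)%E.

Let I_ge0 x : (0 <= I x)%E. Proof. by have [[]] := I_LDP. Qed.

Let I_cpt (lambda : R) : 0 <= lambda -> compact [set x | (I x <= lambda%:E)%E].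
Proof. by have [[_ +] _ _] := I_LDP; exact. Qed.

Let Psi_cont (lambda r : R) x : 0 < r -> (I x <= lambda%:E)%E ->
  \forall x' \near x, (I x' <= lambda%:E)%E -> ball (Psi x) r (Psi x').
Proof.
move=> r0 Ix.
have r3 : 0 < r / 3 by rewrite divr_gt0.
have [n /= PhiPsi] := @filter_ex _ \oo _ _ (Phi_Psi lambda r3).
have : \forall x' \near x, ball (Phi n x) (r / 3) (Phi n x').
  exact: (@Phi_cont n x _ (nbhsx_ballx (Phi n x) (r / 3) r3)).
apply: filterS => x' /= Phixx' Ix'.
have -> : r = r / 3 + r / 3 + r / 3 by field.
apply: (ball_triangle _ (PhiPsi _ Ix')).
by apply: (ball_triangle _ Phixx'); apply: ball_sym; exact: PhiPsi.
Qed.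

Let J_cpt (lambda : R) : 0 <= lambda -> compact [set xz | (J xz <= lambda%:E)%E].
Proof.
move=> l0; apply/compact_near_coveringP => U F Q FF cover.
have := I_cpt l0 => /compact_near_coveringP /near_covering_withinP.
move=> /(_ U F (fun u x => Q u (x, Psi x)) FF) cov.
have : \forall u \near F, [set x | (I x <= lambda%:E)%E] `<=`
    (fun x => Q u (x, Psi x)).
  apply: cov => x /= Ix.
  have Iy : (I x < +oo)%E by rewrite (le_lt_trans Ix) ?ltry.
  have /= := cover (x, Psi x); rewrite J_graph// => /(_ Ix) [[V W] /= [nV FW] VWQ].
  have [[V1 V2] /= [nV1 nV2] VV] := nV.
  move/nbhs_ballP : nV2 => -[r /= r0 rV2].
  exists ([set x' | V1 x' /\ ((I x' <= lambda%:E)%E -> ball (Psi x) r (Psi x'))], W).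
    by split => //=; apply: filterI => //; exact: Psi_cont.
  move=> [x' u] /= [[V1x' bx'] Wu] Ix'.
  apply: (VWQ ((x', Psi x'), u)); split => //=; apply: VV; split => //=.
  by apply: rV2; exact: bx'.
apply: filterS => u IQ [x z] /= Jxz.
have [Ixy zx] : (I x < +oo)%E /\ z = Psi x.
  by apply: J_fin; rewrite (le_lt_trans Jxz) ?ltry.
by rewrite zx; apply: IQ => /=; rewrite -(J_graph Ixy) -zx.
Qed.

Let gap (C : set (E1 * E2)) (lambda : R) : closed C -> 0 <= lambda ->
  (forall xz, C xz -> ~ (J xz <= lambda%:E)%E) ->
  exists2 r : R, 0 < r & forall x, (I x <= lambda%:E)%E ->
    forall x' z, ball x r x' -> ball (Psi x) r z -> ~ C (x', z).
Proof.
move=> Ccl l0 CJ.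
have := I_cpt l0 => /compact_near_coveringP /near_covering_withinP.
move=> /(_ R 0^'+ (fun r x => forall x' z, ball x r x' -> ball (Psi x) r z ->
  ~ C (x', z)) _) cov.
have [] : exists r : R, 0 < r /\ [set x | (I x <= lambda%:E)%E] `<=`
  (fun x => forall x' z, ball x r x' -> ball (Psi x) r z -> ~ C (x', z)).
  apply: (@filter_ex _ (0 : R)^'+ _).
  apply: filterI; first exact: near0_gt0.
  apply: cov => x /= Ix.
  have : nbhs (x, Psi x) (~` C).
    apply: open_nbhs_nbhs; split; first by rewrite openC.
    by move=> /CJ; apply; rewrite J_graph// (le_lt_trans Ix) ?ltry.
  move=> /nbhs_ballP[r /= r0 rC].
  have r2 : 0 < r / 2 by rewrite divr_gt0.
  exists ([set x' | ball x (r / 2) x' /\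
      ((I x' <= lambda%:E)%E -> ball (Psi x) (r / 2) (Psi x'))], [set s | s <= r / 2]).
    split; last exact: nbhs_right_le.
    by apply: filterI; [exact: nbhsx_ballx|exact: Psi_cont].
  move=> [x1 s] /= [[xx1 Psix1] sr] Ix1 x' z x1x' Psix1z.
  apply: rC; split => /=; rewrite (splitr r).
    by apply: (ball_triangle xx1); exact: le_ball x1x'.
  by apply: (ball_triangle (Psix1 Ix1)); exact: le_ball Psix1z.
by move=> r [r0 h]; exists r.
Qed.

Let xi_meas (e : R) (G : set E1) : 0 < e <= 1 -> <<s open >> G -> measurable (xi e @^-1` G).
Proof. by have [_ h _] := I_LDP => e01; exact: h. Qed.

Let probU2 (A B : set T) : measurable A -> measurable B ->
  (P (A `|` B) <= P A + P B)%E.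
Proof. by move=> mA mB; exact: measureU2. Qed.

Let upper (G : set (E1 * E2)) : <<s open >> G ->
  (limf_esup (fun e : R => e%:E * lne (P ((fun w => (xi e w, zeta e w)) @^-1` G))) 0^'+
    <= - ereal_inf (J @` closure G))%E.
Proof.
move=> bG.
have inf0 : (0 <= ereal_inf (J @` closure G))%E.
  by apply: le_ereal_inf_tmp => _ [xz _ <-].
apply/lee_addgt0Pr => eps eps0; rewrite -leeBlDr//.
suff H (lambda : R) : (lambda%:E < ereal_inf (J @` closure G))%E ->
    (limf_esup (fun e : R => e%:E * lne (P ((fun w => (xi e w, zeta e w)) @^-1` G))) 0^'+
    <= (- lambda)%:E)%E.
  case E : (ereal_inf _) inf0 => [s| |]// _.
    apply: (@le_trans _ _ ((- (s - eps))%:E - eps%:E)%E); last first.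
      by rewrite -EFinB lee_fin opprB addrAC subrr add0r.
    by apply: leeB => //; apply: H; rewrite E lte_fin gtrBl.
  have : forall r : R, (limf_esup (fun e : R => e%:E *
      lne (P ((fun w => (xi e w, zeta e w)) @^-1` G))) 0^'+ <= r%:E)%E.
    by move=> r; rewrite -[r]opprK; apply: H; rewrite E ltry.
  case: (limf_esup _ _) => [r| |] //.
    by move=> /(_ (r - 1)); rewrite lee_fin lerBrDr gerDl ler10.
  by move=> /(_ 0).
move=> linf; apply/limf_esup_expRP => l' l'l.
have [l0|l0] := ltP lambda 0.
  near=> e; have e01 : 0 < e <= 1 by near: e; exact: near0_unit.
  apply: (@le_trans _ _ 1%E); first by apply: probability_le1; exact: pair_meas.
  rewrite lee_fin -[leLHS](@expR0 R) ler_expR.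
  by apply: divr_ge0; [rewrite oppr_ge0 ltW// (lt_trans l'l)|case/andP: e01 => /ltW].
have [r r0 hr] : exists2 r : R, 0 < r & forall x, (I x <= lambda%:E)%E ->
    forall x' z, ball x r x' -> ball (Psi x) r z -> ~ closure G (x', z).
  apply: gap => //; first exact: closed_closure.
  move=> xz Gxz; apply/negP; rewrite -ltNge; apply: (lt_le_trans linf).
  by apply: ereal_inf_lbound; exists xz.
have r3 : 0 < r / 3 by rewrite divr_gt0.
have [n [/= PhiPsi expg]] := @filter_ex _ \oo _ _
  (filterI (Phi_Psi lambda r3) (exp_good lambda r3)).
pose F0 := [set x' | exists2 z, G (x', z) & ball (Phi n x') (r / 3) z].
have F0I : (lambda%:E <= ereal_inf (I @` closure (closure F0)))%E.
  apply: le_ereal_inf_tmp => _ [x F0x <-]; rewrite leNgt; apply/negP => /ltW Ix.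
  move: F0x; rewrite -((closure_id _).1 (@closed_closure _ F0)).
  move=> /(_ [set x' | ball x r x' /\ ball (Phi n x) (r / 3) (Phi n x')]) [].
    by apply: filterI; [exact: nbhsx_ballx|apply: Phi_cont; exact: nbhsx_ballx].
  move=> x' [[z Gx'z zx'] [xx' Phixx']]; apply: (hr x Ix x' z) => //.
    have -> : r = r / 3 + r / 3 + r / 3 by field.
    apply: (ball_triangle _ zx'); apply: (ball_triangle _ Phixx').
    by apply: ball_sym; exact: PhiPsi.
  exact: subset_closure.
have bF0 : <<s open >> (closure F0) by apply: borel_closed; exact: closed_closure.
have : (limf_esup (fun e : R => e%:E * lne (P (xi e @^-1` closure F0))) 0^'+ <= (- lambda)%:E)%E.
  have [_ _ /(_ _ bF0) [_ _]] := I_LDP; move=> /le_trans; apply.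
  by rewrite EFinN leeN2.
pose l1 := (l' + lambda) / 2.
have l1l : l1 < lambda by rewrite /l1; lra.
have l'l1 : l' < l1 by rewrite /l1; lra.
move=> /limf_esup_expRP/(_ _ l1l) PF0.
near=> e; have e01 : 0 < e <= 1 by near: e; exact: near0_unit.
have [e0 e1] := andP e01.
have [B [mB Bball PB]] : exists B : set T, [/\ measurable B,
    forall w, ~ B w -> ball (Phi n (xi e w)) (r / 3) (zeta e w) &
    (P B <= (expR (- lambda / e))%:E)%E] by near: e.
have PF0e : (P (xi e @^-1` closure F0) <= (expR (- l1 / e))%:E)%E by near: e.
have two : 2 * expR (- l1 / e) <= expR (- l' / e) by near: e; exact: near_expR_rate.
have mF0 := xi_meas e01 bF0.
apply: (@le_trans _ _ (P (xi e @^-1` closure F0 `|` B))).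
  apply: le_measure; rewrite ?inE; [exact: (pair_meas e01 bG)|exact: measurableU|].
  move=> w /= Gw; have [Bw|nBw] := pselect (B w); [by right|left].
  by apply: subset_closure; exists (zeta e w) => //; exact: Bball.
apply: (le_trans (probU2 mF0 mB)).
apply: (@le_trans _ _ ((expR (- l1 / e))%:E + (expR (- l1 / e))%:E)%E).
  apply: leeD => //; apply: (le_trans PB); rewrite lee_fin ler_expR.
  by rewrite ler_pM2r ?invr_gt0// lerN2 ltW.
by rewrite -EFinD lee_fin -mulr2n -mulr_natl.
Unshelve. all: by end_near. Qed.

Let lower (G : set (E1 * E2)) : <<s open >> G ->
  (- ereal_inf (J @` G^°) <=
    limf_einf (fun e : R => e%:E * lne (P ((fun w => (xi e w, zeta e w)) @^-1` G))) 0^'+)%E.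
Proof.
move=> bG; rewrite leeNl; apply: le_ereal_inf_tmp => _ [[x z] Gxz <-]; rewrite leeNl.
have [Jy|] := ltP (J (x, z)) +oo%E; last by rewrite leye_eq => /eqP ->; rewrite leNye.
have [Iy zx] := J_fin Jy; rewrite zx J_graph//.
have [i Ii] : exists i : R, I x = i%:E.
  by exists (fine (I x)); rewrite fineK// ge0_fin_numE.
rewrite Ii -EFinN; apply/limf_einf_expRP => m' im'.
move: Gxz; rewrite zx /interior => /nbhs_ballP [r /= r0 rG].
have r3 : 0 < r / 3 by rewrite divr_gt0.
have [n [/= PhiPsi expg]] := @filter_ex _ \oo _ _
  (filterI (Phi_Psi i r3) (exp_good m' r3)).
pose U := [set x' | ball x r x' /\ ball (Phi n x) (r / 3) (Phi n x')].
have Ux : (U^°) x.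
  by apply: filterI; [exact: nbhsx_ballx|apply: Phi_cont; exact: nbhsx_ballx].
have bU : <<s open >> U^° by apply: borel_open; exact: open_interior.
have : ((- i)%:E <= limf_einf (fun e : R => e%:E * lne (P (xi e @^-1` U^°))) 0^'+)%E.
  have [_ _ /(_ _ bU) [+ _ _]] := I_LDP; apply: le_trans.
  rewrite EFinN leeN2 -Ii; apply: ereal_inf_lbound; exists x => //.
  by rewrite (interior_id _).1//; exact: open_interior.
pose m1 := (i + m') / 2.
have im1 : i < m1 by rewrite /m1; lra.
have m1m' : m1 < m' by rewrite /m1; lra.
move=> /limf_einf_expRP /(_ _ im1) PU.
near=> e; have e01 : 0 < e <= 1 by near: e; exact: near0_unit.
have [B [mB Bball PB]] : exists B : set T, [/\ measurable B,
    forall w, ~ B w -> ball (Phi n (xi e w)) (r / 3) (zeta e w) &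
    (P B <= (expR (- m' / e))%:E)%E] by near: e.
have PUe : ((expR (- m1 / e))%:E <= P (xi e @^-1` U^°))%E by near: e.
have two : 2 * expR (- m' / e) <= expR (- m1 / e) by near: e; exact: near_expR_rate.
have mG := pair_meas e01 bG; have mU := xi_meas e01 bU.
have : (P (xi e @^-1` U^°) <=
    P ((fun w => (xi e w, zeta e w)) @^-1` G) + P B)%E.
  apply: le_trans (probU2 mG mB).
  apply: le_measure; rewrite ?inE//; first exact: measurableU.
  move=> w /= /interior_subset [xw Phiw].
  have [Bw|nBw] := pselect (B w); [by right|left].
  apply: rG; split => //=.
  have -> : r = r / 3 + r / 3 + r / 3 by field.
  apply: (ball_triangle _ (Bball _ nBw)); apply: (ball_triangle _ Phiw).
  by apply: ball_sym; apply: PhiPsi; rewrite Ii.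
move=> PUG; have := le_trans PUe (le_trans PUG (leeD2l _ PB)).
rewrite -leeBlDr// => /(le_trans _); apply.
by rewrite -EFinB lee_fin; lra.
Unshelve. all: by end_near. Qed.

Lemma LDP_graph : satisfies_LDP P (fun e w => (xi e w, zeta e w)) J.
Proof.
split; [by split|exact: pair_meas|move=> G bG f; split].
- exact: lower.
- exact: limf_einf_le_esup.
- exact: upper.
Qed.

End GraphLDP.

(** * Hoelder functions *)

Section Holder.
Context {R : realType}.
Implicit Types (f g x : R -> R) (alpha beta : R).

Lemma clamp01_id (t : R) : 0 <= t <= 1 -> clamp01 t = t.
Proof. by case/andP => t0 t1; rewrite /clamp01 min_l// max_r. Qed.

Lemma clamp01_lip (s t : R) : `|clamp01 s - clamp01 t| <= `|s - t|.
Proof.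
wlog st : s t / s <= t.
  move=> H; have [/H//|/ltW/H] := leP s t.
  by rewrite distrC [leRHS]distrC.
have cst : clamp01 s <= clamp01 t by rewrite /clamp01 le_max2// le_min2.
rewrite distrC [leRHS]distrC ger0_norm ?subr_ge0// ger0_norm ?subr_ge0//.
move: cst; rewrite /clamp01.
have [t1|t1] := leP t 1; have [s1|s1] := leP s 1;
have [s0|s0] := leP 0 s; have [t0|t0] := leP 0 t; have [u|u] := leP (0 : R) 1; lra.
Qed.

Lemma clamp01_continuous : continuous (@clamp01 R).
Proof.
move=> t; apply/cvgrPdist_lt => e e0; near=> s.
by apply: le_lt_trans (clamp01_lip _ _) _; near: s; exact: cvgr_dist_lt.
Unshelve. all: by end_near. Qed.

Lemma within01_continuous (f : R -> R) : (forall t, f t = f (clamp01 t)) ->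
  {within `[0, 1], continuous f} -> continuous f.
Proof.
move=> fc /subspace_continuousP f01 t.
have -> : f = f \o @clamp01 R by apply/funext => s /=; exact: fc.
apply: (@cvg_comp _ _ _ (@clamp01 R) f _ (within `[0, 1] (nbhs (clamp01 t)))); last first.
  by apply: f01; rewrite /= in_itv/= clamp01_itv.
move=> A nA.
have : \forall s \near t, `[(0:R), 1]%classic (clamp01 s) -> A (clamp01 s).
  exact: (@clamp01_continuous t _ nA).
apply: filterS => s; apply.
by rewrite /= in_itv/= clamp01_itv.
Qed.

Lemma C01_continuous (a : C01 R) : continuous a.
Proof. by apply: within01_continuous; [exact: C01_clamp|exact: C01_cont]. Qed.

Lemma C01_modulus (a : C01 R) (e : R) : 0 < e ->
  exists2 r : R, 0 < r & forall s t, `|s - t| <= r -> `|a s - a t| < e.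
Proof.
move=> e0.
have := @segment_compact R 0 1 => /compact_near_coveringP.
move=> /(_ R 0^'+ (fun r s => forall t, `|s - t| <= r -> `|a s - a t| < e) _) cov.
have [r [r0 h]] : exists r : R, 0 < r /\ `[0, 1] `<=`
    (fun s => forall t, `|s - t| <= r -> `|a s - a t| < e).
  apply: (@filter_ex _ (0 : R)^'+ _).
  apply: filterI; first exact: near0_gt0.
  apply: cov => s _.
  have e2 : 0 < e / 2 by rewrite divr_gt0.
  have := @C01_continuous a s => /cvgrPdist_lt /(_ _ e2) /nbhs_ballP[q /= q0 qa].
  have q2 : 0 < q / 2 by rewrite divr_gt0.
  exists (ball s (q / 2), [set r | r < q / 2]).
    by split; [exact: nbhsx_ballx|exact: nbhs_right_lt].
  move=> [s1 r] /= [+ rq] t s1t; rewrite /ball/= => ss1.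
  have h1 := qa s1; have h2 := qa t.
  rewrite (splitr e); apply: le_lt_trans (ler_distD (a s) _ _) _; apply: ltrD.
    rewrite distrC; apply: h1 => /=; apply: (lt_trans ss1).
    by rewrite [ltRHS](splitr q) ltrDl.
  apply: h2 => /=; rewrite (splitr q); apply: le_lt_trans (ler_distD s1 _ _) _.
  by apply: ltrD => //; exact: le_lt_trans rq.
exists r => // s t st; rewrite (C01_clamp a s) (C01_clamp a t); apply: h.
  by rewrite /= in_itv/= clamp01_itv.
by apply: le_trans st; exact: clamp01_lip.
Qed.

Lemma C01_bounded (a : C01 R) : exists2 M : R, 0 < M & forall t, `|a t| <= M.
Proof.
have [r r0 ar] := C01_modulus a ltr01.
have fu := C01_unif_fin a a.
have [c _ fc] := EVT_max (@ler01 R) (@C01_cont _ a).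
have [c' _ fc'] := EVT_min (@ler01 R) (@C01_cont _ a).
exists (`|a c| + `|a c'| + 1); first by rewrite ltr_wpDl// addr_ge0.
move=> t; rewrite (C01_clamp a t).
have t01 : clamp01 t \in `[0, 1] by rewrite in_itv/= clamp01_itv.
have := fc _ t01; have := fc' _ t01; move: (a (clamp01 t)) => y y1 y2.
have := ler_norm (a c); have := ler_norm (- a c'); rewrite normrN.
have := normr_ge0 (a c); have := normr_ge0 (a c').
by move=> *; rewrite ler_norml; apply/andP; split; lra.
Qed.

Definition hld_le alpha (C : R) f := forall s t : R, 0 <= s -> s <= t -> t <= 1 ->
  `|f t - f s| <= C * (t - s) `^ alpha.

Lemma hld_le_norm alpha (C : R) f :
  (hld_norm alpha f <= C%:E)%E -> hld_le alpha C f.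
Proof.
move=> fC s t s0; rewrite le_eqVlt => /predU1P[<- _|st t1].
  rewrite subrr normr0 mulr_ge0// ?powR_ge0//.
  by rewrite -lee_fin (le_trans _ fC) ?hld_norm_ge0.
rewrite -ler_pdivrMr ?powR_gt0 ?subr_gt0// -lee_fin (le_trans _ fC)//.
exact: hld_norm_ub.
Qed.

Lemma hld_norm_le alpha (c C : R) f : `|f 0| <= c -> hld_le alpha C f ->
  (hld_norm alpha f <= (c + C)%:E)%E.
Proof.
move=> f0 fC; rewrite EFinD; apply: leeD; first by rewrite lee_fin.
apply: ge_ereal_sup => _ [s [t [s0 st t1 ->]]]; rewrite lee_fin.
by rewrite ler_pdivrMr ?powR_gt0 ?subr_gt0// fC// ltW.
Qed.

Lemma hld_norm_mono alpha beta f : beta <= alpha ->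
  (hld_norm beta f <= hld_norm alpha f)%E.
Proof.
move=> ba; apply: leeD2l; apply: ge_ereal_sup => _ [s [t [s0 st t1 ->]]].
apply: (@le_trans _ _ (hld_quot alpha f s t)%:E); last first.
  by apply: ereal_sup_ubound; exists s, t.
rewrite lee_fin ler_wpM2l// lef_pV2 ?posrE ?powR_gt0 ?subr_gt0//.
apply: ger_powR; first by rewrite subr_gt0 st/= lerBlDr (le_trans t1)// lerDl.
exact: ba.
Qed.

Lemma hld_leD alpha (C D : R) f g : hld_le alpha C f -> hld_le alpha D g ->
  hld_le alpha (C + D) (f \+ g).
Proof.
move=> fC gD s t s0 st t1; have := fC s t s0 st t1; have := gD s t s0 st t1.
rewrite mulrDl /= => h1 h2; apply: (le_trans _ (lerD h2 h1)).
by apply: le_trans (ler_normD _ _); rewrite le_eqVlt; apply/orP; left; apply/eqP; congr `|_|; ring.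
Qed.

Lemma hld_leZ alpha (C k : R) f : hld_le alpha C f ->
  hld_le alpha (`|k| * C) (fun t => k * f t).
Proof.
move=> fC s t s0 st t1; rewrite -mulrBr normrM -mulrA ler_wpM2l//.
exact: fC.
Qed.

Lemma hld_leN alpha (C : R) f : hld_le alpha C f -> hld_le alpha C (\- f).
Proof.
move=> fC s t s0 st t1; rewrite /= -normrN opprD !opprK; exact: fC.
Qed.

Lemma hld_leB alpha (C D : R) f g : hld_le alpha C f -> hld_le alpha D g ->
  hld_le alpha (C + D) (f \- g).
Proof. by move=> fC gD; apply: hld_leD => //; exact: hld_leN. Qed.

Lemma hld_le_sum alpha n (C : nat -> R) (f : nat -> R -> R) :
  (forall i, (i < n)%N -> hld_le alpha (C i) (f i)) ->
  hld_le alpha (\sum_(i < n) C i) (fun t => \sum_(i < n) f i t).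
Proof.
move=> fC s t s0 st t1; rewrite -sumrB mulr_suml.
apply: le_trans (ler_norm_sum _ _ _) _; apply: ler_sum => i _; exact: fC.
Qed.

Lemma hld_leW alpha (C D : R) f : C <= D -> hld_le alpha C f -> hld_le alpha D f.
Proof.
move=> CD fC s t s0 st t1; apply: le_trans (fC s t s0 st t1) _.
by rewrite ler_wpM2r// powR_ge0.
Qed.

Lemma hld_le_ge0 alpha (C : R) f : hld_le alpha C f -> 0 <= C.
Proof.
move=> /(_ 0 1 (lexx _) ler01 (lexx _)); rewrite subr0 powR1 mulr1.
exact: le_trans.
Qed.

Lemma hld_le_stop alpha (C r : R) f : 0 <= alpha -> 0 <= r -> hld_le alpha C f ->
  hld_le alpha C (fun t => f (Num.min t r)).
Proof.
move=> a0 r0 fC s t s0 st t1; have C0 := hld_le_ge0 fC.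
have st' : Num.min s r <= Num.min t r by rewrite le_min2.
apply: le_trans (fC _ _ _ st' _) _.
- by rewrite le_min s0.
- by rewrite ge_min t1.
rewrite ler_wpM2l// ge0_ler_powR ?nnegrE ?subr_ge0//.
have [|] := leP t r => tr; have [|] := leP s r => sr; lra.
Qed.

Lemma hld_le_continuous alpha (C : R) f : 0 < alpha -> (forall t, f t = f (clamp01 t)) ->
  hld_le alpha C f -> continuous f.
Proof.
move=> a0 fc fC t.
have C0 := hld_le_ge0 fC.
have H s : `|f t - f s| <= C * `|t - s| `^ alpha.
  rewrite (fc t) (fc s); apply: (@le_trans _ _ (C * `|clamp01 t - clamp01 s| `^ alpha)); last first.
    rewrite ler_wpM2l//; apply: ge0_ler_powR; rewrite ?nnegrE//; first exact: ltW.
    exact: clamp01_lip.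
  have /andP[t0 t1] := clamp01_itv t; have /andP[s0 s1] := clamp01_itv s.
  have [ts|/ltW ts] := leP (clamp01 t) (clamp01 s).
    by rewrite distrC [X in X `^ _]distrC [X in X `^ _]ger0_norm ?subr_ge0// fC.
  by rewrite [X in X `^ _]ger0_norm ?subr_ge0// fC.
apply/cvgrPdist_lt => e e0.
have D0 : 0 < (e / (C + 1)) `^ (alpha^-1) by rewrite powR_gt0// divr_gt0// ltr_wpDl.
near=> s; apply: (le_lt_trans (H s)).
have ts : `|t - s| < (e / (C + 1)) `^ (alpha^-1) by near: s; exact: cvgr_dist_lt.
apply: (@le_lt_trans _ _ (C * (e / (C + 1)))); last first.
  rewrite mulrCA gtr_pMr// ltr_pdivrMr ?ltr_wpDl// mul1r; lra.
rewrite ler_wpM2l//.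
apply: (@le_trans _ _ (((e / (C + 1)) `^ (alpha^-1)) `^ alpha)).
  by apply: ge0_ler_powR; rewrite ?nnegrE ?powR_ge0//; exact: ltW.
by rewrite -powRrM mulVf ?gt_eqF// powRr1// divr_ge0// ?ltW// ltr_wpDl.
Unshelve. all: by end_near. Qed.

Lemma C0Hld_le alpha (x : C0Hld alpha) : hld_le alpha (fine (hld_norm alpha x)) x.
Proof.
apply: hld_le_norm; rewrite fineK// ge0_fin_numE ?hld_norm_ge0//.
exact: C0Hld_fin.
Qed.

Lemma CHld_le alpha (x : CHld alpha) : hld_le alpha (fine (hld_norm alpha x)) x.
Proof.
apply: hld_le_norm; rewrite fineK// ge0_fin_numE ?hld_norm_ge0//.
exact: CHld_fin.
Qed.

Lemma C0Hld_continuous alpha (x : C0Hld alpha) : 0 < alpha -> continuous x.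
Proof.
by move=> a0; apply: (hld_le_continuous a0 (C0Hld_clamp x) (C0Hld_le x)).
Qed.

Lemma CHld_continuous alpha (x : CHld alpha) : 0 < alpha -> continuous x.
Proof.
by move=> a0; apply: (hld_le_continuous a0 (@CHld_clamp _ _ x) (CHld_le x)).
Qed.

Lemma C01_ball (a b : C01 R) (r : R) : ball a r b -> forall t, `|a t - b t| < r.
Proof.
rewrite ballEmdist /= => ab t; apply: le_lt_trans ab.
rewrite -lee_fin fineK ?C01_unif_fin//.
rewrite (C01_clamp a t) (C01_clamp b t).
exact: (unif_norm_ub (a \- b) (clamp01_itv t)).
Qed.

Lemma C0Hld_ballP alpha (x y : C0Hld alpha) (r : R) :
  ball x r y <-> (hld_norm alpha (x \- y) < r%:E)%E.
Proof.
by rewrite ballEmdist /= -[X in _ <-> (X < _)%E]fineK ?C0Hld_norm_fin// lte_fin.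
Qed.

Lemma C0Hld_ball_le alpha (x y : C0Hld alpha) (r : R) : ball x r y ->
  hld_le alpha r (x \- y).
Proof. by move=> /C0Hld_ballP/ltW; exact: hld_le_norm. Qed.

Lemma hld_norm_ge_pt alpha f (C t : R) : 0 < alpha -> 0 <= t <= 1 ->
  (hld_norm alpha f <= C%:E)%E -> `|f t| <= C + C.
Proof.
move=> a0 /andP[t0 t1] fC.
have f0 : `|f 0| <= C by rewrite -lee_fin (le_trans _ fC)// hld_norm_ub0.
have := hld_le_norm fC (lexx 0) t0 t1; rewrite subr0 => h.
have C0 : 0 <= C by apply: le_trans f0.
have h2 : `|f t - f 0| <= C.
  apply: le_trans h _; apply: ler_piMr => //.
  apply: (@le_trans _ _ (1 `^ alpha)); last by rewrite powR1.
  by apply: ge0_ler_powR; rewrite ?nnegrE// ltW.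
rewrite -[f t](subrK (f 0)); apply: le_trans (ler_normD _ _) _.
exact: lerD.
Qed.

Lemma C0Hld_ball_pt alpha (x y : C0Hld alpha) (r t : R) : 0 < alpha ->
  ball x r y -> `|x t - y t| <= r + r.
Proof.
move=> a0 /C0Hld_ballP/ltW/(hld_norm_ge_pt a0 (clamp01_itv t)).
by rewrite /= -(C0Hld_clamp x) -(C0Hld_clamp y).
Qed.

Lemma C0Hld_eq alpha (x y : C0Hld alpha) :
  (forall t, 0 <= t <= 1 -> x t = y t) -> x = y.
Proof.
move=> xy; apply: mdist_positivity; rewrite /mdist /= /C0Hld_dist.
rewrite (_ : _ \- _ = fun=> 0) ?hld_norm0//; apply/funext => t /=.
by rewrite (C0Hld_clamp x t) (C0Hld_clamp y t) xy ?clamp01_itv// subrr.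
Qed.

End Holder.

(** * Riemann-Stieltjes sums *)

Section Sums.
Context {R : realType}.
Implicit Types (x : R -> R) (p q f g : nat -> R) (s t r : R).

Definition clip s t r : R := Num.max s (Num.min r t).

Lemma clip_split x s t r : s <= t ->
  x (clip s t r) = x (Num.min r t) + x s - x (Num.min r s).
Proof.
rewrite /clip => st; have [rs|sr] := leP r s.
  by rewrite min_l ?max_l//; [ring|exact: le_trans st].
rewrite max_r; first by rewrite addrK.
by rewrite le_min st ltW.
Qed.

Lemma clip_le s t r r' : r <= r' -> clip s t r <= clip s t r'.
Proof. by move=> rr; rewrite /clip le_max2// le_min2. Qed.

Lemma clip_le_r s t r : s <= t -> clip s t r <= t.
Proof. by move=> st; rewrite /clip ge_max st ge_min lexx orbT. Qed.

Lemma clip_lo s t r : s <= t -> r <= s -> clip s t r = s.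
Proof. by move=> st rs; rewrite /clip max_l// ge_min rs. Qed.

Lemma clip_hi s t r : s <= t -> t <= r -> clip s t r = t.
Proof. by move=> st tr; rewrite /clip min_r// max_r. Qed.

Lemma clip_lt s t r r' : clip s t r < clip s t r' -> r < r'.
Proof. by rewrite !ltNge; apply: contra => /(@clip_le s t). Qed.

Lemma nondec_nat p : (forall i, p i <= p i.+1) -> forall i j, (i <= j)%N -> p i <= p j.
Proof. by move=> pm; apply/nondecreasing_seqP. Qed.

Lemma big_divmod (V : zmodType) L N (F : nat -> nat -> V) :
  \sum_(j < L * N.+1) F (j %/ N.+1)%N (j %% N.+1)%N =
  \sum_(k < L) \sum_(i < N.+1) F k i.
Proof.
elim: L => [|L IH]; first by rewrite mul0n !big_ord0.
rewrite [RHS]big_ord_recr /= -IH mulSnr big_split_ord /=; congr (_ + _).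
apply: eq_bigr => i _; rewrite divnMDl// divn_small// addn0.
by rewrite modnMDl modn_small.
Qed.

Lemma sum_telescope (V : zmodType) N (F : nat -> V) :
  \sum_(i < N) (F i.+1 - F i) = F N - F 0%N.
Proof.
by rewrite -(big_mkord xpredT (fun i => F i.+1 - F i)) telescope_sumr.
Qed.

Lemma sum_clip x L q s t r r' : (forall i, q i <= q i.+1) ->
  q 0%N = s -> q L = t -> s <= r <= t -> s <= r' <= t ->
  \sum_(k < L) (x (clip (q k) (q k.+1) r) - x (clip (q k) (q k.+1) r')) = x r - x r'.
Proof.
move=> qm q0 qL /andP[sr rt] /andP[sr' rt'].
rewrite (eq_bigr (fun k : 'I_L => (x (Num.min r (q k.+1)) - x (Num.min r' (q k.+1)))
   - (x (Num.min r (q k)) - x (Num.min r' (q k))))); last first.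
  by move=> k _; rewrite !clip_split//; ring.
rewrite (sum_telescope _ (fun k => x (Num.min r (q k)) - x (Num.min r' (q k)))).
by rewrite q0 qL (min_l rt) (min_l rt') (min_r sr) (min_r sr') subrr subr0.
Qed.

Lemma double_clip x N L p q f g s t : (forall i, p i <= p i.+1) ->
  (forall i, q i <= q i.+1) -> p 0%N = s -> q 0%N = s -> p N = t -> q L = t ->
  \sum_(i < N) f i * (x (p i.+1) - x (p i)) - \sum_(k < L) g k * (x (q k.+1) - x (q k)) =
  \sum_(k < L) \sum_(i < N) (f i - g k) *
     (x (clip (q k) (q k.+1) (p i.+1)) - x (clip (q k) (q k.+1) (p i))).
Proof.
move=> pm qm p0 q0 pN qL.
have pst i : (i <= N)%N -> s <= p i <= t.
  by move=> iN; rewrite -p0 -pN !nondec_nat.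
have -> : \sum_(i < N) f i * (x (p i.+1) - x (p i)) =
   \sum_(k < L) \sum_(i < N) f i *
     (x (clip (q k) (q k.+1) (p i.+1)) - x (clip (q k) (q k.+1) (p i))).
  rewrite exchange_big /=; apply: eq_bigr => i _.
  by rewrite -mulr_sumr (sum_clip x qm q0 qL)// pst// ltnW.
rewrite -sumrB; apply: eq_bigr => k _.
have qk : q k.+1 <= t by rewrite -qL nondec_nat.
have qk' : s <= q k by rewrite -q0 nondec_nat.
have -> : x (q k.+1) - x (q k) =
   \sum_(i < N) (x (clip (q k) (q k.+1) (p i.+1)) - x (clip (q k) (q k.+1) (p i))).
  rewrite (sum_telescope _ (fun i => x (clip (q k) (q k.+1) (p i)))).
  by rewrite p0 pN clip_hi// clip_lo.
by rewrite mulr_sumr -sumrB; apply: eq_bigr => i _; rewrite mulrBl.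
Qed.

Definition var_bound alpha (K : R) x := forall N p, (forall i, p i <= p i.+1) ->
  0 <= p 0%N -> p N <= 1 ->
  \sum_(i < N) `|x (p i.+1) - x (p i)| <= K * (p N - p 0%N) `^ alpha.

Lemma var_bound_hld alpha (K : R) x : var_bound alpha K x -> hld_le alpha K x.
Proof.
move=> xK s t s0 st t1.
have := xK 1%N (fun i => if i is 0%N then s else t) _ s0 t1.
by rewrite big_ord1 /=; apply; case.
Qed.

Lemma double_clip_var alpha (K : R) x N L p q s t : var_bound alpha K x ->
  (forall i, p i <= p i.+1) ->
  (forall i, q i <= q i.+1) -> p 0%N = s -> q 0%N = s -> p N = t -> q L = t ->
  0 <= s -> t <= 1 ->
  \sum_(k < L) \sum_(i < N)
     `|x (clip (q k) (q k.+1) (p i.+1)) - x (clip (q k) (q k.+1) (p i))|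
  <= K * (t - s) `^ alpha.
Proof.
move=> xK pm qm p0 q0 pN qL s0 t1.
pose rho j := clip (q (j %/ N.+1)%N) (q (j %/ N.+1).+1) (p (j %% N.+1)%N).
have qs k : s <= q k by rewrite -q0 nondec_nat.
have rhoS k i : (i < N)%N -> rho (k * N.+1 + i).+1 = clip (q k) (q k.+1) (p i.+1).
  move=> iN; rewrite /rho -addnS divnMDl// divn_small ?addn0//.
  by rewrite modnMDl modn_small.
have rhoE k i : (i <= N)%N -> rho (k * N.+1 + i)%N = clip (q k) (q k.+1) (p i).
  move=> iN; rewrite /rho divnMDl// divn_small ?addn0//.
  by rewrite modnMDl modn_small.
have rho0 k : rho (k * N.+1)%N = q k.
  by rewrite -[X in rho X]addn0 rhoE// p0 clip_lo.
have rhom j : rho j <= rho j.+1.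
  rewrite (divn_eq j N.+1); set k := (j %/ N.+1)%N; set i := (j %% N.+1)%N.
  have : (i < N.+1)%N by rewrite ltn_mod.
  rewrite ltnS leq_eqVlt => /predU1P[->|iN].
    rewrite rhoE// -addnS -mulSnr rho0; exact: clip_le_r.
  by rewrite rhoE ?rhoS//; [exact: clip_le|exact: ltnW].
have r0 : rho 0%N = s by have := rho0 0%N; rewrite mul0n q0.
have rL : rho (L * N.+1)%N = t by rewrite rho0 qL.
have := xK (L * N.+1)%N rho rhom; rewrite r0 rL => /(_ s0 t1); apply: le_trans.
pose F k i := `|x (rho (k * N.+1 + i).+1) - x (rho (k * N.+1 + i)%N)|.
rewrite [leRHS](eq_bigr (fun j : 'I__ => F (j %/ N.+1)%N (j %% N.+1)%N)); last first.
  by move=> j _; rewrite /F -divn_eq.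
rewrite (@big_divmod _ L N F).
apply: ler_sum => k _; rewrite big_ord_recr /=.
rewrite -[leLHS]addr0; apply: lerD; last by rewrite /F.
by apply: ler_sum => i _; rewrite /F rhoS// rhoE// ltnW.
Qed.

Lemma compare_sums alpha (K w : R) x N L p q f g s t : var_bound alpha K x ->
  (forall i, p i <= p i.+1) ->
  (forall i, q i <= q i.+1) -> p 0%N = s -> q 0%N = s -> p N = t -> q L = t ->
  0 <= s -> t <= 1 -> 0 <= w ->
  (forall i k, (i < N)%N -> (k < L)%N -> p i < q k.+1 -> q k < p i.+1 ->
     `|f i - g k| <= w) ->
  `|\sum_(i < N) f i * (x (p i.+1) - x (p i)) -
    \sum_(k < L) g k * (x (q k.+1) - x (q k))| <= w * K * (t - s) `^ alpha.
Proof.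
move=> xK pm qm p0 q0 pN qL s0 t1 w0 fg.
rewrite (double_clip x f g pm qm p0 q0 pN qL).
apply: (@le_trans _ _ (w * \sum_(k < L) \sum_(i < N)
     `|x (clip (q k) (q k.+1) (p i.+1)) - x (clip (q k) (q k.+1) (p i))|)); last first.
  by rewrite -mulrA ler_wpM2l//; exact: (double_clip_var xK pm qm p0 q0 pN qL s0 t1).
rewrite mulr_sumr; apply: le_trans (ler_norm_sum _ _ _) _; apply: ler_sum => k _.
rewrite mulr_sumr; apply: le_trans (ler_norm_sum _ _ _) _; apply: ler_sum => i _.
have [piq|qpi] := ltP (p i) (q k.+1); last first.
  rewrite (clip_hi (qm k) qpi) (clip_hi (qm k) (le_trans qpi (pm i))).
  by rewrite subrr mulr0 normr0 mulr0.
have [qp|pq] := ltP (q k) (p i.+1); last first.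
  rewrite (clip_lo (qm k) pq) (clip_lo (qm k) (le_trans (pm i) pq)).
  by rewrite subrr mulr0 normr0 mulr0.
by rewrite normrM ler_wpM2r// fg.
Qed.

End Sums.

Section Grid.
Context {R : realType}.

Definition grid (n k : nat) : R := k%:R / n.+1%:R.

Lemma grid0 n : grid n 0 = 0. Proof. by rewrite /grid mul0r. Qed.

Lemma grid_ge0 n k : 0 <= grid n k. Proof. by rewrite /grid divr_ge0. Qed.

Lemma gridn n : grid n n.+1 = 1.
Proof. by rewrite /grid divff// pnatr_eq0. Qed.

Lemma gridS n k : grid n k.+1 = grid n k + n.+1%:R^-1.
Proof. by rewrite /grid -natr1 mulrDl mul1r. Qed.

Lemma grid_le n k : grid n k <= grid n k.+1.
Proof. by rewrite gridS lerDl invr_ge0. Qed.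

Lemma grid_le1 n k : (k <= n.+1)%N -> grid n k <= 1.
Proof. by rewrite -(gridn n) => kn; apply: (nondec_nat (@grid_le n)). Qed.

Definition RSsum (n : nat) (a x : R -> R) (t : R) : R :=
  \sum_(k < n.+1) a (grid n k) *
    (x (Num.min t (grid n k.+1)) - x (Num.min t (grid n k))).

Lemma RSsum0 n a x : RSsum n a x 0 = 0.
Proof.
rewrite /RSsum big1// => k _.
by rewrite !min_l ?grid_ge0// subrr mulr0.
Qed.

Lemma RSsum_incr n a x (s t : R) : s <= t -> RSsum n a x t - RSsum n a x s =
  \sum_(k < n.+1) a (grid n k) * (x (clip s t (grid n k.+1)) - x (clip s t (grid n k))).
Proof.
move=> st; rewrite /RSsum -sumrB; apply: eq_bigr => k _.
rewrite !clip_split// ![Num.min (grid _ _) _]minC; ring.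
Qed.

Lemma RSsum_hld_le alpha (C : R) n a x : 0 <= alpha -> hld_le alpha C x ->
  hld_le alpha (\sum_(k < n.+1) `|a (grid n k)| * (C + C)) (RSsum n a x).
Proof.
move=> a0 xC.
apply: (@hld_le_sum _ alpha n.+1 (fun k => `|a (grid n k)| * (C + C))
  (fun k t => a (grid n k) *
    (x (Num.min t (grid n k.+1)) - x (Num.min t (grid n k))))) => k _.
apply: (@hld_leZ _ _ _ _ (fun t => x (Num.min t (grid n k.+1)) - x (Num.min t (grid n k)))).
by apply: (@hld_leB _ alpha C C (fun t => x (Num.min t (grid n k.+1)))
   (fun t => x (Num.min t (grid n k)))); apply: hld_le_stop => //; exact: grid_ge0.
Qed.

Lemma RSsum_clamp n a x (t : R) : (forall t, x t = x (clamp01 t)) ->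
  RSsum n a x t = RSsum n a x (clamp01 t).
Proof.
move=> xc; have E r : 0 <= r <= 1 -> x (Num.min t r) = x (Num.min (clamp01 t) r).
  move=> /andP[r0 r1]; have [t0|t0] := ltP t 0.
    have c0 : clamp01 t = 0 by rewrite /clamp01 max_l// ge_min ltW.
    by rewrite c0 min_l ?(min_l r0) ?(ltW (lt_le_trans t0 r0))// xc c0.
  have [t1|t1] := leP t 1; first by rewrite clamp01_id ?t0.
  have c1 : clamp01 t = 1 by rewrite /clamp01 min_r ?ltW// max_r.
  by rewrite c1 (min_r r1) min_r// (le_trans r1)// ltW.
rewrite /RSsum; apply: eq_bigr => k _; rewrite !E// grid_ge0 grid_le1//.
exact: ltnW.
Qed.

Lemma compare_RSsum alpha (K w d : R) (a : C01 R) x n m (s t : R) :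
  var_bound alpha K x -> 0 <= s -> s <= t -> t <= 1 ->
  (forall r r', `|r - r'| <= d -> `|a r - a r'| <= w) ->
  n.+1%:R^-1 <= d -> m.+1%:R^-1 <= d ->
  `|(RSsum n a x t - RSsum m a x t) - (RSsum n a x s - RSsum m a x s)|
     <= w * K * (t - s) `^ alpha.
Proof.
move=> xK s0 st t1 aw nd md.
have w0 : 0 <= w.
  have := aw 0 0; rewrite !subrr normr0; apply.
  by apply: le_trans nd; rewrite invr_ge0.
have -> : RSsum n a x t - RSsum m a x t - (RSsum n a x s - RSsum m a x s) =
  (RSsum n a x t - RSsum n a x s) - (RSsum m a x t - RSsum m a x s) by ring.
rewrite !RSsum_incr//.
apply: (@compare_sums _ alpha K w x n.+1 m.+1 (fun i => clip s t (grid n i))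
  (fun i => clip s t (grid m i)) (fun k => a (grid n k)) (fun k => a (grid m k))) => //.
- by move=> i; apply: clip_le; exact: grid_le.
- by move=> i; apply: clip_le; exact: grid_le.
- by rewrite clip_lo// grid0.
- by rewrite clip_lo// grid0.
- by rewrite clip_hi// gridn.
- by rewrite clip_hi// gridn.
- move=> i k _ _ /clip_lt; rewrite gridS => h1 /clip_lt; rewrite gridS => h2.
  apply: aw; move: h1 h2; move: (grid n i) (grid m k) => y z h1 h2.
  have {}h1 := lt_le_trans h1 (lerD (lexx z) md).
  have {}h2 := lt_le_trans h2 (lerD (lexx y) nd).
  by rewrite ler_norml; apply/andP; split; lra.
Qed.

End Grid.

(** * Riemann-Stieltjes integrals *)

Section RiemannStieltjes.
Context {R : realType}.
Implicit Types (x : R -> R) (s t r : R).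

Lemma near_inv_succ (d : R) : 0 < d -> \forall n \near \oo, n.+1%:R^-1 <= d.
Proof.
move=> d0; near=> n; have : n.+1%:R^-1 < d by near: n; exact: near_infty_natSinv_lt (PosNum d0).
exact: ltW.
Unshelve. all: by end_near. Qed.

Lemma partition_mono (u t : R) (s : seq R) i : itv_partition u t s ->
  nth t (u :: s) i <= nth t (u :: s) i.+1.
Proof.
move=> p01; have [ils|sli] := ltnP i (size s).
  case: p01 => ps _; have /pathP := ps => /(_ t i ils)/= => h; exact: ltW.
rewrite [leRHS]nth_default//; have [->|] := eqVneq i (size s).
  by rewrite (itv_partition_nth_size _ p01).
by move=> si; rewrite nth_default//= ltn_neqAle eq_sym si.
Qed.

Lemma var_bound_BV alpha (K : R) x : var_bound alpha K x -> bounded_variation 0 1 x.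
Proof.
move=> xK; exists K => _ [s p01 <-]; rewrite /variation big_mkord.
have := xK (size s) (nth 1 (0 :: s)) (fun i => partition_mono i p01).
rewrite (itv_partition_nth_size _ p01) /= subr0 powR1 mulr1; exact.
Qed.

Lemma uniform_partition t (d : R) : 0 < t -> 0 < d -> exists2 s : seq R,
  itv_partition 0 t s & forall i, (i < size s)%N ->
    nth t (0 :: s) i.+1 - nth t (0 :: s) i < d.
Proof.
move=> t0 d0; have [n /= nd] := @filter_ex _ \oo _ _ (near_inv_succ (divr_gt0 d0 (ltr_wpDl (ltW t0) ltr01))).
pose s := [seq grid n i * t | i <- iota 1 n.+1].
have sizes : size s = n.+1 by rewrite size_map size_iota.
have nthE i : (i <= n.+1)%N -> nth t (0 :: s) i = grid n i * t.
  case: i => [|i] iN /=; first by rewrite grid0 mul0r.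
  by rewrite (nth_map 0%N) ?size_iota// nth_iota.
exists s; [split|].
- apply/(pathP t) => i; rewrite sizes => iN.
  have := nthE i.+1 iN => /= ->; have := nthE i (ltnW iN) => /= ->.
  by rewrite ltr_pM2r// gridS ltrDl invr_gt0.
- have -> : last 0 s = nth t (0 :: s) (size s) by rewrite nth_last.
  by rewrite sizes nthE// gridn mul1r.
move=> i; rewrite sizes => iN /=; have /= -> := nthE i.+1 iN.
have -> := nthE i (ltnW iN).
rewrite -mulrBl gridS addrAC subrr add0r.
apply: (@le_lt_trans _ _ (d / (t + 1) * t)); first by rewrite ler_pM2r.
by rewrite mulrAC ltr_pdivrMr ?ltr_wpDl// ?ltW// ltr_pM2l// ltrDl.
Qed.

Lemma RS_unique (a x : R -> R) t v v' : 0 <= t ->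
  is_RS_integral a x t v -> is_RS_integral a x t v' -> v = v'.
Proof.
move=> t0 rv rv'; apply/eqP; rewrite -subr_eq0 -normr_le0.
apply/ler_addgt0Pr => e e0; rewrite add0r.
have [d d0 hd] := rv _ (divr_gt0 e0 (@ltr0n R 2)).
have [d' d'0 hd'] := rv' _ (divr_gt0 e0 (@ltr0n R 2)).
have [s ps sd] : exists2 s : seq R, itv_partition 0 t s &
    forall i, (i < size s)%N -> nth t (0 :: s) i.+1 - nth t (0 :: s) i < Num.min d d'.
  move: t0; rewrite le_eqVlt => /predU1P[<-|t0].
    by exists [::] => //; split.
  by apply: uniform_partition => //; rewrite lt_min d0.
have tag i : (i < size s)%N -> nth t (0 :: s) i <= nth t (0 :: s) i <= nth t (0 :: s) i.+1.
  by move=> _; rewrite lexx partition_mono.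
have := hd s (nth t (0 :: s)) ps _ tag.
have := hd' s (nth t (0 :: s)) ps _ tag.
move=> /=; set S := \sum_(i < _) _ => h' h.
have {}h : `|S - v| < e / 2 by apply: h => i /sd; rewrite lt_min => /andP[].
have {}h' : `|S - v'| < e / 2 by apply: h' => i /sd; rewrite lt_min => /andP[].
rewrite (splitr e) (le_trans (ler_distD S _ _))// lerD ?ltW//.
by rewrite distrC.
Qed.

Section integral.
Variables (alpha : R) (alpha0 : 0 < alpha) (a : C01 R) (x : R -> R) (K : R).
Hypothesis xK : var_bound alpha K x.
Hypothesis xc : forall t, x t = x (clamp01 t).

Definition RSint (t : R) : R := limn (fun n => RSsum n a x (clamp01 t)).

Let K0 : 0 <= K. Proof. exact: hld_le_ge0 (var_bound_hld xK). Qed.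

Lemma RSsum_cvg t : RSsum n a x (clamp01 t) @[n --> \oo] --> RSint t.
Proof.
apply/cauchy_cvgP/cauchy_ballP => e e0; have /andP[t0 t1] := clamp01_itv t.
have [d d0 ad] := C01_modulus a (divr_gt0 e0 (ltr_wpDl K0 ltr01)).
rewrite near_map2; near=> n m.
have nd : n.+1%:R^-1 <= d by near: n; exact: near_inv_succ.
have md : m.+1%:R^-1 <= d by near: m; exact: near_inv_succ.
have := compare_RSsum xK (lexx _) t0 t1 (fun r r' h => ltW (ad r r' h)) nd md.
rewrite !RSsum0 !subr0 /ball /= => /le_lt_trans; apply.
apply: (@le_lt_trans _ _ (e / (K + 1) * K)); last first.
  by rewrite mulrAC ltr_pdivrMr ?ltr_wpDl// ltr_pM2l// ltrDl.
rewrite ler_piMr//; first by rewrite mulr_ge0// divr_ge0 ?ltW// ltr_wpDl.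
apply: (@le_trans _ _ (1 `^ alpha)); last by rewrite powR1.
by apply: ge0_ler_powR; rewrite ?nnegrE// ltW.
Unshelve. all: by end_near. Qed.

Lemma RSint_dist n (w : R) : (forall r r', `|r - r'| <= n.+1%:R^-1 -> `|a r - a r'| <= w) ->
  hld_le alpha (w * K) (RSint \- RSsum n a x).
Proof.
move=> aw s t s0 st t1; apply/ler_addgt0Pr => e e0.
have e2 : 0 < e / 2 by rewrite divr_gt0.
have s01 : 0 <= s <= 1 by rewrite s0 (le_trans st).
have t01 : 0 <= t <= 1 by rewrite t1 (le_trans s0).
have /cvgrPdist_lt /(_ _ e2) Ht := @RSsum_cvg t.
have /cvgrPdist_lt /(_ _ e2) Hs := @RSsum_cvg s.
have n1 : 0 < n.+1%:R^-1 :> R by rewrite invr_gt0.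
have [m [/= [h1 h2] h3]] := @filter_ex _ \oo _ _ (filterI (filterI Ht Hs) (near_inv_succ n1)).
have := compare_RSsum xK s0 st t1 aw (lexx _) h3.
move: h1 h2; rewrite !clamp01_id//= => h1 h2 h4.
have -> : RSint t - RSsum n a x t - (RSint s - RSsum n a x s) =
   (RSint t - RSsum m a x t) - (RSint s - RSsum m a x s) -
   (RSsum n a x t - RSsum m a x t - (RSsum n a x s - RSsum m a x s)) by ring.
apply: le_trans (ler_normB _ _) _; rewrite addrC; apply: lerD => //.
rewrite (splitr e); apply: le_trans (ler_normB _ _) _.
by apply: lerD; exact: ltW.
Qed.

Lemma RSint0 : RSint 0 = 0.
Proof.
apply/cvg_lim => //; rewrite clamp01_id ?lexx ?ler01//.
under eq_fun do rewrite RSsum0.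
exact: cvg_cst.
Qed.

Lemma RSint_RS t : 0 <= t <= 1 -> is_RS_integral a x t (RSint t).
Proof.
move=> t01; have /andP[t0 t1] := t01 => e e0.
have K1 : 0 < K + 1 by rewrite ltr_wpDl.
pose w := e / 2 / (K + 1).
have w0 : 0 < w by rewrite !divr_gt0.
have [d d0 ad] := C01_modulus a w0.
have d2 : 0 < d / 2 by rewrite divr_gt0.
have [n /= nd] := @filter_ex _ \oo _ _ (near_inv_succ d2).
have ta : t `^ alpha <= 1.
  apply: (@le_trans _ _ (1 `^ alpha)); last by rewrite powR1.
  by apply: ge0_ler_powR; rewrite ?nnegrE// ltW.
have wK : w * K * t `^ alpha < e / 2.
  apply: (@le_lt_trans _ _ (w * K)); first by rewrite ler_piMr// mulr_ge0// ltW.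
  by rewrite /w mulrAC ltr_pdivrMr// ltr_pM2l ?divr_gt0// ltrDl.
exists (d / 2); first exact: d2.
move=> s c ps mesh tag; pose p := nth t (0 :: s).
have p0 : p 0%N = 0 by [].
have pN : p (size s) = t by rewrite /p (itv_partition_nth_size _ ps).
have pm i : p i <= p i.+1 by exact: partition_mono.
rewrite [X in `|X - _|](_ : _ = \sum_(i < size s) a (c i) * (x (p i.+1) - x (p i)))//.
set S := \sum_(i < size s) _.
have -> : S - RSint t = (S - RSsum n a x t) + (RSsum n a x t - RSint t) by ring.
apply: le_lt_trans (ler_normD _ _) _; rewrite (splitr e); apply: ltrD; last first.
  have : hld_le alpha (w * K) (RSint \- RSsum n a x).
    apply: RSint_dist => r r' rr; apply/ltW/ad; apply: (le_trans rr).
    by apply: (le_trans nd); rewrite [leRHS](splitr d) lerDl ltW.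
  move=> /(_ 0 t (lexx _) t0 t1); rewrite /= RSint0 RSsum0 !subr0 distrC.
  by move=> /le_lt_trans; apply.
apply: le_lt_trans wK.
have -> : RSsum n a x t = \sum_(k < n.+1) a (grid n k) *
    (x (clip 0 t (grid n k.+1)) - x (clip 0 t (grid n k))).
  by rewrite -RSsum_incr// RSsum0 subr0.
have := @compare_sums _ alpha K w x (size s) n.+1 p (fun k => clip 0 t (grid n k))
  (fun i => a (c i)) (fun k => a (grid n k)) 0 t xK pm _ p0 _ pN _ (lexx _) t1 (ltW w0).
rewrite subr0; apply.
- by move=> k; apply: clip_le; exact: grid_le.
- by rewrite clip_lo// grid0.
- by rewrite clip_hi// gridn.
move=> i k il _.
have /andP[ci1 ci2] : p i <= c i <= p i.+1 := tag _ il.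
have me : p i.+1 - p i < d / 2 := mesh _ il.
rewrite /clip; set u := Num.min (grid n k.+1) t; set v := Num.min (grid n k) t.
have pi0 : 0 <= p i by rewrite -p0; apply: nondec_nat.
have pit : p i.+1 <= t by rewrite -pN; apply: nondec_nat.
move=> h1 h2; apply/ltW/ad.
have h3 : p i < grid n k + d / 2.
  apply: (@lt_le_trans _ _ (grid n k.+1)); last by rewrite gridS lerD2l.
  by move: h1; rewrite lt_max ltNge pi0/= /u lt_min => /andP[].
have h4 : grid n k < p i.+1.
  move: h2; rewrite gt_max => /andP[_]; rewrite /v gt_min => /orP[//|].
  by rewrite ltNge pit.
by rewrite ler_norml; apply/andP; split; lra.
Qed.

End integral.
End RiemannStieltjes.

(** * Approximation by Riemann-Stieltjes sums *)

Section Approximation.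
Context {R : realType} (alpha beta : R).
Hypothesis (alpha0 : 0 < alpha) (hba : beta < alpha).
Local Notation E1 := (C01 R * C0Hld alpha)%type.
Local Notation E2 := (C0Hld beta).

Lemma hld_le_fin (C : R) (f : R -> R) : hld_le alpha C f -> (hld_norm alpha f < +oo)%E.
Proof.
by move=> fC; apply: (le_lt_trans (hld_norm_le (lexx _) fC)); exact: ltry.
Qed.

Lemma RSsum_CHld_subproof n (y : E1) : (hld_norm alpha (RSsum n y.1 y.2) < +oo)%E.
Proof. exact: hld_le_fin (RSsum_hld_le n y.1 (ltW alpha0) (C0Hld_le y.2)). Qed.

Definition RSsum_CHld n (y : E1) : CHld alpha :=
  MkCHld (fun t => RSsum_clamp n y.1 t (C0Hld_clamp y.2)) (RSsum_CHld_subproof n y).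

Definition RSsum_C0Hld n (y : E1) : E2 := CHld_C0Hld hba (RSsum_CHld n y).

Lemma RSsumB n (a a' x x' : R -> R) t : RSsum n a x t - RSsum n a' x' t =
  RSsum n a (x \- x') t + RSsum n (a \- a') x' t.
Proof.
by rewrite /RSsum -sumrB -big_split /=; apply: eq_bigr => k _; ring.
Qed.

Lemma RSsum_C0Hld_continuous n : continuous (RSsum_C0Hld n).
Proof.
move=> y; apply/cvg_ballP => e e0.
have [M M0 aM] := C01_bounded y.1.
pose C := fine (hld_norm alpha y.2); have xC : hld_le alpha C y.2 := C0Hld_le y.2.
have C0 := hld_le_ge0 xC.
pose L := n.+1%:R * (M + M + (C + 1 + (C + 1))).
have L0 : 0 < L by rewrite mulr_gt0// ?ltr0n//; lra.
pose r := Num.min 1 (e / 2 / L).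
have r0 : 0 < r by rewrite lt_min ltr01 !divr_gt0.
have rL : r * L <= e / 2 by rewrite -ler_pdivlMr// ge_min lexx orbT.
have r1 : r <= 1 by rewrite ge_min lexx.
near=> y'; have : ball y r y' by near: y'; exact: (nbhsx_ballx y r r0).
move=> [ba bx]; apply/C0Hld_ballP.
apply: (@le_lt_trans _ _ (r * L)%:E); last first.
  by rewrite lte_fin (le_lt_trans rL)// gtr_pMr// invf_lt1 ?ltr1n.
apply: le_trans (hld_norm_mono _ (ltW hba)) _.
rewrite -[r * L]add0r; apply: hld_norm_le.
  by rewrite /= !RSsum0 subrr normr0.
have xr : hld_le alpha r (y.2 \- y'.2) := C0Hld_ball_le bx.
have x'C : hld_le alpha (C + 1) y'.2.
  have -> : (y'.2 : R -> R) = y.2 \- (y.2 \- y'.2).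
    by apply/funext => t /=; rewrite opprB addrC subrK.
  by apply: (hld_leW _ (hld_leB xC xr)); rewrite lerD2l.
have -> : RSsum_C0Hld n y \- RSsum_C0Hld n y' =
    (fun t => RSsum n y.1 (y.2 \- y'.2) t + RSsum n (y.1 \- y'.1) y'.2 t).
  by apply/funext => t; exact: RSsumB.
have H1 := RSsum_hld_le n y.1 (ltW alpha0) xr.
have H2 := RSsum_hld_le n (y.1 \- y'.1) (ltW alpha0) x'C.
apply: hld_leW (hld_leD H1 H2).
apply: (@le_trans _ _ (\sum_(k < n.+1) M * (r + r) + \sum_(k < n.+1) r * (C + 1 + (C + 1)))).
  apply: lerD; apply: ler_sum => k _.
    by rewrite ler_wpM2r// addr_ge0// ltW.
  rewrite ler_wpM2r//; first by lra.
  by apply/ltW; exact: C01_ball.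
rewrite !sumr_const !card_ord -[(M * _) *+ _]mulr_natl -[(r * _) *+ _]mulr_natl /L.
by move: (n.+1%:R : R) => k; rewrite le_eqVlt; apply/orP; left; apply/eqP; ring.
Unshelve. all: by end_near. Qed.

Lemma RSint_CHld_exists (y : E1) : exists z : CHld alpha, forall K : R,
  var_bound alpha K y.2 ->
  (forall t, 0 <= t <= 1 -> is_RS_integral y.1 y.2 t (z t)) /\
  forall n (w : R),
    (forall r r', `|r - r'| <= n.+1%:R^-1 -> `|y.1 r - y.1 r'| <= w) ->
    (hld_norm alpha (z \- RSsum n y.1 y.2) <= (w * K)%:E)%E.
Proof.
have [[K0 xK0]|nK] := pselect (exists K, var_bound alpha K y.2); last first.
  by exists (RSsum_CHld 0 y) => K xK; exfalso; apply: nK; exists K.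
have RSc t : RSint y.1 y.2 t = RSint y.1 y.2 (clamp01 t).
  by rewrite /RSint (clamp01_id (clamp01_itv t)).
have [M M0 aM] := C01_bounded y.1.
have am r r' : `|r - r'| <= 1%:R^-1 -> `|y.1 r - y.1 r'| <= M + M.
  by move=> _; apply: le_trans (ler_normB _ _) _; exact: lerD.
have RSf : (hld_norm alpha (RSint y.1 y.2) < +oo)%E.
  have h1 := RSint_dist alpha0 xK0 am.
  have h2 := RSsum_hld_le 0 y.1 (ltW alpha0) (C0Hld_le y.2).
  have E : (RSint y.1 y.2 \- RSsum 0 y.1 y.2) \+ RSsum 0 y.1 y.2 = RSint y.1 y.2.
    by apply/funext => t /=; rewrite subrK.
  by have := hld_leD h1 h2; rewrite E; exact: hld_le_fin.
exists (MkCHld RSc RSf) => K xK; split; first by move=> t; apply: RSint_RS xK _.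
move=> n w aw; rewrite -[w * K]add0r; apply: hld_norm_le => /=.
  by rewrite RSint0 RSsum0 subrr normr0.
exact: RSint_dist.
Qed.

Lemma RSint_C0Hld_exists : exists Psi : E1 -> E2, forall (y : E1) (K : R),
  var_bound alpha K y.2 ->
  (forall t, 0 <= t <= 1 -> is_RS_integral y.1 y.2 t (Psi y t)) /\
  forall n (w e : R),
    (forall r r', `|r - r'| <= n.+1%:R^-1 -> `|y.1 r - y.1 r'| <= w) ->
    w * K < e -> ball (RSsum_C0Hld n y) e (Psi y).
Proof.
have /choice[z zP] := RSint_CHld_exists.
exists (fun y => CHld_C0Hld hba (z y)) => y K xK.
have [h1 h2] := zP y K xK; split; first exact: h1.
move=> n w e aw wKe; apply/C0Hld_ballP; rewrite hld_norm_sym.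
apply: le_lt_trans (hld_norm_mono _ (ltW hba)) _.
by apply: le_lt_trans (h2 n w aw) _; rewrite lte_fin.
Qed.

Lemma compact_modulus (S : set E1) (e : R) : compact S -> 0 < e ->
  \forall n \near \oo, forall y, S y -> forall r r', `|r - r'| <= n.+1%:R^-1 ->
    `|y.1 r - y.1 r'| < e.
Proof.
move=> /compact_near_coveringP cS e0; apply: (cS _ \oo) => y _.
have e3 : 0 < e / 3 by rewrite divr_gt0.
have [d d0 ad] := C01_modulus y.1 e3.
exists ([set y' | ball y (e / 3) y'], [set n | n.+1%:R^-1 <= d]).
  by split; [exact: (nbhsx_ballx y _ e3)|exact: near_inv_succ].
move=> [y' n] /= [[/C01_ball ba _] nd] r r' rr.
have h1 := ba r; have h2 := ba r'; have h3 := ad r r' (le_trans rr nd).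
have -> : y'.1 r - y'.1 r' = - (y.1 r - y'.1 r) + (y.1 r' - y'.1 r') + (y.1 r - y.1 r').
  by ring.
have -> : e = e / 3 + e / 3 + e / 3 by field.
apply: le_lt_trans (ler_normD _ _) _; apply: ltrD => //.
apply: le_lt_trans (ler_normD _ _) _; apply: ltrD => //.
by rewrite normrN.
Qed.

End Approximation.

(** * Measurability with respect to a sub-sigma-algebra *)

Section SubSigmaAlgebra.
Context {R : realType} {T : pointedType} (G : set_system T).
Hypothesis HG : sigma_algebra setT G.
Implicit Types (f g : T -> R) (A B : set T).

Definition fmeas f := forall B : set R, measurable B -> G (f @^-1` B).

Let gT := g_sigma_algebraType G.

Lemma salgE : @measurable _ gT = G.
Proof. exact: measurable_g_measurableTypeE. Qed.

Lemma fmeasP f : fmeas f <-> @measurable_fun _ _ gT R setT f.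
Proof.
split=> [fG _ B mB|fG B mB]; first by rewrite setTI salgE; exact: fG.
by rewrite -salgE -[X in measurable X]setTI; exact: fG.
Qed.

Lemma salg0 : G set0. Proof. by case: HG. Qed.

Lemma salgC A : G A -> G (~` A).
Proof. by case: HG => _ h _ /h; rewrite setTD. Qed.

Lemma salgT : G setT. Proof. by rewrite -setC0; apply/salgC/salg0. Qed.

Lemma salg_bigcup (A : nat -> set T) : (forall n, G (A n)) -> G (\bigcup_n A n).
Proof. by case: HG => _ _; apply. Qed.

Lemma salg_bigcup_rat (A : rat -> set T) : (forall q, G (A q)) -> G (\bigcup_q A q).
Proof. by rewrite -salgE => h; apply: bigcupT_measurable_rat. Qed.

Lemma salgU A B : G A -> G B -> G (A `|` B).
Proof. by rewrite -salgE => *; exact: measurableU. Qed.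

Lemma salgI A B : G A -> G B -> G (A `&` B).
Proof. by rewrite -salgE => *; exact: measurableI. Qed.

Lemma salg_bigcap (A : nat -> set T) : (forall n, G (A n)) -> G (\bigcap_n A n).
Proof. by rewrite -salgE => h; apply: bigcapT_measurable. Qed.

Lemma salg_and (P : Prop) A : (P -> G A) -> G [set w | P /\ A w].
Proof.
move=> PA; have [p|np] := pselect P.
  by rewrite (_ : [set w | _] = A); [exact: PA|apply/seteqP; split => [w []|w]].
by rewrite (_ : [set w | _] = set0); [exact: salg0|apply/seteqP; split => [w []|w]].
Qed.

Lemma fmeas_cst (c : R) : fmeas (fun=> c).
Proof. by apply/fmeasP; exact: measurable_cst. Qed.

Lemma fmeasD f g : fmeas f -> fmeas g -> fmeas (fun w => f w + g w).
Proof. by move=> /fmeasP mf /fmeasP mg; apply/fmeasP; exact: measurable_funD. Qed.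

Lemma fmeasB f g : fmeas f -> fmeas g -> fmeas (fun w => f w - g w).
Proof. by move=> /fmeasP mf /fmeasP mg; apply/fmeasP; exact: measurable_funB. Qed.

Lemma fmeasM f g : fmeas f -> fmeas g -> fmeas (fun w => f w * g w).
Proof. by move=> /fmeasP mf /fmeasP mg; apply/fmeasP; exact: measurable_funM. Qed.

Lemma fmeas_comp (h : R -> R) f : measurable_fun setT h -> fmeas f -> fmeas (fun w => h (f w)).
Proof.
by move=> mh /fmeasP mf; apply/fmeasP; exact: (measurableT_comp mh mf).
Qed.

Lemma fmeas_norm f : fmeas f -> fmeas (fun w => `|f w|).
Proof. exact: fmeas_comp (@normr_measurable _ _). Qed.

Lemma fmeas_sum n (f : nat -> T -> R) : (forall i, (i < n)%N -> fmeas (f i)) ->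
  fmeas (fun w => \sum_(i < n) f i w).
Proof.
elim: n => [|n IH] mf.
  by under eq_fun do rewrite big_ord0; exact: fmeas_cst.
under eq_fun do rewrite big_ord_recr /=; apply: fmeasD; last exact: mf.
by apply: IH => i /ltnW/mf.
Qed.

Lemma fmeas_gt f (c : R) : fmeas f -> G [set w | c < f w].
Proof.
move=> mf; rewrite (_ : [set w | _] = f @^-1` `]c, +oo[); first exact: mf.
by apply/seteqP; split => w /=; rewrite in_itv/= andbT.
Qed.

Lemma fmeas_ge f (c : R) : fmeas f -> G [set w | c <= f w].
Proof.
move=> mf; rewrite (_ : [set w | _] = f @^-1` `[c, +oo[); first exact: mf.
by apply/seteqP; split => w /=; rewrite in_itv/= andbT.
Qed.

Lemma fmeas_of_gt f : (forall c : R, G [set w | c < f w]) -> fmeas f.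
Proof.
move=> mf; apply/fmeasP; apply: (measurability _ (RGenOInfty.measurableE R)) => //.
move=> _ [_ [c ->] <-]; rewrite setTI salgE.
rewrite (_ : _ @^-1` _ = [set w | c < f w]); first exact: mf.
by apply/seteqP; split => w /=; rewrite in_itv/= andbT.
Qed.

Lemma fmeas_ind (b : T -> bool) : G [set w | b w] -> fmeas (fun w => (b w)%:R).
Proof.
move=> mb; apply: fmeas_of_gt => c.
have [c0|c0] := ltP c 0.
  rewrite (_ : [set w | _] = setT); first exact: salgT.
  by apply/seteqP; split => w //= _; case: (b w) => //=; apply: (lt_trans c0).
have [c1|c1] := ltP c 1.
  rewrite (_ : [set w | _] = [set w | b w])//.
  by apply/seteqP; split => w /=; case: (b w) => //=; rewrite ltNge c0.
rewrite (_ : [set w | _] = set0); first exact: salg0.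
by apply/seteqP; split => w //=; case: (b w) => /=; rewrite ltNge ?c0 ?c1.
Qed.

Lemma fmeas_cvg (h : nat -> T -> R) f : (forall n, fmeas (h n)) ->
  (forall w, h n w @[n --> \oo] --> f w) -> fmeas f.
Proof.
move=> mh hf; apply/fmeasP.
by apply: (@measurable_fun_cvg _ gT R setT h) => // n; apply/fmeasP.
Qed.

Lemma fmeas_ext f g : (forall w, f w = g w) -> fmeas f -> fmeas g.
Proof. by move=> /funext ->. Qed.

Lemma fmeas_preimage_and f A (B : set R) : G A -> measurable B ->
  fmeas (fun w => f w * (`[< A w >])%:R) -> G (f @^-1` B `&` A).
Proof.
move=> GA mB mf; rewrite (_ : _ `&` _ = (fun w => f w * (`[< A w >])%:R) @^-1` B `&` A).
  by apply: salgI => //; exact: mf.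
by apply/seteqP; split => w /= [Bw Aw]; split => //; move: Bw; rewrite asboolT// mulr1.
Qed.

Lemma grid_sum_stop (h : R -> R) (t r : R) N n : 0 <= t -> 0 <= r ->
  exists j, [/\ (j <= N)%N, h 0 + \sum_(k < N) (h (grid n k.+1 * t) - h (grid n k * t)) *
     (grid n k.+1 * t <= r)%R%:R = h (grid n j * t), grid n j * t <= r &
     (r < grid n j.+1 * t) \/ j = N].
Proof.
move=> t0 r0; elim: N => [|N [j [jN Sj gj rj]]].
  by exists 0%N; rewrite big_ord0 addr0 grid0 mul0r; split => //; right.
rewrite big_ord_recr /= addrA Sj; have [gr|rg] := leP (grid n N.+1 * t) r; last first.
  exists j; rewrite mulr0 addr0; split => //; first exact: leqW.
  by left; case: rj => // ->.
have -> : j = N.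
  case: rj => // rj; apply/eqP; rewrite eqn_leq jN leqNgt; apply/negP => jN'.
  have := lt_le_trans (le_lt_trans gr rj) (ler_wpM2r t0 (nondec_nat (@grid_le R n) (leqW jN'))).
  by rewrite ltxx.
by exists N.+1; rewrite mulr1 addrC subrK; split => //; right.
Qed.

Lemma fmeas_stop (f : T -> R -> R) (rho : T -> R) (t : R) : 0 <= t ->
  (forall w, continuous (f w)) -> (forall s, 0 <= s <= t -> fmeas (fun w => f w s)) ->
  (forall w, 0 <= rho w <= t) -> fmeas rho -> fmeas (fun w => f w (rho w)).
Proof.
move=> t0 fc mf rhot mrho.
pose h n w := f w 0 + \sum_(k < n.+1) (f w (grid n k.+1 * t) - f w (grid n k * t)) *
     (grid n k.+1 * t <= rho w)%R%:R.
have gt n k : (k <= n.+1)%N -> 0 <= grid n k * t <= t.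
  by move=> kn; rewrite mulr_ge0 ?grid_ge0//= ler_piMl// grid_le1.
apply: (@fmeas_cvg h) => [n|w].
  apply: fmeasD; first by apply: mf; rewrite lexx.
  apply: (@fmeas_sum n.+1 (fun k w => (f w (grid n k.+1 * t) - f w (grid n k * t)) *
     (grid n k.+1 * t <= rho w)%R%:R)) => k kn.
  apply: fmeasM; last by apply: fmeas_ind; exact: fmeas_ge.
  by apply: fmeasB; apply: mf; apply: gt => //; exact: ltnW.
have /andP[r0 rt] := rhot w.
apply/cvgrPdist_lt => e e0; have /cvgrPdist_lt /(_ _ e0) /nbhs_ballP[d /= d0 fd] := fc w (rho w).
have d2 : 0 < d / 2 / (t + 1) by rewrite !divr_gt0// ltr_wpDl.
near=> n; rewrite /h.
have [j [jn -> gj rj]] := grid_sum_stop (f w) n.+1 n t0 r0.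
have nd : n.+1%:R^-1 <= d / 2 / (t + 1) by near: n; exact: near_inv_succ.
apply: (fd (grid n j * t)); rewrite /ball /= ger0_norm ?subr_ge0//.
case: rj => [rj|jE]; last first.
  have -> : rho w = grid n j * t.
    by apply/eqP; rewrite eq_le gj andbT jE gridn mul1r.
  by rewrite subrr.
apply: (@le_lt_trans _ _ (grid n j.+1 * t - grid n j * t)); first by rewrite lerD2r ltW.
rewrite -mulrBl gridS addrAC subrr add0r.
apply: (@le_lt_trans _ _ (d / 2 / (t + 1) * t)); first by rewrite ler_wpM2r.
apply: (@le_lt_trans _ _ (d / 2)); last by rewrite [ltRHS](splitr d) ltrDl divr_gt0.
rewrite mulrAC ler_pdivrMr ?ltr_wpDl//; apply: ler_wpM2l; first by rewrite divr_ge0// ltW.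
by rewrite lerDl.
Unshelve. all: by end_near. Qed.

Lemma salg_unif_norm_gt (f : T -> R -> R) (c : R) :
  (forall t : R, 0 <= t <= 1 -> fmeas (fun w => f w t)) ->
  (forall w (t : R), 0 < t <= 1 -> f w s @[s --> t^'-] --> f w t) ->
  G [set w | (c%:E < unif_norm (f w))%E].
Proof.
move=> mf lf; pose A (q : rat) : set T := [set w | (0 <= (ratr q : R) <= 1) /\ c < `|f w (ratr q)|].
have -> : [set w | (c%:E < unif_norm (f w))%E] =
   [set w | c < `|f w 0|] `|` \bigcup_q A q.
  apply/seteqP; split => w /=; last first.
    case=> [c0|[q _ [q01 cq]]].
      by apply: lt_le_trans (unif_norm_ub (f w) (_ : 0 <= 0 <= 1)); rewrite ?lte_fin ?lexx ?ler01.
    by apply: lt_le_trans (unif_norm_ub (f w) q01); rewrite lte_fin.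
  move=> /ereal_sup_gt[_ [t t01 ->]]; rewrite lte_fin => ct.
  have /andP[] := t01; rewrite le_eqVlt => /predU1P[t0|t0] t1.
    by left; rewrite t0.
  right; have ct0 : 0 < `|f w t| - c by rewrite subr_gt0.
  have /cvgrPdist_lt /(_ _ ct0) : f w s @[s --> t^'-] --> f w t by apply: lf; rewrite t0.
  move=> ne; have [d /= d0 dn] : exists2 d : R, 0 < d & forall s, t - d < s -> s < t ->
      `|f w t - f w s| < `|f w t| - c.
    move: ne; rewrite /at_left near_withinE => /nbhs_ballP[d /= d0 hd].
    exists d => // s ds st; apply: hd => //; rewrite /ball /= ger0_norm ?subr_ge0 ?ltW//.
    by rewrite ltrBlDl -ltrBlDr.
  have : Num.max 0 (t - d) < t by rewrite gt_max t0/= gtrBl.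
  move=> /rat_in_itvoo[q]; rewrite in_itv/= gt_max => /andP[/andP[q0 q1] q2].
  exists q => //; split; first by rewrite (ltW q0)/= (le_trans (ltW q2)).
  have : `|f w t - f w (ratr q)| < `|f w t| - c by exact: dn.
  have := lerB_dist (f w t) (f w (ratr q)); lra.
apply: salgU; first by apply/fmeas_gt/fmeas_norm/mf; rewrite lexx ler01.
apply: salg_bigcup_rat => q; apply: salg_and => q01.
exact/fmeas_gt/fmeas_norm/mf.
Qed.

Lemma salg_hld_norm_gt (f : T -> R -> R) (alpha c : R) : 0 <= alpha ->
  (forall t : R, 0 <= t <= 1 -> fmeas (fun w => f w t)) -> (forall w, continuous (f w)) ->
  G [set w | (c%:E < hld_norm alpha (f w))%E].
Proof.
move=> a0 mf fc.
pose A (p q : rat) := [set w | [/\ 0 <= ratr p :> R, ratr p < ratr q :> R & ratr q <= 1 :> R] /\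
  c < `|f w 0| + hld_quot alpha (f w) (ratr p) (ratr q)].
have -> : [set w | (c%:E < hld_norm alpha (f w))%E] = \bigcup_p \bigcup_q A p q.
  apply/seteqP; split => w /=; last first.
    move=> [p _ [q _ [[p0 pq q1] h]]]; apply: (@lt_le_trans _ _ (`|f w 0|%:E +
      (hld_quot alpha (f w) (ratr p) (ratr q))%:E)%E); first by rewrite -EFinD lte_fin.
    by apply: leeD2l; apply: ereal_sup_ubound; exists (ratr p), (ratr q).
  rewrite /hld_norm -lteBlDl// -EFinB => /ereal_sup_gt[_ [s [t [s0 st t1 ->]]]].
  rewrite lte_fin /hld_quot ltr_pdivlMr ?powR_gt0 ?subr_gt0// => h.
  set D := (t - s) `^ alpha in h; set c' := c - `|f w 0| in h *.
  pose e := (`|f w t - f w s| - c' * D) / 2.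
  have e0 : 0 < e by rewrite divr_gt0// subr_gt0.
  have /cvgrPdist_lt /(_ _ e0) /nbhs_ballP[d1 /= d10 h1] := fc w s.
  have /cvgrPdist_lt /(_ _ e0) /nbhs_ballP[d2 /= d20 h2] := fc w t.
  have m1 : s < Num.min ((s + t) / 2) (s + d1) by rewrite lt_min; apply/andP; split; lra.
  have m2 : Num.max ((s + t) / 2) (t - d2) < t by rewrite gt_max; apply/andP; split; lra.
  have [p] := rat_in_itvoo m1; rewrite in_itv/= lt_min => /and3P[sp p1 p2].
  have [q] := rat_in_itvoo m2; rewrite in_itv/= gt_max => /andP[/andP[q1 q2] qt].
  exists p => //; exists q => //; split; first by split; lra.
  have hp : `|f w s - f w (ratr p)| < e.
    by apply: h1; rewrite /ball/= ler0_norm; lra.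
  have hq : `|f w t - f w (ratr q)| < e.
    by apply: h2; rewrite /ball/= ger0_norm; lra.
  have pq : 0 < ratr q - ratr p :> R by lra.
  rewrite -ltrBlDl -/c' /hld_quot ltr_pdivlMr ?powR_gt0//.
  have big : c' * D < `|f w (ratr q) - f w (ratr p)|.
    have E : f w t - f w s = (f w t - f w (ratr q)) - (f w s - f w (ratr p)) +
      (f w (ratr q) - f w (ratr p)) by ring.
    have := ler_normD ((f w t - f w (ratr q)) - (f w s - f w (ratr p)))
      (f w (ratr q) - f w (ratr p)).
    rewrite -E; have := ler_normB (f w t - f w (ratr q)) (f w s - f w (ratr p)).
    have : e * 2 = `|f w t - f w s| - c' * D by rewrite /e; field.
    lra.
  have [c0|c0] := leP c' 0.
    have [fne|fne] := eqVneq (f w (ratr q) - f w (ratr p)) 0; last first.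
      apply: le_lt_trans (_ : 0 < _); last by rewrite normr_gt0.
      by rewrite mulr_le0_ge0// powR_ge0.
    rewrite fne normr0 in big *.
    have D0 : 0 < D by rewrite powR_gt0 ?subr_gt0.
    have Q0 : 0 < (ratr q - ratr p : R) `^ alpha by rewrite powR_gt0.
    by move: big; rewrite (pmulr_llt0 _ D0) (pmulr_llt0 _ Q0).
  apply: le_lt_trans big; apply: ler_wpM2l; first exact: ltW.
  by rewrite /D; apply: ge0_ler_powR; rewrite ?nnegrE//; lra.
apply: salg_bigcup_rat => p; apply: salg_bigcup_rat => q; apply: salg_and => -[p0 pq q1].
apply: fmeas_gt; apply: fmeasD.
  by apply/fmeas_norm/mf; rewrite lexx ler01.
apply: fmeasM; last exact: fmeas_cst.
apply: fmeas_norm; apply: fmeasB; apply: mf.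
  by rewrite q1 (le_trans p0)// ltW.
by rewrite p0 (le_trans (ltW pq)).
Qed.

Lemma salg_hld_norm_ge (f : T -> R -> R) (alpha c : R) : 0 <= alpha ->
  (forall t : R, 0 <= t <= 1 -> fmeas (fun w => f w t)) -> (forall w, continuous (f w)) ->
  G [set w | (c%:E <= hld_norm alpha (f w))%E].
Proof.
move=> a0 mf fc.
have -> : [set w | (c%:E <= hld_norm alpha (f w))%E] =
    \bigcap_n [set w | ((c - n.+1%:R^-1)%:E < hld_norm alpha (f w))%E].
  apply/seteqP; split => w /= => [h n _|h].
    by apply: lt_le_trans h; rewrite lte_fin gtrBl invr_gt0.
  apply/lee_subgt0Pr => e e0; have [n /= ne] := @filter_ex _ \oo _ _ (near_inv_succ e0).
  by apply: (@le_trans _ _ (c - n.+1%:R^-1)%:E);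
    [rewrite -EFinB lee_fin lerB|exact: ltW (h n I)].
by apply: salg_bigcap => n; exact: salg_hld_norm_gt.
Qed.

End SubSigmaAlgebra.

(** * Refinement and stopping of step sums *)

Section StoppedSums.
Context {R : realType}.
Implicit Types (t s r lo hi : R) (sigma tau : \bar R) (f a : R -> R).

Definition tmin t tau : R := fine (mine t%:E tau).

Definition eclip lo hi sigma : \bar R := maxe lo%:E (mine sigma hi%:E).

Lemma tmin_fin t r : tmin t r%:E = Num.min t r.
Proof. by rewrite /tmin -EFin_min. Qed.

Lemma tmin_pinfty t : tmin t +oo = t.
Proof. by rewrite /tmin min_l ?leey. Qed.

Lemma tmin_le t tau : (0 <= tau)%E -> tmin t tau <= t.
Proof.
case: tau => [r| |]// _; last by rewrite tmin_pinfty.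
by rewrite tmin_fin ge_min lexx.
Qed.

Lemma tmin_ge0 t tau : 0 <= t -> (0 <= tau)%E -> 0 <= tmin t tau.
Proof.
case: tau => [r| |]// t0 r0; last by rewrite tmin_pinfty.
by rewrite tmin_fin le_min t0.
Qed.

Lemma tmin_id t tau : (t%:E <= tau)%E -> tmin t tau = t.
Proof. by move=> h; rewrite /tmin min_l. Qed.

Lemma tminA t sigma tau : (0 <= sigma)%E -> (0 <= tau)%E ->
  tmin t (mine sigma tau) = tmin (tmin t tau) sigma.
Proof.
case: tau => [r| |]// s0 r0; last by rewrite tmin_pinfty min_l ?leey.
case: sigma s0 => [s| |]// s0.
  by rewrite -EFin_min !tmin_fin [Num.min s r]minC minA.
by rewrite min_r ?leey// tmin_pinfty.
Qed.

Lemma tmin_continuous tau : (0 <= tau)%E -> continuous (tmin ^~ tau).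
Proof.
case: tau => [r| |]// _ t.
  under eq_fun do rewrite tmin_fin.
  by apply: continuous_min; [exact: cvg_id|exact: cvg_cst].
under eq_fun do rewrite tmin_pinfty.
exact: cvg_id.
Qed.

Lemma tmin_eclip f t lo hi sigma : (0 <= sigma)%E -> 0 <= lo -> lo <= hi ->
  f (tmin t (eclip lo hi sigma)) =
  f (Num.min (tmin t sigma) hi) + f (Num.min t lo) - f (Num.min (tmin t sigma) lo).
Proof.
case: sigma => [s| |]// s0 lo0 lohi; last first.
  rewrite /eclip min_r ?leey// max_r ?lee_fin// tmin_fin tmin_pinfty.
  by rewrite addrK.
rewrite /eclip -EFin_min -EFin_max !tmin_fin.
have [sl|ls] := leP s lo.
  rewrite [Num.min s hi]min_l ?(le_trans sl)// max_l//.
  rewrite [Num.min _ hi]min_l ?ge_min ?(le_trans sl) ?orbT//.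
  by rewrite [Num.min (Num.min t s) lo]min_l ?ge_min ?sl ?orbT// addrAC subrr add0r.
rewrite max_r ?le_min ?(ltW ls)//.
rewrite minA -[Num.min (Num.min t s) lo]minA (min_r (ltW ls)).
by rewrite addrK.
Qed.

Lemma eclip_le lo hi sigma sigma' : (sigma <= sigma')%E -> (eclip lo hi sigma <= eclip lo hi sigma')%E.
Proof. by move=> h; rewrite /eclip le_max2// le_min2. Qed.

Lemma eclip_ge lo hi sigma : (lo%:E <= eclip lo hi sigma)%E.
Proof. by rewrite /eclip le_max lexx. Qed.

Lemma eclip_lo lo hi sigma : lo <= hi -> (sigma <= lo%:E)%E -> eclip lo hi sigma = lo%:E.
Proof. by move=> st rs; rewrite /eclip max_l// ge_min rs. Qed.

Lemma eclip_hi lo hi sigma : lo <= hi -> (hi%:E <= sigma)%E -> eclip lo hi sigma = hi%:E.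
Proof. by move=> st tr; rewrite /eclip min_r// max_r// lee_fin. Qed.

Section merge.
Variables (n N : nat) (sigma : nat -> \bar R).
Hypothesis sigma0 : sigma 0%N = 0%E.
Hypothesis sigma_le : forall i, (sigma i <= sigma i.+1)%E.

(* The refinement of sigma 0 <= ... <= sigma N by the grid: the k-th block of
   N+1 times consists of the sigma i clipped to [grid n k, grid n k+1]. *)
Definition merge_time (j : nat) : \bar R :=
  eclip (grid n (j %/ N.+1)) (grid n (j %/ N.+1).+1) (sigma (j %% N.+1)%N).

Let sigma_ge0 i : (0 <= sigma i)%E.
Proof. by elim: i => [|i IH]; [rewrite sigma0|exact: le_trans (sigma_le i)]. Qed.

Let sig i := if (i <= N)%N then sigma i else +oo%E.

Let sig_ge0 i : (0 <= sig i)%E. Proof. by rewrite /sig; case: ifPn. Qed.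

Lemma merge_timeE k i : (i <= N.+1)%N ->
  merge_time (k * N.+1 + i) = eclip (grid n k) (grid n k.+1) (if (i <= N)%N then sigma i else +oo%E).
Proof.
rewrite leq_eqVlt => /predU1P[->|iN].
  rewrite -mulSnr /merge_time mulnK// modnMl sigma0 ltnn.
  rewrite eclip_lo ?grid_le ?lee_fin ?grid_ge0//.
  by rewrite eclip_hi ?grid_le ?leey.
rewrite -ltnS iN /merge_time divnMDl// divn_small ?addn0//.
by rewrite modnMDl modn_small.
Qed.

Lemma merge_time0 : merge_time 0%N = 0%E.
Proof. by have := @merge_timeE 0 0 isT; rewrite mul0n => ->; rewrite sigma0 eclip_lo ?grid_le ?grid0. Qed.

Lemma merge_time_le j : (merge_time j <= merge_time j.+1)%E.
Proof.
rewrite (divn_eq j N.+1); set k := (j %/ N.+1)%N; set i := (j %% N.+1)%N.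
have iN : (i < N.+1)%N by rewrite ltn_mod.
rewrite -addnS !merge_timeE//; last exact: ltnW.
rewrite -ltnS iN; apply: eclip_le.
by case: ifPn; rewrite ?leey.
Qed.

Lemma merge_sum (h : nat -> R) (c : R) a f t : 0 <= t <= 1 ->
  \sum_(j < n.+1 * N.+1) (c * (h (j %% N.+1)%N * ((j %% N.+1 < N)%N &&
      (sigma (j %% N.+1)%N < (grid n (j %/ N.+1).+1)%:E)%E)%:R - a (grid n (j %/ N.+1)))) *
    (f (tmin t (merge_time j.+1)) - f (tmin t (merge_time j))) =
  c * (\sum_(i < N) h i * (f (tmin t (sigma i.+1)) - f (tmin t (sigma i)))
       - RSsum n a f t).
Proof.
move=> /andP[t0 t1].
pose D k i := f (tmin t (eclip (grid n k) (grid n k.+1) (sig i.+1))) -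
              f (tmin t (eclip (grid n k) (grid n k.+1) (sig i))).
pose V k i := c * (h i * ((i < N)%N && (sigma i < (grid n k.+1)%:E)%E)%:R - a (grid n k)).
transitivity (\sum_(j < n.+1 * N.+1) V (j %/ N.+1)%N (j %% N.+1)%N * D (j %/ N.+1)%N (j %% N.+1)%N).
  apply: eq_bigr => j _; congr (_ * _); rewrite /D {1 2}(divn_eq j N.+1).
  set k := (j %/ N.+1)%N; set i := (j %% N.+1)%N.
  have iN : (i < N.+1)%N by rewrite ltn_mod.
  by rewrite -addnS !merge_timeE// ltnW.
rewrite (@big_divmod _ n.+1 N (fun k i => V k i * D k i)).
have VD k i : V k i * D k i = c * ((i < N)%N%:R * h i * D k i) - c * (a (grid n k) * D k i).
  rewrite /V -mulrA mulrBl mulrBr; congr (c * _ - _).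
  have [iN|] /= := ltnP i N; last by rewrite mulr0 !mul0r.
  rewrite mul1r; have [_|gs] := ltP; first by rewrite mulr1.
  rewrite mulr0 mul0r /D /sig iN ltnW// !eclip_hi ?grid_le//.
    by rewrite subrr mulr0.
  exact: le_trans (sigma_le i).
under eq_bigr do under eq_bigr do rewrite VD.
under eq_bigr do rewrite sumrB -!mulr_sumr.
rewrite sumrB -!mulr_sumr -mulrBr; congr (c * (_ - _)); last first.
  rewrite /RSsum; apply: eq_bigr => k _; congr (_ * _).
  rewrite /D (sum_telescope _ (fun i => f (tmin t (eclip (grid n k) (grid n k.+1) (sig i))))).
  rewrite /sig ltnn leq0n sigma0 eclip_hi ?grid_le ?leey//.
  by rewrite eclip_lo ?grid_le ?lee_fin ?grid_ge0// !tmin_fin.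
rewrite exchange_big /= big_ord_recr /= [X in _ + X]big1 ?addr0; last first.
  by move=> k _; rewrite ltnn mul0r mul0r.
apply: eq_bigr => i _; under eq_bigr do rewrite (ltn_ord i) mul1r.
rewrite -mulr_sumr; congr (_ * _).
pose u i := tmin t (sig i).
have -> : f (tmin t (sigma i.+1)) - f (tmin t (sigma i)) = f (u i.+1) - f (u i).
  by rewrite /u /sig (ltn_ord i) (ltnW (ltn_ord i)).
have ui j : 0 <= u j <= 1.
  by rewrite tmin_ge0//= (le_trans (tmin_le _ _)).
rewrite -[RHS](@sum_clip _ f n.+1 (@grid R n) 0 1 (u i.+1) (u i) (@grid_le R n)) ?grid0 ?gridn//.
apply: eq_bigr => k _; rewrite /D !tmin_eclip ?grid_ge0 ?grid_le//.
rewrite !clip_split ?grid_le// /u; ring.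
Qed.

End merge.

Lemma stop_sum N (sigma : nat -> \bar R) tau (h : nat -> R) f t :
  (forall i, (0 <= sigma i)%E) -> (forall i, (sigma i <= sigma i.+1)%E) -> (0 <= tau)%E ->
  \sum_(i < N) (h i * (sigma i < tau)%E%:R) *
    (f (tmin t (mine (sigma i.+1) tau)) - f (tmin t (mine (sigma i) tau))) =
  \sum_(i < N) h i * (f (tmin (tmin t tau) (sigma i.+1)) - f (tmin (tmin t tau) (sigma i))).
Proof.
move=> s0 sle t0; apply: eq_bigr => i _; rewrite !tminA//.
have [|ts] := ltP (sigma i) tau; first by rewrite mulr1.
rewrite -!tminA// !min_r ?subrr ?mulr0//.
exact: le_trans (sle i).
Qed.

Lemma ind_between t sigma sigma' : (sigma <= sigma')%E -> (0 <= sigma)%E -> 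
  ((t <= tmin t sigma')%R%:R - (t <= tmin t sigma)%R%:R : R) =
  ((sigma < t%:E) && (t%:E <= sigma'))%E%:R.
Proof.
have E (s : \bar R) : (0 <= s)%E -> (t <= tmin t s) = (t%:E <= s)%E.
  case: s => [s| |]// _; last by rewrite tmin_pinfty leey lexx.
  by rewrite tmin_fin le_min lexx lee_fin.
move=> ss s0; rewrite !E//; last exact: le_trans ss.
have [ts|st] := leP t%:E%E sigma.
  by rewrite (le_trans ts)//= subrr.
by rewrite subr0.
Qed.

End StoppedSums.

(** * Stopping times and simple processes *)

Section Stopping.
Context {R : realType} {d : measure_display} {T : measurableType d}.
Variables (P : probability T R) (F : R -> set_system T).
Hypothesis hF : usual_filtration P F.
Implicit Types (sigma tau : T -> \bar R) (s t : R).

Lemma filt_salg t : 0 <= t -> sigma_algebra setT (F t).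
Proof. by case: hF => + _ _ _ _; apply. Qed.

Lemma filt_le s t (A : set T) : 0 <= s -> s <= t -> F s A -> F t A.
Proof. by case: hF => _ _ h _ _ s0 st; exact: h. Qed.

Lemma fmeas_le s t (f : T -> R) : 0 <= s -> s <= t -> fmeas (F s) f -> fmeas (F t) f.
Proof. by move=> s0 st h B mB; apply: filt_le (h B mB). Qed.

Lemma fmeas_meas t (f : T -> R) : 0 <= t -> fmeas (F t) f -> fmeas measurable f.
Proof. by case: hF => _ h _ _ _ t0 mf B mB; apply: h (mf B mB). Qed.

Lemma stop_le sigma s t : stopping_time F sigma -> 0 <= s -> s <= t ->
  F t [set w | (sigma w <= s%:E)%E].
Proof. by move=> [_ h] s0 st; apply: filt_le (h s s0). Qed.

Lemma stop_lt sigma t : stopping_time F sigma -> 0 <= t ->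
  F t [set w | (sigma w < t%:E)%E].
Proof.
move=> hs t0; pose A (q : rat) : set T :=
  [set w | (0 <= (ratr q : R) < t) /\ (sigma w <= (ratr q)%:E)%E].
have -> : [set w | (sigma w < t%:E)%E] = \bigcup_q A q.
  apply/seteqP; split => w /=; last first.
    by move=> [q _ [/andP[_ qt] sq]]; apply: le_lt_trans sq _; rewrite lte_fin.
  move=> st; have s0 : (0 <= sigma w)%E by case: hs => + _; apply.
  case E : (sigma w) s0 st => [r| |]// ; rewrite lee_fin lte_fin => r0 rt.
  have [q] := rat_in_itvoo rt; rewrite in_itv/= => /andP[rq qt].
  by exists q => //; rewrite /A/= E lee_fin (ltW rq) qt (le_trans r0 (ltW rq)).
apply: (salg_bigcup_rat (filt_salg t0)) => q; apply: (salg_and (filt_salg t0)).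
by move=> /andP[q0 qt]; apply: stop_le => //; exact: ltW.
Qed.

Lemma stop_ge sigma t : stopping_time F sigma -> 0 <= t ->
  F t [set w | (t%:E <= sigma w)%E].
Proof.
move=> hs t0; have := salgC (filt_salg t0) (stop_lt hs t0).
rewrite (_ : ~` _ = [set w | (t%:E <= sigma w)%E])//.
by apply/seteqP; split => w /=; rewrite leNgt => /negP.
Qed.

Lemma stop_lt_stop sigma tau t : stopping_time F sigma -> stopping_time F tau ->
  0 <= t -> F t [set w | (sigma w < tau w)%E && (sigma w <= t%:E)%E].
Proof.
move=> hs ht t0; have FS := filt_salg t0.
pose A (q : rat) : set T := [set w | (0 <= (ratr q : R) <= t) /\
  ([set w | (sigma w <= (ratr q)%:E)%E] `&` ~` [set w | (tau w <= (ratr q)%:E)%E]) w].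
have -> : [set w | (sigma w < tau w)%E && (sigma w <= t%:E)%E] =
    ([set w | (sigma w <= t%:E)%E] `&` ~` [set w | (tau w <= t%:E)%E]) `|` \bigcup_q A q.
  apply/seteqP; split => w /=; last first.
    case=> [[h1 /negP]|]; first by rewrite -ltNge => h2; rewrite h1 andbT (le_lt_trans h1 h2).
    move=> [q _ [/andP[q0 qt] /= [sq /negP]]]; rewrite -ltNge => h2.
    by rewrite (le_lt_trans sq h2) (le_trans sq)// lee_fin.
  move=> /andP[st sl]; have [tt|] := leP (tau w) t%:E%E; last first.
    by move=> h; left; split => //; apply/negP; rewrite -ltNge.
  right; have s0 : (0 <= sigma w)%E by case: hs => + _; apply.
  have := le_lt_trans s0 st.
  case E : (sigma w) s0 st sl => [r| |]//; case E' : (tau w) tt => [r'| |]//.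
  rewrite !lee_fin !lte_fin => r't r0 rr' rt _.
  have [q] := rat_in_itvoo rr'; rewrite in_itv/= => /andP[rq qr'].
  exists q => //; rewrite /A/= E E' !lee_fin (ltW rq) (le_trans r0 (ltW rq)).
  rewrite (le_trans (ltW qr') r't); do ! split => //.
  by apply/negP; rewrite -ltNge.
apply: salgU => //.
  by apply: salgI => //; [|apply: salgC => //]; apply: stop_le.
apply: (salg_bigcup_rat FS) => q; apply: (salg_and FS) => /andP[q0 qt].
by apply: salgI => //; [|apply: salgC => //]; apply: stop_le.
Qed.

Lemma stop_mine sigma tau : stopping_time F sigma -> stopping_time F tau ->
  stopping_time F (fun w => mine (sigma w) (tau w)).
Proof.
move=> hs ht; split=> [w|t t0]; first by rewrite le_min (proj1 hs) (proj1 ht).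
rewrite (_ : [set w | _] = [set w | (sigma w <= t%:E)%E] `|` [set w | (tau w <= t%:E)%E]).
  by apply: salgU; [exact: filt_salg|exact: (proj2 hs)|exact: (proj2 ht)].
by apply/seteqP; split => w /=; rewrite ge_min => /orP.
Qed.

Lemma stop_eclip lo hi sigma : 0 <= lo -> lo <= hi -> stopping_time F sigma ->
  stopping_time F (fun w => eclip lo hi (sigma w)).
Proof.
move=> lo0 lohi hs; split=> [w|t t0]; first by rewrite (le_trans _ (eclip_ge _ _ _)).
have FS := filt_salg t0.
rewrite (_ : [set w | _] = [set w | (lo <= t) /\ ([set w | (sigma w <= t%:E)%E] `|`
   [set w | (hi <= t) /\ setT w]) w]); last first.
  apply/seteqP; split => w /=; rewrite /eclip ge_max ge_min !lee_fin.
    by move=> /andP[lt /orP[h|h]]; split=> //; [left|right].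
  by move=> [-> [->|[-> _]]] //; rewrite orbT.
apply: salg_and => // lot; apply: salgU => //; first exact: (proj2 hs).
by apply: salg_and => // _; exact: salgT.
Qed.

Lemma stop_cst t : 0 <= t -> stopping_time F (fun=> t%:E).
Proof.
move=> t0; split=> [w|s s0]; first by rewrite lee_fin.
have FS := filt_salg s0.
rewrite (_ : [set w | _] = [set w | (t <= s) /\ setT w]).
  by apply: salg_and => // _; exact: salgT.
by apply/seteqP; split => w /=; rewrite lee_fin => // -[].
Qed.

Lemma tmin_fmeas tau t : stopping_time F tau -> 0 <= t ->
  fmeas (F t) (fun w => tmin t (tau w)).
Proof.
move=> ht t0; have FS := filt_salg t0; apply: fmeas_of_gt => // c.
have [ct|tc] := ltP c t; last first.
  rewrite (_ : [set w | _] = set0); first exact: salg0.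
  apply/seteqP; split => w //=; apply/negP; rewrite -leNgt (le_trans _ tc)// tmin_le//.
  exact: (proj1 ht).
have [c0|c0] := ltP c 0.
  rewrite (_ : [set w | _] = setT); first exact: salgT.
  apply/seteqP; split => w //= _; apply: (lt_le_trans c0); apply: tmin_ge0 => //.
  exact: (proj1 ht).
have := salgC FS (stop_le ht c0 (ltW ct)).
rewrite (_ : ~` _ = [set w | c < tmin t (tau w)])//.
apply/seteqP; split => w /=; have := proj1 ht w; case: (tau w) => [r| |]// _;
  rewrite ?tmin_fin ?tmin_pinfty ?lt_min ?lee_fin ?ct//=.
- by move/negP; rewrite -ltNge.
- by move=> h; apply/negP; rewrite -ltNge.
Qed.

Lemma fmeas_stopped (f : T -> R -> R) tau t : stopping_time F tau -> 0 <= t ->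
  (forall w, continuous (f w)) -> (forall s, 0 <= s <= t -> fmeas (F s) (fun w => f w s)) ->
  fmeas (F t) (fun w => f w (tmin t (tau w))).
Proof.
move=> ht t0 fc mf; apply: (fmeas_stop (filt_salg t0) t0 fc) => [s /andP[s0 st]|w|].
- by apply: (fmeas_le s0 st); apply: mf; rewrite s0.
- by rewrite tmin_ge0// ?tmin_le//; exact: (proj1 ht).
- exact: tmin_fmeas.
Qed.

Lemma stopped_sigma_fmeas sigma (v : T -> R) t : 0 <= t ->
  stopping_time F sigma ->
  (forall B : set R, measurable B -> stopped_sigma F sigma (v @^-1` B)) ->
  fmeas (F t) (fun w => v w * (sigma w <= t%:E)%E%:R).
Proof.
move=> t0 hs hv B mB; have FS := filt_salg t0.
have hs' := proj2 hs t t0.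
have [_ /(_ t t0) hB] := hv B mB.
have [B0|nB0] := pselect (B 0).
  rewrite (_ : _ @^-1` B = (v @^-1` B `&` [set w | (sigma w <= t%:E)%E]) `|`
     ~` [set w | (sigma w <= t%:E)%E]).
    by apply: salgU => //; exact: salgC.
  apply/seteqP; split => w /=.
    case: (boolP (sigma w <= t%:E)%E) => st; last by right; apply/negP.
    by rewrite mulr1; left.
  by case=> [[Bv ->]|/negP/negbTE ->]; rewrite ?mulr1 ?mulr0.
rewrite (_ : _ @^-1` B = v @^-1` B `&` [set w | (sigma w <= t%:E)%E])//.
apply/seteqP; split => w /=; last by move=> [Bv ->]; rewrite mulr1.
by case: (boolP (sigma w <= t%:E)%E) => st; rewrite ?mulr1 ?mulr0.
Qed.

Lemma fmeas_stopped_sigma sigma (v : T -> R) : stopping_time F sigma ->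
  fmeas measurable v ->
  (forall t, 0 <= t -> fmeas (F t) (fun w => v w * (sigma w <= t%:E)%E%:R)) ->
  forall B : set R, measurable B -> stopped_sigma F sigma (v @^-1` B).
Proof.
move=> hs mv hv B mB; split; first exact: mv.
move=> t t0; apply: fmeas_preimage_and => //; first exact: filt_salg.
  exact: (proj2 hs).
by apply: fmeas_ext (hv t t0) => w; rewrite /= asboolb.
Qed.

Let mT : sigma_algebra setT (@measurable d T) := @sigma_algebra_measurable d T.

Lemma meas_stop sigma (t : R) : stopping_time F sigma -> 0 <= t -> measurable [set w | (sigma w < t%:E)%E].
Proof.
by move=> hs t0; case: hF => _ h _ _ _; apply: (h t t0); exact: stop_lt.
Qed.

Lemma sp_val_meas (H : simple_process F) i : fmeas measurable (sp_val H i).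
Proof. by move=> B mB; have [] := sp_valF H i mB. Qed.

Section stop_simple.
Variables (H : simple_process F) (tau : T -> \bar R) (htau : stopping_time F tau).

Let mlt i : measurable [set w | (sp_time H i w < tau w)%E].
Proof.
have -> : [set w | (sp_time H i w < tau w)%E] =
   \bigcup_n [set w | (sp_time H i w < tau w)%E && (sp_time H i w <= n%:R%:E)%E].
  apply/seteqP; split => w /=; last by move=> [n _ /andP[]].
  move=> h; have s0 : (0 <= sp_time H i w)%E by case: (sp_stop H i).
  case E : (sp_time H i w) s0 h => [r| |]// r0 h; last by rewrite ltNge leey in h.
  exists (Num.bound r) => //=; rewrite E h/= lee_fin ltW//.
  by rewrite lee_fin in r0; have := archi_boundP r0.
apply: (salg_bigcup mT) => n; case: hF => _ h _ _ _; apply: (h n%:R (ler0n _ _)).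
by apply: stop_lt_stop => //; exact: sp_stop.
Qed.

Let valF i : forall B : set R, measurable B ->
  stopped_sigma F (fun w => mine (sp_time H i w) (tau w))
    ((fun w => sp_val H i w * (sp_time H i w < tau w)%E%:R) @^-1` B).
Proof.
apply: fmeas_stopped_sigma.
- by apply: stop_mine => //; exact: sp_stop.
- apply: fmeasM => //; first exact: sp_val_meas.
  by apply: fmeas_ind => //; exact: mlt.
move=> t t0; have FS := filt_salg t0.
have h1 := stopped_sigma_fmeas t0 (sp_stop H i) (@sp_valF _ _ _ _ H i).
have h2 : fmeas (F t) (fun w => ((sp_time H i w < tau w)%E && (sp_time H i w <= t%:E)%E)%:R : R).
  exact: (fmeas_ind FS (stop_lt_stop (sp_stop H i) htau t0)).
have := fmeasM FS h1 h2; apply: fmeas_ext => w /=.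
have [st|ts] := ltP (sp_time H i w) (tau w); last by rewrite !mulr0 mul0r.
by rewrite mulr1 /=; case: (sp_time H i w <= t%:E)%E; rewrite ?mulr1 ?mulr0.
Qed.

Definition stop_simple : simple_process F := @MkSimple _ _ _ F
  (sp_size H) (fun=> 0) (fun i w => mine (sp_time H i w) (tau w))
  (fun i w => sp_val H i w * (sp_time H i w < tau w)%E%:R)
  (fun B mB => fmeas_cst (filt_salg (lexx 0)) 0 mB)
  (fun w => etrans (congr1 (fun x => mine x (tau w)) (sp_time0 H w)) (min_l (proj1 htau w)))
  (fun i w => le_min2 (sp_time_le H i w) (lexx _))
  (fun i => stop_mine (sp_stop H i) htau) valF.

End stop_simple.

Section merge_simple.
Variables (H : simple_process F) (n : nat) (c : R) (A : T -> R -> R).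
Hypothesis hA : forall t, 0 <= t -> fmeas (F t) (fun w => A w t).

Let N := sp_size H.
Let time j w := merge_time n N (fun i => sp_time H i w) j.
Let val j w := c * (sp_val H (j %% N.+1)%N w * ((j %% N.+1 < N)%N &&
      (sp_time H (j %% N.+1)%N w < (grid n (j %/ N.+1).+1)%:E)%E)%:R - A w (grid n (j %/ N.+1))).

Let time_stop j : stopping_time F (time j).
Proof.
by apply: stop_eclip; [exact: grid_ge0|exact: grid_le|exact: sp_stop].
Qed.

Let valF j : forall B : set R, measurable B -> stopped_sigma F (time j) (val j @^-1` B).
Proof.
set k := (j %/ N.+1)%N; set i := (j %% N.+1)%N.
apply: fmeas_stopped_sigma; first exact: time_stop.
  apply: fmeasM => //; first exact: fmeas_cst.
  apply: fmeasB => //; last by apply: (fmeas_meas _ (hA _)); exact: grid_ge0.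
  apply: fmeasM => //; first exact: sp_val_meas.
  apply: fmeas_ind => //.
  rewrite (_ : [set w | _] = [set w | (i < N)%N /\ [set w | (sp_time H i w < (grid n k.+1)%:E)%E] w]).
    by apply: salg_and => // _; apply: meas_stop; [exact: sp_stop|exact: grid_ge0].
  by apply/seteqP; split => w /= /andP.
move=> t t0; have FS := filt_salg t0.
have [tg|gt] := ltP t (grid n k).
  apply: (@fmeas_ext _ _ _ (fun=> 0)); last exact: fmeas_cst.
  move=> w; rewrite [(_ <= _)%E](_ : _ = false) ?mulr0//; apply/negbTE; rewrite -ltNge.
  by apply: lt_le_trans (eclip_ge _ _ _); rewrite lte_fin.
have h1 := stopped_sigma_fmeas t0 (sp_stop H i) (@sp_valF _ _ _ _ H i).
have h2 : fmeas (F t) (fun w => ((i < N)%N && ((sp_time H i w < (grid n k.+1)%:E)%E &&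
     (sp_time H i w <= t%:E)%E))%:R : R).
  apply: fmeas_ind => //.
  rewrite (_ : [set w | _] = [set w | (i < N)%N /\ [set w | (sp_time H i w < (grid n k.+1)%:E)%E &&
      (sp_time H i w <= t%:E)%E] w]); last first.
    by apply/seteqP; split => w /= /andP.
  apply: salg_and => // _.
  have [gt'|tg] := leP (grid n k.+1) t.
    rewrite (_ : [set w | _] = [set w | (sp_time H i w < (grid n k.+1)%:E)%E]).
      by apply: (filt_le _ gt') => //; [exact: grid_ge0|apply: stop_lt; [exact: sp_stop|exact: grid_ge0]].
    apply/seteqP; split => w /=; first by case/andP.
    by move=> h; rewrite h/= (le_trans (ltW h))// lee_fin.
  rewrite (_ : [set w | _] = [set w | (sp_time H i w <= t%:E)%E]).
    by apply: (stop_le (sp_stop H i) t0).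
  apply/seteqP; split => w /=; first by case/andP.
  by move=> h; rewrite h andbT (le_lt_trans h)// lte_fin.
have h3 : fmeas (F t) (fun w => (time j w <= t%:E)%E%:R : R).
  by apply: fmeas_ind => //; exact: (proj2 (time_stop j)).
have h4 : fmeas (F t) (fun w => A w (grid n k)).
  by apply: (fmeas_le _ gt); [exact: grid_ge0|apply: hA; exact: grid_ge0].
have := fmeasM FS (fmeasM FS (fmeas_cst FS c) (fmeasB FS (fmeasM FS h1 h2) h4)) h3.
apply: fmeas_ext => w /=; rewrite /val -/k -/i.
have [tt|] := boolP (time j w <= t%:E)%E; last by rewrite !mulr0.
congr (c * (_ - _) * _).
case: (i < N)%N; rewrite ?mulr0//=.
have [sg|] := boolP (sp_time H i w < (grid n k.+1)%:E)%E; rewrite ?mulr0//=.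
have -> : (sp_time H i w <= t%:E)%E.
  apply: le_trans tt; rewrite /time /merge_time -/k -/i /eclip.
  by rewrite le_max le_min lexx (ltW sg) orbT.
by rewrite !mulr1.
Qed.

Definition merge_simple : simple_process F := @MkSimple _ _ _ F
  (n.+1 * N.+1) (fun=> 0) time val
  (fun B mB => fmeas_cst (filt_salg (lexx 0)) 0 mB)
  (fun w => merge_time0 n N (sp_time0 H w))
  (fun i w => merge_time_le n N (sp_time0 H w) (fun i => sp_time_le H i w) i)
  time_stop valF.

End merge_simple.

End Stopping.

(** * Ito integrals of step and oscillation integrands *)

Section StepPaths.
Context {R : realType}.
Implicit Types (a b : nat -> \bar R) (v : nat -> R -> R) (t : R).

Definition step_path N v a b t : R :=
  \sum_(k < N) v k t * ((a k < t%:E)%E && (t%:E <= b k)%E)%:R.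

Lemma near_left_lt (x : \bar R) t : \forall s \near t^'-, (x < s%:E)%E = (x < t%:E)%E.
Proof.
have [xt|tx] := ltP x t%:E%E; last first.
  apply: filterS (nbhs_left_lt t) => s st; apply/negbTE; rewrite -leNgt.
  by apply: le_trans tx; rewrite lee_fin ltW.
case: x xt => [r| |]//=; last by move=> _; apply: nearW => s; exact: ltNyr.
by rewrite lte_fin => /nbhs_left_gt; apply: filterS => s; rewrite lte_fin.
Qed.

Lemma near_right_lt (x : \bar R) t : \forall s \near t^'+, (x < s%:E)%E = (x <= t%:E)%E.
Proof.
have [xt|tx] := leP x t%:E%E.
  apply: filterS (nbhs_right_gt t) => s st; apply: le_lt_trans xt _.
  by rewrite lte_fin.
case: x tx => [r| |]//=; last by move=> _; apply: nearW.
rewrite lte_fin => /nbhs_right_lt; apply: filterS => s sr; apply/negbTE.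
by rewrite -leNgt lee_fin ltW.
Qed.

Lemma step_path_left N v a b t : (forall k, continuous (v k)) ->
  step_path N v a b s @[s --> t^'-] --> step_path N v a b t.
Proof.
move=> vc; rewrite /step_path; elim: N => [|N IH].
  by under eq_fun do rewrite big_ord0; rewrite big_ord0; exact: cvg_cst.
under eq_fun do rewrite big_ord_recr; rewrite big_ord_recr; apply: cvgD => //.
apply: cvgM; first by apply: cvg_at_left_filter; exact: vc.
apply: cvg_near_cst; have := near_left_lt (b N) t; have := near_left_lt (a N) t.
by apply: filterS2 => s -> h; rewrite leNgt h -leNgt.
Qed.

Lemma step_path_right N v a b t : (forall k, continuous (v k)) ->
  cvg (step_path N v a b s @[s --> t^'+]).
Proof.
move=> vc; rewrite /step_path; elim: N => [|N IH].
  by under eq_fun do rewrite big_ord0; exact: is_cvg_cst.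
under eq_fun do rewrite big_ord_recr; apply: is_cvgD => //.
apply: is_cvgM.
  by apply/cvg_ex; exists (v N t); apply: cvg_at_right_filter; exact: vc.
apply/cvg_ex; exists ((a N <= t%:E)%E && ~~ (b N <= t%:E)%E)%:R.
apply: cvg_near_cst; have := near_right_lt (b N) t; have := near_right_lt (a N) t.
by apply: filterS2 => s -> h; rewrite [(s%:E <= _)%E]leNgt h.
Qed.

Lemma step_ind_sum N a t : (forall k, (a k <= a k.+1)%E) ->
  \sum_(k < N) ((a k < t%:E)%E && (t%:E <= a k.+1)%E)%:R <= 1 :> R.
Proof.
move=> am.
rewrite (eq_bigr (fun k : 'I_N => (t%:E <= a k.+1)%E%:R - (t%:E <= a k)%E%:R)); last first.
  move=> k _; have [ta|at_] := leP t%:E%E (a k); last by rewrite subr0.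
  by rewrite (le_trans ta)//= subrr.
rewrite (sum_telescope _ (fun k => (t%:E <= a k)%E%:R)).
by case: (t%:E <= a N)%E; case: (t%:E <= a 0%N)%E => /=; lra.
Qed.

Lemma step_path_le1 N v a b t : (forall k, (a k <= a k.+1)%E) ->
  (forall k, (k < N)%N -> (b k <= a k.+1)%E) ->
  (forall k, (k < N)%N -> (a k < t%:E)%E -> (t%:E <= b k)%E -> `|v k t| <= 1) ->
  `|step_path N v a b t| <= 1.
Proof.
move=> am ba v1; apply: le_trans (step_ind_sum N t am).
apply: le_trans (ler_norm_sum _ _ _) _; apply: ler_sum => k _.
have [akt|_] := ltP (a k) t%:E%E; last by rewrite mulr0 normr0.
have [tbk|_] := leP t%:E%E (b k); last by rewrite mulr0 normr0 ler0n.
by rewrite (le_trans tbk (ba k _))//= mulr1 v1.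
Qed.

End StepPaths.

Section Ito.
Context {R : realType} {d : measure_display} {T : measurableType d}.
Variables (P : probability T R) (F : R -> set_system T).
Hypothesis hF : usual_filtration P F.

Let mT : sigma_algebra setT (@measurable d T) := @sigma_algebra_measurable d T.

Lemma adapted_fmeas (V : T -> R -> R) : (forall w t, V w t = V w (clamp01 t)) ->
  adapted F V -> forall t, 0 <= t -> fmeas (F t) (fun w => V w t).
Proof.
move=> Vc hV t t0; have [t1|t1] := leP t 1.
  by move=> B mB; apply: hV => //; rewrite t0.
apply: (fmeas_le hF ler01 (ltW t1)) => B mB.
have := hV 1 _ B mB; rewrite ler01 lexx => /(_ isT).
rewrite (_ : (fun w => V w t) = V^~ 1)//; apply/funext => w.
by rewrite Vc /clamp01 (min_r (ltW t1)) max_r.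
Qed.

(* H_t is the elementary integral of H along the path s |-> 1_(t <= s), so that
   identities between elementary integrals also give the values of H. *)
Lemma simple_evalE (H : simple_process F) w (t : R) : simple_eval H w t =
  sp_init H w * (t == 0)%:R + \sum_(i < sp_size H) sp_val H i w *
   ((t <= tmin t (sp_time H i.+1 w))%R%:R - (t <= tmin t (sp_time H i w))%R%:R).
Proof.
rewrite /simple_eval; congr (_ + _); apply: eq_bigr => i _; congr (_ * _).
rewrite ind_between//; first exact: sp_time_le.
by case: (sp_stop H i).
Qed.

Lemma simple_eval_left (H : simple_process F) w (t : R) : 0 < t ->
  simple_eval H w s @[s --> t^'-] --> simple_eval H w t.
Proof.
move=> t0; apply: cvgD; last first.
  by apply: (@step_path_left _ (sp_size H) (fun i _ => sp_val H i w)
    (fun i => sp_time H i w) (fun i => sp_time H i.+1 w)) => k; exact: cst_continuous.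
apply: cvgM; first exact: cvg_cst.
apply: cvg_near_cst; apply: filterS (nbhs_left_gt t0) => s s0.
by rewrite (gt_eqF s0) (gt_eqF t0).
Qed.

Lemma simple_eval_meas (H : simple_process F) (t : R) : 0 <= t ->
  fmeas measurable (fun w => simple_eval H w t).
Proof.
move=> t0; apply: fmeasD => //.
  apply: fmeasM => //; last exact: fmeas_cst.
  by move=> B mB; case: hF => _ h _ _ _; apply: (h 0 (lexx _)); exact: sp_initF.
apply: (@fmeas_sum _ _ _ mT (sp_size H) (fun i w => sp_val H i w *
  ((sp_time H i w < t%:E) && (t%:E <= sp_time H i.+1 w))%E%:R)) => i _.
apply: fmeasM => //; first exact: sp_val_meas.
apply: fmeas_ind => //.
have h1 := meas_stop hF (sp_stop H i) t0.
have h2 := salgC mT (meas_stop hF (sp_stop H i.+1) t0).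
rewrite (_ : [set w | _] = [set w | (sp_time H i w < t%:E)%E] `&`
  ~` [set w | (sp_time H i.+1 w < t%:E)%E]); first exact: salgI.
apply/seteqP; split => w /=.
  by move=> /andP[-> h]; split => //; apply/negP; rewrite -leNgt.
by move=> [-> /negP]; rewrite -leNgt => ->.
Qed.

Lemma simple_integral_continuous (H : simple_process F) (X : T -> R -> R) w :
  continuous (X w) -> continuous (simple_integral H X w).
Proof.
move=> Xc; suff h N : continuous (fun t => \sum_(i < N) sp_val H i w *
    (stopped X (sp_time H i.+1) w t - stopped X (sp_time H i) w t)) by exact: h.
have c i : continuous (stopped X (sp_time H i) w).
  move=> t; apply: (@continuous_comp _ _ _ (fun t => tmin t (sp_time H i w)) (X w)); last exact: Xc.
  by apply: tmin_continuous; case: (sp_stop H i).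
elim: N => [|N IH] t.
  by under eq_fun do rewrite big_ord0; exact: cvg_cst.
under eq_fun do rewrite big_ord_recr; apply: cvgD; first exact: IH.
apply: cvgM; first exact: cvg_cst.
by apply: cvgB; exact: c.
Qed.

Lemma simple_integral_meas (H : simple_process F) (X : T -> R -> R) (t : R) :
  (forall w, continuous (X w)) ->
  (forall s, 0 <= s -> fmeas (F s) (fun w => X w s)) -> 0 <= t ->
  fmeas measurable (fun w => simple_integral H X w t).
Proof.
move=> Xc hX t0.
have m i : fmeas measurable (fun w => stopped X (sp_time H i) w t).
  apply: (fmeas_meas hF t0).
  by apply: (fmeas_stopped hF (sp_stop H i) t0 Xc) => s /andP[s0 _]; exact: hX.
apply: (@fmeas_sum _ _ _ mT (sp_size H) (fun i w => sp_val H i w *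
  (stopped X (sp_time H i.+1) w t - stopped X (sp_time H i) w t))) => i _.
by apply: fmeasM => //; [exact: sp_val_meas|exact: fmeasB].
Qed.

Lemma ucp_exact (V : T -> R -> R) : ucp P (fun=> V) V.
Proof.
move=> e e0; apply: cvg_near_cst; near=> n.
rewrite (_ : [set w | _] = set0) ?measure0//; apply/seteqP; split => w //=.
rewrite (_ : V w \- V w = fun=> 0) ?unif_norm0 ?lte_fin ?ltNge ?(ltW e0)//.
by apply/funext => t /=; rewrite subrr.
Unshelve. all: by end_near. Qed.

Lemma ucp_dominated (V_ W_ : nat -> T -> R -> R) (V W : T -> R -> R) (c : R) : 0 < c ->
  (forall n w t, 0 <= t <= 1 -> exists2 s, 0 <= s <= 1 &
     `|V_ n w t - V w t| <= c * `|W_ n w s - W w s|) ->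
  (forall n (e : R), measurable [set w | (e%:E < unif_norm (V_ n w \- V w))%E]) ->
  (forall n (e : R), measurable [set w | (e%:E < unif_norm (W_ n w \- W w))%E]) ->
  ucp P W_ W -> ucp P V_ V.
Proof.
move=> c0 VW mV mW hW e e0.
apply: (@squeeze_cvge _ _ _ _ (fun=> 0%E) _
  (fun n => P [set w | ((e / c)%:E < unif_norm (W_ n w \- W w))%E])); last 2 first.
- exact: cvg_cst.
- by apply: hW; rewrite divr_gt0.
near=> n; rewrite measure_ge0/=; apply: le_measure; rewrite ?inE//.
move=> w /= /ereal_sup_gt[_ [t t01 ->]]; rewrite lte_fin => et.
have [s s01 h] := VW n w t t01.
apply: (lt_le_trans _ (unif_norm_ub (W_ n w \- W w) s01)); rewrite lte_fin /=.
by rewrite ltr_pdivrMr// mulrC (lt_le_trans et).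
Unshelve. all: by end_near. Qed.

Section deterministic.
Variables (N : nat) (p h : nat -> R).
Hypotheses (p0 : p 0%N = 0) (pm : forall i, p i <= p i.+1) (h1 : forall i, `|h i| <= 1).

Let p_ge0 i : 0 <= p i. Proof. by rewrite -p0 nondec_nat. Qed.

Let det_valF i : forall B : set R, measurable B ->
  stopped_sigma F (fun=> (p i)%:E) ((fun=> h i) @^-1` B).
Proof.
apply: (fmeas_stopped_sigma hF); first exact: (stop_cst hF (p_ge0 i)).
  exact: fmeas_cst.
by move=> t t0; apply: fmeas_cst; exact: (filt_salg hF t0).
Qed.

Definition det_simple : simple_process F := @MkSimple _ _ _ F N (fun=> 0)
  (fun i _ => (p i)%:E) (fun i _ => h i)
  (fun B mB => fmeas_cst (filt_salg hF (lexx 0)) 0 mB)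
  (fun w => congr1 EFin p0) (fun i w => pm i) (fun i => stop_cst hF (p_ge0 i)) det_valF.

Lemma det_unit_integrand : unit_integrand F (simple_eval det_simple).
Proof.
have E w : simple_eval det_simple w = step_path N (fun i _ => h i)
    (fun i => (p i)%:E) (fun i => (p i.+1)%:E).
  by apply/funext => t; rewrite /simple_eval /= mul0r add0r.
have hc k : continuous (fun _ : R => h k) by exact: cst_continuous.
split.
- move=> t /andP[t0 _]; exact: (fmeas_cst (filt_salg hF t0) (simple_eval det_simple point t)).
- by move=> w t _; rewrite E; exact: step_path_left.
- by move=> w t _; rewrite E; exact: step_path_right.
- by move=> w t _; rewrite E; apply: step_path_le1.
Qed.

Lemma det_ito (X : T -> R -> R) : (forall w, continuous (X w)) ->
  (forall s, 0 <= s -> fmeas (F s) (fun w => X w s)) ->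
  is_ito_integral P F (simple_eval det_simple) X (simple_integral det_simple X).
Proof.
move=> Xc hX; split.
- move=> t /andP[t0 _]; have FS := filt_salg hF t0.
  have m i : fmeas (F t) (fun w => stopped X (fun=> (p i)%:E) w t).
    by apply: (fmeas_stopped hF (stop_cst hF (p_ge0 i)) t0 Xc) => s /andP[s0 _]; exact: hX.
  apply: (@fmeas_sum _ _ _ FS N (fun i w => h i *
    (stopped X (fun=> (p i.+1)%:E) w t - stopped X (fun=> (p i)%:E) w t))) => i _.
  by apply: fmeasM => //; [exact: fmeas_cst|exact: fmeasB].
- by move=> w; apply: continuous_subspaceT; exact: simple_integral_continuous.
- by exists (fun=> det_simple); split; exact: ucp_exact.
Qed.

Lemma det_integralE (X : T -> R -> R) w t :
  simple_integral det_simple X w t =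
  \sum_(i < N) h i * (X w (Num.min t (p i.+1)) - X w (Num.min t (p i))).
Proof.
by rewrite /simple_integral; apply: eq_bigr => i _; rewrite /stopped -!EFin_min.
Qed.

End deterministic.

End Ito.

Section Oscillation.
Context {R : realType} {d : measure_display} {T : measurableType d}.
Variables (P : probability T R) (F : R -> set_system T).
Hypothesis hF : usual_filtration P F.
Variables (alpha : R) (alpha0 : 0 < alpha).
Variables (A : T -> C01 R) (X : T -> C0Hld alpha) (Z : T -> CHld alpha).
Hypothesis hA : adapted F (fun w => A w).
Hypothesis hX : adapted F (fun w => X w).
Hypothesis hZ : is_ito_integral P F (fun w => A w) (fun w => X w) (fun w => Z w).
Variables (n : nat) (delta : R).
Hypothesis delta0 : 0 < delta.

Let mT : sigma_algebra setT (@measurable d T) := @sigma_algebra_measurable d T.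
Let c := delta^-1.
Let c0 : 0 < c. Proof. by rewrite invr_gt0. Qed.

Let Am t : 0 <= t -> fmeas (F t) (fun w => A w t).
Proof. by apply: (adapted_fmeas hF _ hA) => w s; exact: C01_clamp. Qed.

Let Xm t : 0 <= t -> fmeas (F t) (fun w => X w t).
Proof. by apply: (adapted_fmeas hF _ hX) => w s; exact: C0Hld_clamp. Qed.

Let Zm t : 0 <= t -> fmeas (F t) (fun w => Z w t).
Proof.
have [h _ _] := hZ.
by apply: (adapted_fmeas hF _ h) => w s; exact: CHld_clamp.
Qed.

Definition osc_time w : \bar R := ereal_inf [set h | exists k (t : R),
  [/\ (k < n.+1)%N, grid n k <= t <= grid n k.+1,
      delta < `|A w t - A w (grid n k)| & h = t%:E]].

Lemma osc_time_ge0 w : (0 <= osc_time w)%E.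
Proof.
apply: le_ereal_inf_tmp => _ [k [t [_ /andP[kt _] _ ->]]].
by rewrite lee_fin (le_trans _ kt)// grid_ge0.
Qed.

Lemma osc_time_lt_rat w k t : (k < n.+1)%N -> grid n k <= t <= grid n k.+1 ->
  delta < `|A w t - A w (grid n k)| -> exists q : rat,
  [/\ grid n k <= ratr q :> R, ratr q <= grid n k.+1 :> R, ratr q < t &
    delta < `|A w (ratr q) - A w (grid n k)|].
Proof.
move=> kn /andP[]; rewrite le_eqVlt => /predU1P[<-|kt] tk.
  by rewrite subrr normr0 ltNge (ltW delta0).
move=> dA; have e0 : 0 < `|A w t - A w (grid n k)| - delta by rewrite subr_gt0.
have /cvgrPdist_lt /(_ _ e0) /nbhs_ballP[r /= r0 h] := @C01_continuous _ (A w) t.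
have m : Num.max (grid n k) (t - r) < t by rewrite gt_max kt/= gtrBl.
have [q] := rat_in_itvoo m; rewrite in_itv/= gt_max => /andP[/andP[kq rq] qt].
exists q; split => //; [exact: ltW|exact: (ltW (lt_le_trans qt tk))|].
have hq : `|A w t - A w (ratr q)| < `|A w t - A w (grid n k)| - delta.
  by apply: h; rewrite /ball/= gtr0_norm ?subr_gt0// ltrBlDl -ltrBlDr.
have := ler_distD (A w (ratr q)) (A w t) (A w (grid n k)); lra.
Qed.

Lemma osc_time_lt_meas t : 0 <= t -> F t [set w | (osc_time w < t%:E)%E].
Proof.
move=> t0; have FS := filt_salg hF t0.
pose B (q : rat) k : set T := [set w |
  [/\ (k < n.+1)%N, grid n k <= ratr q :> R, ratr q <= grid n k.+1 :> R & (ratr q : R) < t]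
  /\ delta < `|A w (ratr q) - A w (grid n k)|].
have -> : [set w | (osc_time w < t%:E)%E] = \bigcup_q \bigcup_k B q k.
  apply/seteqP; split => w /=; last first.
    move=> [q _ [k _ [[kn kq qk qt] dA]]]; apply: (@le_lt_trans _ _ (ratr q)%:E).
      by apply: ereal_inf_lbound; exists k, (ratr q); rewrite kq qk.
    by rewrite lte_fin.
  move=> /ereal_inf_lt[_ [k [s [kn ks dA ->]]]]; rewrite lte_fin => st.
  have [q [kq qk qs dAq]] := osc_time_lt_rat kn ks dA.
  by exists q => //; exists k => //; split => //; split => //; exact: lt_trans st.
apply: salg_bigcup_rat => // q; apply: salg_bigcup => // k; apply: salg_and => // -[kn kq qk qt].
apply: fmeas_gt => //; apply: fmeas_norm => //; apply: fmeasB => //.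
  have q0 : 0 <= ratr q :> R := le_trans (grid_ge0 n k) kq.
  by apply: (fmeas_le hF q0 (ltW qt)); exact: Am.
apply: (fmeas_le hF _ (le_trans kq (ltW qt))); first exact: grid_ge0.
by apply: Am; exact: grid_ge0.
Qed.

(* Right-continuity of F turns {tau < s} for all s > t into {tau <= t}. *)
Lemma osc_time_stop : stopping_time F osc_time.
Proof.
split=> [w|t t0]; first exact: osc_time_ge0.
have -> : F t = \bigcap_(s in [set s | t < s]) F s by case: hF => _ _ _ h _; exact: h.
move=> s /= ts; have s0 : 0 <= s by exact: ltW (le_lt_trans t0 ts).
have FS := filt_salg hF s0.
rewrite (_ : [set w | _] = \bigcap_m [set w | (osc_time w < (t + (s - t) * m.+1%:R^-1)%:E)%E]).
  apply: salg_bigcap => // m.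
  have st : 0 < s - t by rewrite subr_gt0.
  have m0 : 0 < m.+1%:R^-1 :> R by rewrite invr_gt0.
  have m1 : m.+1%:R^-1 <= 1 :> R by rewrite invf_le1 ?ler1n ?ltr0n.
  have u0 := addr_ge0 t0 (ltW (mulr_gt0 st m0)).
  apply: (filt_le hF u0 _ (osc_time_lt_meas u0)).
  by rewrite -lerBrDl ler_piMr// ltW.
apply/seteqP; split => w /= => [h m _|h].
  by apply: le_lt_trans h _; rewrite lte_fin ltrDl mulr_gt0 ?subr_gt0// invr_gt0.
apply/lee_addgt0Pr => e e0.
have st : 0 < s - t by rewrite subr_gt0.
have [m /= me] := @filter_ex _ \oo _ _ (near_inv_succ (divr_gt0 e0 st)).
apply: (le_trans (ltW (h m I))); rewrite -EFinD lee_fin lerD2l.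
by rewrite mulrC -ler_pdivlMr.
Qed.

Lemma osc_time_bound w k t : (k < n.+1)%N -> grid n k <= t <= grid n k.+1 ->
  (t%:E <= osc_time w)%E -> `|A w t - A w (grid n k)| <= delta.
Proof.
move=> kn kt tt; rewrite leNgt; apply/negP => dA.
have [q [kq qk qt dAq]] := osc_time_lt_rat kn kt dA.
have : (osc_time w <= (ratr q)%:E)%E.
  by apply: ereal_inf_lbound; exists k, (ratr q); rewrite kq qk.
by move=> /(le_trans tt); rewrite lee_fin leNgt qt.
Qed.

Lemma osc_time_pinfty w :
  (forall r r', `|r - r'| <= n.+1%:R^-1 -> `|A w r - A w r'| <= delta) ->
  osc_time w = +oo%E.
Proof.
move=> aw; rewrite /osc_time (_ : [set h | _] = set0) ?ereal_inf0//.
apply/seteqP; split => // x [k [t [kn /andP[kt tk] dA xt]]].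
move: dA; rewrite ltNge aw// ger0_norm ?subr_ge0//.
by rewrite lerBlDl -gridS.
Qed.

Let a k (w : T) : \bar R := (grid n k)%:E.
Let b k w : \bar R := mine (grid n k.+1)%:E (osc_time w).
Let v k w t := c * (A w t - A w (grid n k)).

(* (A - A^n) / delta stopped at osc_time, A^n being the step process of the
   values of A on the grid. *)
Definition osc_integrand w t : R :=
  step_path n.+1 (v ^~ w) (a ^~ w) (b ^~ w) t.

Definition osc_integral w t : R :=
  c * (Z w (tmin t (osc_time w)) - RSsum n (A w) (X w) (tmin t (osc_time w))).

Let v_cont k w : continuous (v k w).
Proof.
move=> t; apply: cvgM; first exact: cvg_cst.
by apply: cvgB; [exact: C01_continuous|exact: cvg_cst].
Qed.

Let U_meas t : 0 <= t -> fmeas (F t) (fun w => osc_integrand w t).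
Proof.
move=> t0; have FS := filt_salg hF t0.
apply: (@fmeas_sum _ _ _ FS n.+1 (fun k w => v k w t *
  ((a k w < t%:E)%E && (t%:E <= b k w)%E)%:R)) => k kn.
rewrite /a /b; have [kt|tk] := ltP (grid n k : R) t; last first.
  apply: (@fmeas_ext _ _ _ (fun=> 0)); last exact: fmeas_cst.
  by move=> w; rewrite lte_fin ltNge tk/= mulr0.
apply: fmeasM => //.
  apply: fmeasM => //; first exact: fmeas_cst.
  apply: fmeasB => //; first exact: Am.
  by apply: (fmeas_le hF _ (ltW kt)); [exact: grid_ge0|apply: Am; exact: grid_ge0].
apply: fmeas_ind => //.
rewrite (_ : [set w | _] = [set w | t <= grid n k.+1 /\ [set w | (t%:E <= osc_time w)%E] w]).
  by apply: salg_and => // _; exact: (stop_ge hF osc_time_stop t0).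
apply/seteqP; split => w /=; rewrite lte_fin kt le_min lee_fin /=; first by case/andP.
by move=> [-> ->].
Qed.

Lemma osc_unit_integrand : unit_integrand F osc_integrand.
Proof.
split.
- by move=> t /andP[t0 _]; exact: U_meas.
- by move=> w t _; apply: step_path_left => k; exact: v_cont.
- by move=> w t _; apply: step_path_right => k; exact: v_cont.
- move=> w t t01; apply: step_path_le1.
  + by move=> k; rewrite lee_fin grid_le.
  + by move=> k _; rewrite /b /a ge_min lexx.
  move=> k kn; rewrite /a /b /v lte_fin le_min lee_fin => kt /andP[tk tt].
  rewrite normrM gtr0_norm// mulrC ler_pdivrMr// mul1r.
  by apply: osc_time_bound => //; rewrite (ltW kt).
Qed.

Let RS_cont w : continuous (RSsum n (A w) (X w)).
Proof.
apply: (hld_le_continuous alpha0) (RSsum_hld_le n (A w) (ltW alpha0) (C0Hld_le (X w))).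
by move=> t; apply: RSsum_clamp; exact: C0Hld_clamp.
Qed.

Let G w t := c * (Z w t - RSsum n (A w) (X w) t).

Let G_cont w : continuous (G w).
Proof.
move=> t; apply: cvgM; first exact: cvg_cst.
by apply: cvgB; [exact: CHld_continuous|exact: RS_cont].
Qed.

Lemma osc_integral_continuous w : continuous (osc_integral w).
Proof.
move=> t; apply: (@continuous_comp _ _ _ (tmin ^~ (osc_time w)) (G w)); last exact: G_cont.
by apply: tmin_continuous; exact: osc_time_ge0.
Qed.

Lemma RSsum_meas t : 0 <= t -> fmeas (F t) (fun w => RSsum n (A w) (X w) t).
Proof.
move=> t0; have FS := filt_salg hF t0.
apply: (@fmeas_sum _ _ _ FS n.+1 (fun k w => A w (grid n k) *
    (X w (Num.min t (grid n k.+1)) - X w (Num.min t (grid n k))))) => k kn.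
have [kt|/negP] := pselect (grid n k <= t :> R); last first.
  rewrite -ltNge => tk; apply: (@fmeas_ext _ _ _ (fun=> 0)); last exact: fmeas_cst.
  by move=> w; rewrite !min_l ?subrr ?mulr0// ltW// (lt_le_trans tk)// grid_le.
have Xmin r : 0 <= r -> fmeas (F t) (fun w => X w (Num.min t r)).
  move=> r0; have m0 : 0 <= Num.min t r by rewrite le_min t0.
  by apply: (fmeas_le hF m0); [rewrite ge_min lexx|exact: Xm].
apply: fmeasM => //.
  by apply: (fmeas_le hF _ kt); [exact: grid_ge0|apply: Am; exact: grid_ge0].
exact: (fmeasB FS (Xmin _ (grid_ge0 n k.+1)) (Xmin _ (grid_ge0 n k))).
Qed.

Lemma osc_integral_meas t : 0 <= t -> fmeas (F t) (fun w => osc_integral w t).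
Proof.
move=> t0; apply: (fmeas_stopped hF osc_time_stop t0 G_cont) => s /andP[s0 _].
have FS := filt_salg hF s0.
apply: fmeasM => //; first exact: fmeas_cst.
by apply: fmeasB => //; [exact: Zm|exact: RSsum_meas].
Qed.

Section approximants.
Variable H : simple_process F.

Definition osc_simple : simple_process F :=
  stop_simple hF (merge_simple hF H n c Am) osc_time_stop.

Let osc_sum w (f : R -> R) t : 0 <= t <= 1 ->
  \sum_(i < sp_size osc_simple) sp_val osc_simple i w *
    (f (tmin t (sp_time osc_simple i.+1 w)) - f (tmin t (sp_time osc_simple i w))) =
  c * (\sum_(i < sp_size H) sp_val H i w * (f (tmin (tmin t (osc_time w)) (sp_time H i.+1 w)) -
     f (tmin (tmin t (osc_time w)) (sp_time H i w))) - RSsum n (A w) f (tmin t (osc_time w))).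
Proof.
move=> /andP[t0 t1].
rewrite -(@merge_sum _ n (sp_size H) (sp_time H ^~ w) (sp_time0 H w)
  (fun i => sp_time_le H i w) (sp_val H ^~ w)); last first.
  by rewrite tmin_ge0 ?osc_time_ge0//= (le_trans (tmin_le _ (osc_time_ge0 w))).
apply: (@stop_sum _ _ (fun j => merge_time n (sp_size H) (sp_time H ^~ w) j) (osc_time w)
  (fun j => sp_val (merge_simple hF H n c Am) j w)); last exact: osc_time_ge0.
- by move=> j; exact: (proj1 (sp_stop (merge_simple hF H n c Am) j)).
- by move=> j; exact: (sp_time_le (merge_simple hF H n c Am) j w).
Qed.

Lemma osc_simple_integral w t : 0 <= t <= 1 ->
  simple_integral osc_simple (fun w => X w) w t =
  c * (simple_integral H (fun w => X w) w (tmin t (osc_time w)) -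
       RSsum n (A w) (X w) (tmin t (osc_time w))).
Proof. by move=> t01; exact: osc_sum. Qed.

Lemma osc_simple_eval w t : 0 <= t <= 1 ->
  `|simple_eval osc_simple w t - osc_integrand w t| <= c * `|simple_eval H w t - A w t|.
Proof.
move=> t01; have /andP[t0 t1] := t01.
have t'0 := osc_time_ge0 w.
rewrite simple_evalE mul0r add0r (osc_sum w (fun s => (t <= s)%R%:R) t01).
have [tt|tt] := leP t%:E%E (osc_time w); last first.
  have st : tmin t (osc_time w) < t.
    rewrite /tmin (min_r (ltW tt)) -lte_fin fineK//.
    by rewrite ge0_fin_numE// (lt_trans tt) ?ltry.
  have Uz : osc_integrand w t = 0.
    rewrite /osc_integrand /step_path big1// => k _.
    by rewrite /b le_min [(t%:E <= osc_time w)%E]leNgt tt !andbF mulr0.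
  rewrite Uz big1 ?sub0r ?subr0; last first.
    move=> i _; have [[h1 _] [h2 _]] := (sp_stop H i, sp_stop H i.+1).
    rewrite !leNgt (le_lt_trans (tmin_le _ (h1 w)) st) (le_lt_trans (tmin_le _ (h2 w)) st).
    by rewrite subrr mulr0.
  rewrite /RSsum big1 ?oppr0 ?mulr0 ?normr0 ?mulr_ge0// ?(ltW c0)// => k _.
  by rewrite !leNgt !gt_min st/= subrr mulr0.
rewrite tmin_id//; case: (ltrgtP t 0) t0 => // [t0|->] _; last first.
  have -> : osc_integrand w 0 = 0.
    rewrite /osc_integrand /step_path big1// => k _.
    by rewrite /a lte_fin ltNge grid_ge0/= mulr0.
  rewrite big1 ?sub0r ?subr0; last first.
    move=> i _; have [[h1 _] [h2 _]] := (sp_stop H i, sp_stop H i.+1).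
    by rewrite !tmin_ge0// subrr mulr0.
  rewrite RSsum0 oppr0 mulr0 normr0 mulr_ge0// ltW//.
have ev : \sum_(i < sp_size H) sp_val H i w * ((t <= tmin t (sp_time H i.+1 w))%R%:R -
      (t <= tmin t (sp_time H i w))%R%:R) = simple_eval H w t.
  by rewrite simple_evalE gt_eqF// mulr0 add0r.
rewrite ev.
have -> : osc_integrand w t = c * (A w t - RSsum n (A w) (fun s => (t <= s)%R%:R) t).
  have E k : ((a k w < t%:E)%E && (t%:E <= b k w)%E)%:R =
     (t <= Num.min t (grid n k.+1))%R%:R - (t <= Num.min t (grid n k))%R%:R :> R.
    rewrite -!tmin_fin ind_between ?lee_fin ?grid_le ?grid_ge0//.
    by rewrite /b le_min tt andbT.
  rewrite /osc_integrand /step_path /v.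
  under eq_bigr do rewrite E -mulrA mulrBl.
  rewrite -mulr_sumr sumrB -mulr_sumr (sum_telescope _ (fun k => (t <= Num.min t (grid n k))%R%:R)).
  rewrite gridn grid0 min_l// lexx min_r ?(ltW t0)//.
  by rewrite leNgt t0 subr0 mulr1.
by rewrite -mulrBr opprB addrA subrK normrM gtr0_norm.
Qed.

End approximants.

Lemma osc_ito : is_ito_integral P F osc_integrand (fun w => X w) osc_integral.
Proof.
split.
- by move=> t /andP[t0 _]; exact: osc_integral_meas.
- by move=> w; apply: continuous_subspaceT; exact: osc_integral_continuous.
have [_ _ [H [H1 H2]]] := hZ.
have Xc w : continuous (X w) by exact: C0Hld_continuous.
exists (fun m => osc_simple (H m)); split.
- apply: (ucp_dominated c0 _ _ _ H1).
  + by move=> m w t t01; exists t => //; exact: osc_simple_eval.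
  + move=> m e; apply: salg_unif_norm_gt => // [t /andP[t0 _]|w t /andP[t0 _]].
      by apply: fmeasB => //; [exact: (simple_eval_meas hF)|apply: (fmeas_meas hF t0); exact: U_meas].
    apply: cvgB; first exact: simple_eval_left.
    by apply: step_path_left => k; exact: v_cont.
  + move=> m e; apply: salg_unif_norm_gt => // [t /andP[t0 _]|w t /andP[t0 _]].
      by apply: fmeasB => //; [exact: (simple_eval_meas hF)|apply: (fmeas_meas hF t0); exact: Am].
    apply: cvgB; first exact: simple_eval_left.
    by apply: cvg_at_left_filter; exact: C01_continuous.
- apply: (ucp_dominated c0 _ _ _ H2).
  + move=> m w t t01; have /andP[t0 t1] := t01; exists (tmin t (osc_time w)).
      by rewrite tmin_ge0 ?osc_time_ge0//= (le_trans (tmin_le _ (osc_time_ge0 w))).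
    rewrite osc_simple_integral// /osc_integral -mulrBr normrM gtr0_norm//.
    by rewrite ler_pM2l// opprB addrA subrK.
  + move=> m e; apply: salg_unif_norm_gt => // [t /andP[t0 _]|w t /andP[t0 _]].
      by apply: fmeasB => //; [exact: (simple_integral_meas hF)|apply: (fmeas_meas hF t0); exact: osc_integral_meas].
    apply: cvg_at_left_filter; apply: cvgB; first exact: simple_integral_continuous.
    exact: osc_integral_continuous.
  + move=> m e; apply: salg_unif_norm_gt => // [t /andP[t0 _]|w t /andP[t0 _]].
      by apply: fmeasB => //; [exact: (simple_integral_meas hF)|apply: (fmeas_meas hF t0); exact: Zm].
    apply: cvg_at_left_filter; apply: cvgB; first exact: simple_integral_continuous.
    exact: CHld_continuous.
Qed.

Lemma osc_integral_hld_meas (K : R) :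
  measurable [set w | (K%:E <= hld_norm alpha (osc_integral w))%E].
Proof.
apply: salg_hld_norm_ge => //; first exact: ltW.
- by move=> t /andP[t0 _]; apply: (fmeas_meas hF t0); exact: osc_integral_meas.
- exact: osc_integral_continuous.
Qed.

Lemma osc_integral_hld_lt w (K : R) :
  (forall r r', `|r - r'| <= n.+1%:R^-1 -> `|A w r - A w r'| <= delta) ->
  (hld_norm alpha (osc_integral w) < K%:E)%E ->
  (hld_norm alpha (Z w \- RSsum n (A w) (X w)) < (delta * K)%:E)%E.
Proof.
move=> aw; have E : osc_integral w = (fun t => c * (Z w t - RSsum n (A w) (X w) t)).
  by apply/funext => t; rewrite /osc_integral osc_time_pinfty// tmin_pinfty.
have -> : Z w \- RSsum n (A w) (X w) = (fun t => delta * osc_integral w t).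
  by apply/funext => t; rewrite E mulrA divff ?mul1r// gt_eqF.
move: (osc_integral w) => f fK.
have ff : hld_norm alpha f \is a fin_num.
  by rewrite ge0_fin_numE ?hld_norm_ge0// (lt_trans fK)// ltry.
have f0 := hld_norm_ub0 alpha f.
have sf : hld_seminorm alpha f \is a fin_num.
  move: ff; rewrite /hld_norm; case: (hld_seminorm alpha f) => [r| |]//.
rewrite /hld_norm /= normrM gtr0_norm//.
have -> : hld_seminorm alpha (fun t => delta * f t) = (delta%:E * hld_seminorm alpha f)%E.
  rewrite /hld_seminorm -ereal_sup_pZl//; congr ereal_sup; apply/seteqP; split => [_ [s [t [? ? ? ->]]]|_ [_ [s [t [? ? ? ->]]] <-]] /=.
    exists (hld_quot alpha f s t)%:E; first by exists s, t.
    by rewrite -EFinM /hld_quot -mulrBr normrM gtr0_norm// mulrA.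
  exists s, t; split => //.
  by rewrite -EFinM /hld_quot -mulrBr normrM gtr0_norm// mulrA.
have dd : (`|f 0|%:E +? hld_seminorm alpha f)%E by exact: fin_num_adde_defl.
by rewrite EFinM -muleDr// EFinM lte_pmul2l.
Qed.

End Oscillation.

(** * Borel measurability *)

Section PairMeasurability.
Context {R : realType} {d : measure_display} {T : measurableType d}.

(* Separability of the second factor is enough for the Borel sets of a product
   to be generated by rectangles; E1 need not be separable. *)
Lemma pair_measurable (E1 : pseudoMetricType R) (E2 : metricType R) (I : countType)
    (D : I -> E2) (xi : T -> E1) (zeta : T -> E2) :
  (forall w (e : R), 0 < e -> exists i, ball (D i) e (zeta w)) ->
  (forall U : set E1, open U -> measurable (xi @^-1` U)) ->
  (forall i (e : R), 0 < e -> measurable [set w | ball (D i) e (zeta w)]) ->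
  forall G : set (E1 * E2), <<s open >> G ->
  measurable ((fun w => (xi w, zeta w)) @^-1` G).
Proof.
move=> Dd mxi mzeta.
pose S : set_system (E1 * E2) :=
  [set G | measurable ((fun w => (xi w, zeta w)) @^-1` G)].
have SS : sigma_algebra setT S.
  split; first by rewrite /S /= preimage_set0.
    by move=> A mA; rewrite /S /= setTD preimage_setC; exact: measurableC.
  by move=> A mA; rewrite /S /= preimage_bigcup; exact: bigcupT_measurable.
suff : open `<=` S by move=> oS; exact: (smallest_sub SS oS).
move=> G oG.
pose V i (m : nat) : set E1 := [set x | forall z, ball (D i) m.+1%:R^-1 z -> G (x, z)].
have -> : S G = measurable (\bigcup_(im : I * nat) (xi @^-1` (V im.1 im.2)^° `&`
    [set w | ball (D im.1) im.2.+1%:R^-1 (zeta w)])).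
  rewrite /S /=; congr (measurable _); apply/seteqP; split => w /=; last first.
    by move=> [[i m] _ /= [/interior_subset]]; apply.
  move=> Gw; have : nbhs (xi w, zeta w) G by apply: open_nbhs_nbhs.
  move=> /nbhs_ballP[r /= r0 rG].
  have r2 : 0 < r / 2 by rewrite divr_gt0.
  have [m /= mr] := @filter_ex _ \oo _ _ (near_inv_succ r2).
  have m0 : 0 < m.+1%:R^-1 :> R by rewrite invr_gt0.
  have [i iz] := Dd w _ m0.
  exists (i, m) => //; split => //=.
  apply: filterS (nbhsx_ballx (xi w) r r0) => x xx z iz'; apply: rG; split => //=.
  apply: (@le_ball _ _ _ (m.+1%:R^-1 + m.+1%:R^-1)).
    by rewrite (splitr r) lerD.
  by apply: ball_triangle iz'; exact: ball_sym.
apply: countable_bigcupT_measurable => //= -[i m] /=.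
apply: measurableI; last by apply: mzeta; rewrite invr_gt0.
by apply: mxi; exact: open_interior.
Qed.

End PairMeasurability.

Section HolderSeparable.
Context {R : realType} (alpha beta : R).
Hypotheses (beta0 : 0 < beta) (hba : beta < alpha).

Let alpha0 : 0 < alpha := lt_trans beta0 hba.

Lemma grid_cover n (t : R) N : 0 <= t -> t <= grid n N.+1 ->
  exists k, (k <= N)%N /\ grid n k <= t <= grid n k.+1.
Proof.
move=> t0; elim: N => [|N IH] tN.
  by exists 0%N; rewrite grid0 t0.
have [/IH[k [kN kt]]|/ltW tN'] := leP t (grid n N.+1).
  by exists k; split => //; exact: leqW.
by exists N.+1; rewrite leqnn tN tN'.
Qed.

(* Interpolation: small increments are controlled by the alpha-Hoelder bound,
   large ones by the uniform bound. *)
Lemma hld_le_interpolation (C eta rho : R) (f : R -> R) : 0 < rho ->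
  hld_le alpha C f -> (forall t, 0 <= t <= 1 -> `|f t| <= eta) ->
  hld_le beta (C * rho `^ (alpha - beta) + (eta + eta) * rho `^ (- beta)) f.
Proof.
move=> rho0 fC feta s t s0 st t1.
have C0 := hld_le_ge0 fC.
have eta0 : 0 <= eta by apply: le_trans (feta 0 _) => //; rewrite lexx ler01.
rewrite mulrDl; move: st; rewrite le_eqVlt => /predU1P[<-|st].
  by rewrite subrr normr0 addr_ge0// mulr_ge0 ?powR_ge0// mulr_ge0 ?powR_ge0// addr_ge0.
have ts : 0 < t - s by rewrite subr_gt0.
have [tr|rt] := leP (t - s) rho.
  apply: (@le_trans _ _ (C * rho `^ (alpha - beta) * (t - s) `^ beta)); last first.
    by rewrite lerDl mulr_ge0 ?powR_ge0// mulr_ge0 ?powR_ge0// addr_ge0.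
  apply: le_trans (fC s t s0 (ltW st) t1) _; rewrite -mulrA ler_wpM2l//.
  have -> : (t - s) `^ alpha = (t - s) `^ (alpha - beta) * (t - s) `^ beta.
    by rewrite -powRD ?subrK//; apply/implyP => _; rewrite gt_eqF.
  rewrite ler_wpM2r ?powR_ge0// ge0_ler_powR ?nnegrE ?subr_ge0//; exact: ltW.
apply: (@le_trans _ _ ((eta + eta) * rho `^ (- beta) * (t - s) `^ beta)); last first.
  by rewrite lerDr mulr_ge0 ?powR_ge0// mulr_ge0 ?powR_ge0.
apply: (@le_trans _ _ (eta + eta)).
  apply: le_trans (ler_normB _ _) _; apply: lerD; apply: feta.
    by rewrite t1 (le_trans s0)// ltW.
  by rewrite s0 (le_trans _ t1)// ltW.
rewrite -mulrA ler_peMr ?addr_ge0// powRN mulrC ler_pdivlMr ?powR_gt0// mul1r.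
by apply: ge0_ler_powR; rewrite ?nnegrE ?ltW.
Qed.

Let idx := (nat * nat * seq rat)%type.

Let close (i : idx) (z : CHld alpha) := (hld_norm alpha z <= i.1.1%:R%:E)%E /\
  forall k, (k <= i.1.2.+1)%N -> `|z (grid i.1.2 k) - ratr (nth 0 i.2 k)| <= i.1.2.+1%:R^-1.

Lemma CHld_separable (z0 : CHld alpha) : exists D : nat * nat * seq rat -> CHld alpha,
  forall (z : CHld alpha) (e : R), 0 < e ->
    exists i, ball (CHld_C0Hld hba (D i)) e (CHld_C0Hld hba z).
Proof.
have /choice[D DP] : forall i : idx, exists y, (exists z, close i z) -> close i y.
  move=> i; have [[z iz]|nz] := pselect (exists z, close i z); first by exists z.
  by exists z0 => /nz.
exists D => z e e0.
have zf : hld_norm alpha z \is a fin_num.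
  by rewrite ge0_fin_numE ?hld_norm_ge0// CHld_fin.
pose K := Num.bound (fine (hld_norm alpha z)).
have zK : (hld_norm alpha z <= K%:R%:E)%E.
  rewrite -(fineK zf) lee_fin ltW//; apply: archi_boundP.
  by rewrite fine_ge0// hld_norm_ge0.
pose C : R := K%:R + K%:R.
have C0 : 0 <= C by rewrite addr_ge0.
have e4 : 0 < e / 4 by rewrite divr_gt0.
have C1 : 0 < C + 1 by rewrite ltr_wpDl.
have small (x c : R) : 0 < x -> 0 < c -> exists2 r : R, 0 < r &
    forall s, 0 < s -> s < r -> (C + 1) * s `^ x <= c.
  move=> x0 c0; have := @powR_cvg0 R x x0 => /cvgrPdist_lt.
  move=> /(_ (c / (C + 1)) (divr_gt0 c0 C1)).
  rewrite /at_right near_withinE => /nbhs_ballP[r /= r0 hr].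
  exists r => // s s0 sr; have := hr s; rewrite /ball/= sub0r normrN gtr0_norm//.
  move=> /(_ sr s0); rewrite sub0r normrN ger0_norm ?powR_ge0// => h.
  by rewrite mulrC -ler_pdivlMr// ltW.
have ab : 0 < alpha - beta by rewrite subr_gt0.
have [r1 r10 hr1] := small _ _ ab e4.
pose rho := r1 / 2.
have rho0 : 0 < rho by rewrite divr_gt0.
have hrho : C * rho `^ (alpha - beta) <= e / 4.
  apply: le_trans (hr1 rho rho0 _); last by rewrite [ltRHS](splitr r1) ltrDl.
  by rewrite ler_wpM2r ?powR_ge0// lerDl.
pose eta := Num.min (e / 4) (e / 4 / 2 * rho `^ beta).
have eta0 : 0 < eta by rewrite lt_min e4 mulr_gt0 ?divr_gt0// powR_gt0.
have eta2 : 0 < eta / 4 by rewrite divr_gt0.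
have [r2 r20 hr2] := small _ _ alpha0 eta2.
have r22 : 0 < Num.min (eta / 4) (r2 / 2) by rewrite lt_min eta2 divr_gt0.
have [n /= nr] := @filter_ex _ \oo _ _ (near_inv_succ r22).
move: nr; rewrite le_min => /andP[neta nr2].
have n0 : 0 < n.+1%:R^-1 :> R by rewrite invr_gt0.
have /choice[q hq] : forall k, exists q : rat, `|z (grid n k) - ratr q| <= n.+1%:R^-1.
  move=> k; have m : z (grid n k) - n.+1%:R^-1 < z (grid n k) + n.+1%:R^-1.
    by rewrite ltrBlDr -addrA ltrDl addr_gt0.
  have [q] := rat_in_itvoo m; rewrite in_itv/= => /andP[h1 h2].
  by exists q; rewrite distrC ler_distl (ltW h1) (ltW h2).
pose i : idx := (K, n, mkseq q n.+2).
have iz : close i z.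
  split => [|k kn]; first exact: zK.
  by rewrite /= nth_mkseq.
have [yK yq] := DP i (ex_intro _ z iz).
exists i; apply/C0Hld_ballP.
pose y := D i; rewrite -/y in yK yq *.
have hy : hld_le alpha K%:R y := hld_le_norm yK.
have hz : hld_le alpha K%:R z := hld_le_norm zK.
have hyz : hld_le alpha C (y \- z) := hld_leB hy hz.
have sup t : 0 <= t <= 1 -> `|(y \- z) t| <= eta.
  move=> /andP[t0 t1].
  have tn : t <= grid n n.+1 by rewrite gridn.
  have [k [kn /andP[kt tk]]] := grid_cover t0 tn.
  have k1 : t - grid n k <= n.+1%:R^-1 by rewrite lerBlDl -gridS.
  have g1 : `|(y \- z) t - (y \- z) (grid n k)| <= eta / 4.
    apply: le_trans (hyz _ _ (grid_ge0 n k) kt t1) _.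
    apply: le_trans (hr2 n.+1%:R^-1 n0 _); last first.
      by apply: le_lt_trans nr2 _; rewrite [ltRHS](splitr r2) ltrDl divr_gt0.
    apply: (@le_trans _ _ (C * n.+1%:R^-1 `^ alpha)).
      by rewrite ler_wpM2l// ge0_ler_powR ?nnegrE ?subr_ge0// ltW.
    by rewrite ler_wpM2r ?powR_ge0// lerDl.
  have kn' : (k <= n.+1)%N by exact: leqW.
  have := yq k kn'; have := iz.2 k kn'; rewrite /= => g2 g3.
  have g4 : `|(y \- z) (grid n k)| <= eta / 4 + eta / 4.
    rewrite /= -(subrK (ratr (nth 0 (mkseq q n.+2) k)) (y _)) -addrA.
    apply: le_trans (ler_normD _ _) _; apply: lerD; first exact: le_trans neta.
    by rewrite distrC; exact: le_trans neta.
  rewrite -[y t - z t](subrK (y (grid n k) - z (grid n k))).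
  apply: le_trans (ler_normD _ _) _; apply: le_trans (lerD g1 g4) _; lra.
have hb := hld_le_interpolation rho0 hyz sup.
have s0 : `|(y \- z) 0| <= eta by apply: sup; rewrite lexx ler01.
apply: le_lt_trans (hld_norm_le s0 hb) _; rewrite lte_fin.
have h1 : eta <= e / 4 by rewrite ge_min lexx.
have h2 : (eta + eta) * rho `^ (- beta) <= e / 4.
  rewrite powRN ler_pdivrMr ?powR_gt0//.
  have : eta <= e / 4 / 2 * rho `^ beta by rewrite ge_min lexx orbT.
  move: (rho `^ beta) => u; lra.
lra.
Qed.

End HolderSeparable.

Section TripleMeasurability.
Context {R : realType} {d : measure_display} {T : measurableType d}.
Variables (alpha beta : R) (beta0 : 0 < beta) (hba : beta < alpha).

Lemma pair_CHld_measurable (E1 : pseudoMetricType R) (xi : T -> E1) (Z : T -> CHld alpha) :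
  (forall G : set E1, <<s open >> G -> measurable (xi @^-1` G)) ->
  (forall t : R, 0 <= t <= 1 -> fmeas measurable (fun w => Z w t)) ->
  forall G : set (E1 * C0Hld beta), <<s open >> G ->
  measurable ((fun w => (xi w, CHld_C0Hld hba (Z w))) @^-1` G).
Proof.
move=> mxi mZ.
have [D DP] := CHld_separable beta0 hba (Z point).
apply: (pair_measurable (D := fun i => CHld_C0Hld hba (D i))).
- by move=> w e e0; exact: DP.
- by move=> U oU; apply: mxi; exact: sub_sigma_algebra.
move=> i e e0; have mT := @sigma_algebra_measurable d T.
pose f w t := D i t - Z w t.
have -> : [set w | ball (CHld_C0Hld hba (D i)) e (CHld_C0Hld hba (Z w))] =
    ~` [set w | (e%:E <= hld_norm beta (f w))%E].
  apply/seteqP; split => w /=; first by move=> /C0Hld_ballP h; apply/negP; rewrite -ltNge.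
  by move=> /negP; rewrite -ltNge => h; apply/C0Hld_ballP.
apply: (salgC mT); apply: (salg_hld_norm_ge mT); first exact: ltW.
  by move=> t t01; apply: (fmeasB mT); [exact: fmeas_cst|exact: mZ].
have alpha0 : 0 < alpha := lt_trans beta0 hba.
by move=> w t; apply: cvgB; exact: CHld_continuous.
Qed.

End TripleMeasurability.

(** * The large deviation principle *)

Section ItoLDP.
Context {R : realType} {d : measure_display} {T : measurableType d}.
Variables (P : probability T R) (F : R -> set_system T).
Hypothesis hF : usual_filtration P F.
Variables (alpha beta : R).
Hypotheses (alpha0 : 0 < alpha) (beta0 : 0 < beta) (hba : beta < alpha).
Variables (X : R -> T -> C0Hld alpha) (A : R -> T -> C01 R) (Z : R -> T -> CHld alpha).
Hypothesis hX : forall e : R, 0 < e <= 1 -> adapted F (fun w => X e w).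
Hypothesis hA : forall e : R, 0 < e <= 1 -> adapted F (fun w => A e w).
Hypothesis hZ : forall e : R, 0 < e <= 1 ->
  is_ito_integral P F (fun w => A e w) (fun w => X e w) (fun w => Z e w).
Variable Isharp : C01 R * C0Hld alpha -> \bar R.
Hypothesis hLDP : satisfies_LDP P (fun (e : R) (w : T) => (A e w, X e w)) Isharp.
Hypothesis hUET : unif_exp_tight P F alpha (fun (e : R) (w : T) => X e w).

Local Notation E1 := (C01 R * C0Hld alpha)%type.
Let xi (e : R) (w : T) : E1 := (A e w, X e w).
Let mT : sigma_algebra setT (@measurable d T) := @sigma_algebra_measurable d T.

Let I_ge0 y : (0 <= Isharp y)%E. Proof. by have [[]] := hLDP. Qed.

Let I_cpt (lambda : R) : 0 <= lambda -> compact [set y | (Isharp y <= lambda%:E)%E].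
Proof. by have [[_ +] _ _] := hLDP; exact. Qed.

Let xi_meas (e : R) (G : set E1) : 0 < e <= 1 -> <<s open >> G -> measurable (xi e @^-1` G).
Proof. by have [_ h _] := hLDP => e01; exact: h. Qed.

Let Xm (e t : R) : 0 < e <= 1 -> 0 <= t -> fmeas (F t) (fun w => X e w t).
Proof. by move=> e01; apply: (adapted_fmeas hF _ (hX e01)) => w s; exact: C0Hld_clamp. Qed.

(* Integrating the deterministic step function of signs of the increments of x
   bounds the variation of x by the Hoelder norm of the integral. *)
Lemma rate_var_bound (M : R) : 0 < M -> exists2 K : R, 0 < K & forall y,
  (Isharp y < M%:E)%E -> var_bound alpha K y.2.
Proof.
move=> M0; have [K K0 /limf_esup_expRP supK] := hUET M0; exists K => // y IyM N p pm p0 pN.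
rewrite leNgt; apply/negP => big.
pose h i := Num.sg (y.2 (p i.+1) - y.2 (p i)).
have hE : \sum_(i < N) `|y.2 (p i.+1) - y.2 (p i)| =
    \sum_(i < N) h i * (y.2 (p i.+1) - y.2 (p i)).
  by apply: eq_bigr => i _; rewrite normrEsg.
have pst i : (i <= N)%N -> p 0%N <= p i <= p N by move=> iN; rewrite !nondec_nat.
have pNN : p 0%N < p N.
  have : p 0%N <= p N by apply: nondec_nat.
  rewrite le_eqVlt => /predU1P[p0N|//]; move: big.
  rewrite p0N subrr powR0 ?gt_eqF// mulr0 big1 ?ltxx// => i _.
  have E j : (j <= N)%N -> p j = p 0%N.
    by move=> jN; apply/eqP; rewrite eq_le andbC; have := pst j jN; rewrite -p0N.
  by rewrite !E ?subrr ?normr0// ltnW.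
pose S (x : R -> R) : R := \sum_(i < N) h i * (x (p i.+1) - x (p i)).
pose L := K * (p N - p 0%N) `^ alpha.
pose O : set E1 := [set y' : E1 | L < S y'.2].
have Oopen : open O.
  rewrite openE => y' /= Oy'.
  have r0 : 0 < (S y'.2 - L) / (4 * N.+1%:R).
    by rewrite divr_gt0 ?subr_gt0// mulr_gt0// ltr0n.
  apply: filterS (nbhsx_ballx y' _ r0) => y'' [_ b]; rewrite /O /=.
  set r := (_ / _) in r0 b.
  have rE : S y'.2 - L = r * 4 * N.+1%:R.
    by rewrite /r -mulrA divfK// mulf_neq0// ?pnatr_eq0.
  clearbody r.
  have : `|S y'.2 - S y''.2| <= \sum_(i < N) (r + r + (r + r)).
    rewrite /S -sumrB; apply: le_trans (ler_norm_sum _ _ _) _; apply: ler_sum => i _.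
    rewrite -mulrBr normrM.
    have h1 : `|h i| <= 1 by rewrite normr_sg; case: (_ != 0).
    apply: le_trans (ler_wpM2r (normr_ge0 _) h1) _; rewrite mul1r.
    have b1 := C0Hld_ball_pt (p i.+1) alpha0 b; have b2 := C0Hld_ball_pt (p i) alpha0 b.
    have -> : y'.2 (p i.+1) - y'.2 (p i) - (y''.2 (p i.+1) - y''.2 (p i)) =
      (y'.2 (p i.+1) - y''.2 (p i.+1)) - (y'.2 (p i) - y''.2 (p i)) by ring.
    by apply: le_trans (ler_normB _ _) _; exact: lerD.
  rewrite sumr_const card_ord -[(r + r + (r + r)) *+ N]mulr_natr => hS.
  have := ler_norm (S y'.2 - S y''.2); move: hS rE; rewrite -[N.+1%:R]natr1.
  move: (S y'.2) (S y''.2) (N%:R : R) => u v k hS rE hn.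
  suff : 0 < v - L by rewrite subr_gt0.
  have -> : v - L = (u - L) - (u - v) by ring.
  rewrite rE subr_gt0; apply: le_lt_trans (le_trans hn hS) _.
  rewrite -subr_gt0. rewrite (_ : _ - _ = 4 * r); last by ring.
  by rewrite mulr_gt0.
have Oy : O y by rewrite /O /= /S -hE.
have bO : <<s open >> O by exact: borel_open.
pose p' i := if i is j.+1 then p j else 0.
pose h' i := if i is j.+1 then h j else 0.
have p'0 : p' 0%N = 0 by [].
have p'm i : p' i <= p' i.+1 by case: i.
have h'1 i : `|h' i| <= 1.
  by case: i => [|i] /=; rewrite ?normr0// normr_sg; case: (_ != 0).
pose sup (e : R) := ereal_sup [set q : \bar R | exists U Y, [/\ unit_integrand F U,
  is_ito_integral P F U (fun w => X e w) Y & q = P [set w | (K%:E <= hld_norm alpha (Y w))%E]]].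
have cmp (e : R) : 0 < e <= 1 -> (P (xi e @^-1` O) <= sup e)%E.
  move=> e01.
  have Xc w : continuous (X e w) by exact: C0Hld_continuous.
  have Xme s : 0 <= s -> fmeas (F s) (fun w => X e w s) by move=> s0; exact: Xm.
  pose H := det_simple hF N.+1 h' p'0 p'm.
  pose Y := simple_integral H (fun w => X e w).
  have YE w t : Y w t = \sum_(i < N) h i * (X e w (Num.min t (p i.+1)) - X e w (Num.min t (p i))).
    by rewrite /Y det_integralE big_ord_recl /= mul0r add0r.
  apply: (@le_trans _ _ (P [set w | (K%:E <= hld_norm alpha (Y w))%E])); last first.
    apply: ereal_sup_ubound; exists (simple_eval H), Y; split => //.
      exact: det_unit_integrand.
    exact: det_ito.
  apply: le_measure; rewrite ?inE.
  - exact: xi_meas.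
  - apply: (salg_hld_norm_ge mT); first exact: ltW.
      by move=> t /andP[t0 _]; apply: (simple_integral_meas hF).
    by move=> w; exact: simple_integral_continuous.
  move=> w /= Ow; have p01 : p N <= 1 := pN.
  apply: le_trans (hld_norm_ub alpha (Y w) p0 pNN pN); rewrite lee_fin.
  rewrite /hld_quot ler_pdivlMr ?powR_gt0 ?subr_gt0// ltW//.
  have -> : Y w (p 0%N) = 0.
    rewrite YE big1// => i _; rewrite !min_l ?subrr ?mulr0//.
      by have /andP[] := pst i (ltnW (ltn_ord i)).
    by have /andP[] := pst i.+1 (ltn_ord i).
  rewrite subr0 YE; apply: lt_le_trans (ler_norm _).
  rewrite (eq_bigr (fun i : 'I_N => h i * (X e w (p i.+1) - X e w (p i))))// => i _.
  rewrite !min_r//; first by have /andP[] := pst i (ltnW (ltn_ord i)).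
  by have /andP[] := pst i.+1 (ltn_ord i).
have [i Ii] : exists i : R, Isharp y = i%:E.
  by exists (fine (Isharp y)); rewrite fineK// ge0_fin_numE// (lt_trans IyM)// ltry.
rewrite Ii lte_fin in IyM.
have : ((- i)%:E <= limf_einf (fun e : R => e%:E * lne (P (xi e @^-1` O))) 0^'+)%E.
  have [_ _ /(_ _ bO) [+ _ _]] := hLDP; apply: le_trans.
  rewrite EFinN leeN2 -Ii; apply: ereal_inf_lbound; exists y => //.
  by rewrite (interior_id _).1.
pose m1 := (i + i + M) / 3; pose m2 := (i + M + M) / 3.
have im1 : i < m1 by rewrite /m1; lra.
have m12 : m1 < m2 by rewrite /m1 /m2; lra.
have m2M : m2 < M by rewrite /m2; lra.
move=> /limf_einf_expRP /(_ _ im1) lowP.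
have [e [[e01 e1] e2]] := @filter_ex _ (0 : R)^'+ _ _ (filterI (filterI near0_unit lowP) (supK _ m2M)).
have := le_trans e1 (le_trans (cmp e e01) e2); rewrite lee_fin ler_expR.
have /andP[e0 _] := e01; rewrite ler_pM2r ?invr_gt0// lerN2.
by rewrite leNgt m12.
Qed.

Let osc_set (n : nat) (delta : R) : set E1 := [set y : E1 | exists r r',
  `|r - r'| <= n.+1%:R^-1 /\ delta < `|y.1 r - y.1 r'|].

Lemma rate_osc (delta M : R) : 0 < delta -> 0 <= M -> \forall n \near \oo,
  (M%:E <= ereal_inf (Isharp @` closure (closure (osc_set n delta))))%E.
Proof.
move=> d0 M0; have d2 : 0 < delta / 2 by rewrite divr_gt0.
have := compact_modulus (I_cpt M0) d2; apply: filterS => n cm.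
apply: le_ereal_inf_tmp => _ [y Cy <-]; rewrite leNgt; apply/negP => /ltW Iy.
move: Cy; rewrite -((closure_id _).1 (@closed_closure _ (osc_set n delta))).
have d4 : 0 < delta / 4 by rewrite divr_gt0.
move=> /(_ (ball y (delta / 4)) (nbhsx_ballx y _ d4)) [y' [[r [r' [rr dy']]] [/C01_ball b _]]].
have := cm y Iy r r' rr; have := b r; have := b r'.
have E : y'.1 r - y'.1 r' = - (y.1 r - y'.1 r) + (y.1 r' - y'.1 r') + (y.1 r - y.1 r').
  by ring.
move=> b1 b2 b3; move: dy'; rewrite E ltNge => /negP; apply.
apply: le_trans (ler_normD _ _) _; apply: le_trans (lerD (ler_normD _ _) (lexx _)) _.
rewrite normrN; lra.
Qed.

Lemma exp_good_RSsum (eta m : R) : 0 < eta -> \forall n \near \oo,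
  \forall e \near 0^'+, exists B : set T, [/\ measurable B,
    forall w, ~ B w -> ball (RSsum_C0Hld alpha0 hba n (xi e w)) eta (CHld_C0Hld hba (Z e w)) &
    (P B <= (expR (- m / e))%:E)%E].
Proof.
move=> eta0; pose M := `|m| + 1.
have M0 : 0 < M by rewrite ltr_wpDl.
have mM : m < M by rewrite (le_lt_trans (ler_norm m))// ltrDl.
have [K K0 /limf_esup_expRP supK] := hUET M0.
pose delta := eta / K.
have d0 : 0 < delta by rewrite divr_gt0.
have := rate_osc d0 (ltW M0); apply: filterS => n infM.
pose C := closure (osc_set n delta).
have bC : <<s open >> C.
  by apply: borel_closed; exact: closed_closure.
have : (limf_esup (fun e : R => e%:E * lne (P (xi e @^-1` C))) 0^'+ <= (- M)%:E)%E.
  have [_ _ /(_ _ bC) [_ _]] := hLDP; move=> /le_trans; apply.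
  by rewrite EFinN leeN2.
pose m1 := (m + M) / 2.
have mm1 : m < m1 by rewrite /m1; lra.
have m1M : m1 < M by rewrite /m1; lra.
move=> /limf_esup_expRP /(_ _ m1M) PC.
have PUET := supK _ m1M.
near=> e.
have e01 : 0 < e <= 1 by near: e; exact: near0_unit.
have PCe : (P (xi e @^-1` C) <= (expR (- m1 / e))%:E)%E by near: e.
have PK : (ereal_sup [set q : \bar R | exists U Y, [/\ unit_integrand F U,
    is_ito_integral P F U (fun w => X e w) Y &
    q = P [set w | (K%:E <= hld_norm alpha (Y w))%E]]] <= (expR (- m1 / e))%:E)%E.
  by near: e.
have twoe : 2 * expR (- m1 / e) <= expR (- m / e) by near: e; exact: near_expR_rate.
pose Y := osc_integral (A e) (X e) (Z e) n delta.
exists ([set w | (K%:E <= hld_norm alpha (Y w))%E] `|` xi e @^-1` C).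
have mY : measurable [set w | (K%:E <= hld_norm alpha (Y w))%E].
  exact: (osc_integral_hld_meas hF alpha0 (hA e01) (hX e01) (hZ e01) n d0 K).
have mC := xi_meas e01 bC.
split; first exact: measurableU.
- move=> w /not_orP[/negP YK nC]; rewrite -ltNge in YK.
  apply/C0Hld_ballP; rewrite hld_norm_sym.
  apply: le_lt_trans (hld_norm_mono _ (ltW hba)) _.
  have -> : eta = delta * K by rewrite /delta divfK// gt_eqF.
  apply: (osc_integral_hld_lt d0) YK => r r' rr.
  rewrite leNgt; apply/negP => dA; apply: nC; apply: subset_closure.
  by exists r, r'.
have PU : (P ([set w | (K%:E <= hld_norm alpha (Y w))%E] `|` xi e @^-1` C) <=
    P [set w | (K%:E <= hld_norm alpha (Y w))%E] + P (xi e @^-1` C))%E by exact: measureU2.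
apply: (le_trans PU).
apply: (@le_trans _ _ ((expR (- m1 / e))%:E + (expR (- m1 / e))%:E)%E).
  apply: leeD => //; apply: le_trans PK.
  apply: ereal_sup_ubound; exists (osc_integrand (A e) n delta), Y; split => //.
    exact: (osc_unit_integrand hF (hA e01)).
  exact: (osc_ito hF alpha0 (hA e01) (hX e01) (hZ e01) n d0).
by rewrite -EFinD lee_fin -mulr2n -mulr_natl.
Unshelve. all: by end_near. Qed.

Lemma ito_LDP : satisfies_LDP P
  (fun (e : R) (w : T) => (A e w, X e w, CHld_C0Hld hba (Z e w)))
  (@ito_rate R alpha beta Isharp).
Proof.
have [Psi PsiP] := RSint_C0Hld_exists alpha0 hba.
have vb y : (Isharp y < +oo)%E -> exists K, var_bound alpha K y.2.
  move=> Iy; have f0 : 0 <= fine (Isharp y) by rewrite fine_ge0.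
  have [K _ h] := rate_var_bound (ltr_wpDl f0 ltr01); exists K; apply: h.
  by rewrite -[X in (X < _)%E]fineK ?ge0_fin_numE// lte_fin ltrDl.
apply: (@LDP_graph _ _ _ P _ _ xi (fun e w => CHld_C0Hld hba (Z e w)) Isharp _
  (RSsum_C0Hld alpha0 hba) Psi) => //.
- exact: RSsum_C0Hld_continuous.
- move=> e e01; apply: pair_CHld_measurable => //.
    by move=> G bG; exact: xi_meas.
  move=> t t01; have [h _ _] := hZ e01; have /andP[t0 _] := t01.
  by apply: (fmeas_meas hF t0) => B mB; exact: h.
- exact: exp_good_RSsum.
- move=> lambda eta eta0.
  have M0 : 0 < `|lambda| + 1 by rewrite ltr_wpDl.
  have [K K0 hK] := rate_var_bound M0.
  have w0 : 0 < eta / 2 / K by rewrite !divr_gt0.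
  have := compact_modulus (I_cpt (normr_ge0 lambda)) w0; apply: filterS => n cm y Iy.
  have Iy' : (Isharp y <= `|lambda|%:E)%E by rewrite (le_trans Iy)// lee_fin ler_norm.
  have xK : var_bound alpha K y.2.
    by apply: hK; rewrite (le_lt_trans Iy')// lte_fin ltrDl.
  have [_ h] := PsiP y K xK; apply: (h n (eta / 2 / K)).
    by move=> r r' rr; apply/ltW/cm.
  by rewrite divfK ?gt_eqF// [ltRHS](splitr eta) ltrDl divr_gt0.
- move=> [a x] Iy; have [K xK] := vb _ Iy; have [h _] := PsiP _ K xK.
  rewrite /ito_rate asboolT//; split; [exact: var_bound_BV xK|exact: h].
- move=> [a x] z; rewrite /ito_rate; case: asboolP => // -[_ hz] Iy; split => //.
  have [K xK] := vb _ Iy; have [h _] := PsiP _ K xK.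
  apply: C0Hld_eq => t t01; have /andP[t0 _] := t01.
  exact: RS_unique t0 (hz t t01) (h t t01).
- by move=> [[a x] z]; rewrite /ito_rate; case: ifP => // _; rewrite leey.
Qed.

End ItoLDP.

Theorem theorem2p6 (R : realType) (d : measure_display) (T : measurableType d)
  (P : probability T R) (F : R -> set_system T) (hF : usual_filtration P F)
  (alpha beta : R) (halpha : 0 < alpha <= 1) (hbeta : 0 < beta)
  (hba : beta < alpha)
  (X : R -> T -> C0Hld alpha) (A : R -> T -> C01 R) (Z : R -> T -> CHld alpha)
  (hX : forall e : R, 0 < e <= 1 ->
     continuous_semimartingale P F (fun w : T => X e w))
  (hA : forall e : R, 0 < e <= 1 -> adapted F (fun w : T => A e w))
  (hZ : forall e : R, 0 < e <= 1 ->
     is_ito_integral P F (fun w : T => A e w) (fun w : T => X e w) (fun w : T => Z e w))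
  (Isharp : C01 R * C0Hld alpha -> \bar R)
  (hLDP : satisfies_LDP P (fun (e : R) (w : T) => (A e w, X e w)) Isharp)
  (hUET : unif_exp_tight P F alpha (fun (e : R) (w : T) => X e w)) :
  satisfies_LDP P (fun (e : R) (w : T) => (A e w, X e w, CHld_C0Hld hba (Z e w)))
    (@ito_rate R alpha beta Isharp).
Proof.
have /andP[alpha0 _] := halpha.
apply: (ito_LDP hF alpha0 hbeta) => // e e01.
by have [] := hX e e01.
Qed.
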